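(* Let $R$ be an admissible ring. Then $R$ is Gorenstein if and only if $$\Gamma_{R:\mathcal{E}}=\{\alpha\in D_{\Gamma_R}\mid\Delta^{\Gamma_{\mathcal{E}}}(\tau^{\Gamma_R}-\alpha)=\emptyset\}$$ for every $\mathcal{E}\in\mathfrak{R}_R$.
   Context: Rings: all rings are commutative and unitary. A one-dimensional Noetherian ring $R$ is Cohen–Macaulay if $\operatorname{depth}(R_{\mathfrak m})=1$ for all maximal ideals $\mathfrak m$. $Q_R$ is the total ring of fractions of $R$, $Q_R^{\mathrm{reg}}$ the set of its regular elements, $T^{\mathrm{reg}}:=T\cap Q_R^{\mathrm{reg}}$ for $T\subseteq Q_R$, and $\overline{R}$ the integral closure of $R$ in $Q_R$. A fractional ideal of $R$ is an $R$-submodule $\mathcal{E}\subseteq Q_R$ with $r\mathcal{E}\subseteq R$ for some $r\in R^{\mathrm{reg}}$; it is regular if $\mathcal{E}^{\mathrm{reg}}\ne\emptyset$. $\mathfrak{R}_R$ is the set of regular fractional ideals. $R:\mathcal{E}:=\{x\in Q_R\mid x\mathcal{E}\subseteq R\}$. Values: let $R$ be a one-dimensional semilocal Cohen–Macaulay ring. $\mathfrak{V}_R$ is the set of valuation rings of $Q_R$ over $R$, i.e. subrings $V$ with $R\subseteq V\subsetneq Q_R$ such that $Q_R\setminus V$ is multiplicatively closed. This set is finite and nonempty; each $V\in\mathfrak{V}_R$ is a discrete valuation ring in the sense that it has a unique regular maximal ideal $\mathfrak{m}_V$, which is invertible and is the only regular prime ideal of $V$. The associated discrete valuation $\nu_V\colon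 Q_R\to\mathbb{Z}\cup\{\infty\}$ is $\nu_V(x)=\max\{k\in\mathbb{Z}\mid x\in\mathfrak{m}_V^k\}$, with $\nu_V(x)=\infty$ if $x\in\bigcap_k\mathfrak{m}_V^k$. Set $\nu=(\nu_V)_{V\in\mathfrak{V}_R}$ and, for $\mathcal{E}\in\mathfrak{R}_R$, $\Gamma_{\mathcal{E}}:=\nu(\mathcal{E}^{\mathrm{reg}})\subseteq\mathbb{Z}^{\mathfrak{V}_R}$. $R$ is admissible if it is a one-dimensional semilocal Cohen–Macaulay ring that is analytically reduced (its completion $\widehat{R}$ at the Jacobson radical is reduced), residually rational ($\overline{R}/\mathfrak{n}=R/(\mathfrak{n}\cap R)$ for all maximal ideals $\mathfrak{n}$ of $\overline{R}$) and has large residue fields ($|R/\mathfrak{m}|\ge|\mathfrak{V}_{R_{\mathfrak{m}}}|$ for all maximal ideals $\mathfrak{m}$ of $R$). Semigroup notation: for admissible $R$, the group of differences of $\Gamma_R$ is $D_{\Gamma_R}=\mathbb{Z}^I$ with $I=\mathfrak{V}_R$, with componentwise order. The conductor of $\Gamma_R$ is $\gamma^{\Gamma_R}:=\min\{\alpha\in\mathbb{Z}^I\mid\alpha+\mathbb{N}^I\subseteq\Gamma_R\}$ ($\mathbb{N}=\{0,1,\dots\}$; this minimum exists), and $\tau^{\Gamma_R}:=\gamma^{\Gamma_R}-(1,\dots,1)$. For $\alpha\in\mathbb{Z}^I$, $\Delta(\alpha):=\bigcup_{i\in I}\{\beta\in\mathbb{Z}^I\mid\beta_i=\alpha_i,\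 \beta_j>\alpha_j\text{ for all }j\in I\setminus\{i\}\}$, and for a subset $E\subseteq\mathbb{Z}^I$, $\Delta^E(\alpha):=\Delta(\alpha)\cap E$. *)

(* Defs.v *)
From HB Require Import structures.
From mathcomp Require Import all_boot all_order all_algebra.
From mathcomp Require Import generic_quotient.
From mathcomp Require Import boolp classical_sets functions cardinality.
From mathcomp Require Import constructive_ereal.
From mathcomp Require Import ring.

Set Implicit Arguments.
Unset Strict Implicit.
Unset Printing Implicit Defensive.

Import GRing.Theory.
Local Open Scope classical_set_scope.
Local Open Scope ring_scope.
Local Open Scope quotient_scope.

(* Rings are commutative and unitary; the zero ring is allowed ([comPzRingType])
   because a localization may vanish.  Subrings, ideals and fractional ideals
   are Prop-valued sets. *)

(* A [preRing T] carries the ring operations on representatives, the ring laws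
   holding up to [pre_eqv]; [preQuot] is the ring of equivalence classes. It is
   used both for localizations and for adic completions. *)

Record preRing (T : choiceType) := PreRing {
  pre_eqv : equiv_rel T;
  pre_zero : T;
  pre_one : T;
  pre_opp : T -> T;
  pre_add : T -> T -> T;
  pre_mul : T -> T -> T;
  pre_opp_eqv : forall x x', pre_eqv x x' -> pre_eqv (pre_opp x) (pre_opp x');
  pre_add_eqv : forall x x' y y', pre_eqv x x' -> pre_eqv y y' ->
    pre_eqv (pre_add x y) (pre_add x' y');
  pre_mul_eqv : forall x x' y y', pre_eqv x x' -> pre_eqv y y' ->
    pre_eqv (pre_mul x y) (pre_mul x' y');
  pre_addA : forall x y z,
    pre_eqv (pre_add x (pre_add y z)) (pre_add (pre_add x y) z);
  pre_addC : forall x y, pre_eqv (pre_add x y) (pre_add y x);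
  pre_add0 : forall x, pre_eqv (pre_add pre_zero x) x;
  pre_addN : forall x, pre_eqv (pre_add (pre_opp x) x) pre_zero;
  pre_mulA : forall x y z,
    pre_eqv (pre_mul x (pre_mul y z)) (pre_mul (pre_mul x y) z);
  pre_mulC : forall x y, pre_eqv (pre_mul x y) (pre_mul y x);
  pre_mul1 : forall x, pre_eqv (pre_mul pre_one x) x;
  pre_mulD : forall x y z,
    pre_eqv (pre_mul (pre_add x y) z) (pre_add (pre_mul x z) (pre_mul y z))
}.

Definition preQuot (T : choiceType) (P : preRing T) := {eq_quot (pre_eqv P)}.

Section PreQuot.
Variables (T : choiceType) (P : preRing T).

HB.instance Definition _ := EqQuotient.on (preQuot P).
HB.instance Definition _ := Choice.on (preQuot P).

Definition to_quot (x : T) : preQuot P := \pi_(preQuot P) x.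

Let opp (a : preQuot P) := to_quot (pre_opp P (repr a)).
Let add (a b : preQuot P) := to_quot (pre_add P (repr a) (repr b)).
Let mul (a b : preQuot P) := to_quot (pre_mul P (repr a) (repr b)).

Lemma to_quot_eq x y : to_quot x = to_quot y <-> pre_eqv P x y.
Proof. by split=> [/eqmodP|xy]; last apply/eqmodP. Qed.

Lemma repr_to_quot x : pre_eqv P (repr (to_quot x)) x.
Proof. by apply/to_quot_eq; rewrite /to_quot reprK. Qed.

Let oppE x : opp (to_quot x) = to_quot (pre_opp P x).
Proof. by apply/to_quot_eq/pre_opp_eqv/repr_to_quot. Qed.

Let addE x y : add (to_quot x) (to_quot y) = to_quot (pre_add P x y).
Proof. by apply/to_quot_eq/pre_add_eqv; apply: repr_to_quot. Qed.

Let mulE x y : mul (to_quot x) (to_quot y) = to_quot (pre_mul P x y).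
Proof. by apply/to_quot_eq/pre_mul_eqv; apply: repr_to_quot. Qed.

Lemma to_quotW (Q : preQuot P -> Prop) : (forall x, Q (to_quot x)) -> forall a, Q a.
Proof. by move=> H; elim/quotW. Qed.

Let addA : associative add.
Proof.
elim/to_quotW=> x; elim/to_quotW=> y; elim/to_quotW=> z.
by rewrite !addE; apply/to_quot_eq/pre_addA.
Qed.

Let addC : commutative add.
Proof.
elim/to_quotW=> x; elim/to_quotW=> y.
by rewrite !addE; apply/to_quot_eq/pre_addC.
Qed.

Let add0 : left_id (to_quot (pre_zero P)) add.
Proof. by elim/to_quotW=> x; rewrite addE; apply/to_quot_eq/pre_add0. Qed.

Let addN : left_inverse (to_quot (pre_zero P)) opp add.
Proof.
by elim/to_quotW=> x; rewrite oppE addE; apply/to_quot_eq/pre_addN.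
Qed.

HB.instance Definition _ :=
  GRing.isZmodule.Build (preQuot P) addA addC add0 addN.

Let mulA : associative mul.
Proof.
elim/to_quotW=> x; elim/to_quotW=> y; elim/to_quotW=> z.
by rewrite !mulE; apply/to_quot_eq/pre_mulA.
Qed.

Let mulC : commutative mul.
Proof.
elim/to_quotW=> x; elim/to_quotW=> y.
by rewrite !mulE; apply/to_quot_eq/pre_mulC.
Qed.

Let mul1 : left_id (to_quot (pre_one P)) mul.
Proof. by elim/to_quotW=> x; rewrite mulE; apply/to_quot_eq/pre_mul1. Qed.

Let mulD : left_distributive mul add.
Proof.
elim/to_quotW=> x; elim/to_quotW=> y; elim/to_quotW=> z.
by rewrite addE !mulE addE; apply/to_quot_eq/pre_mulD.
Qed.

HB.instance Definition _ :=
  GRing.Zmodule_isComPzRing.Build (preQuot P) mulA mulC mul1 mulD.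

Lemma to_quot0 : to_quot (pre_zero P) = 0. Proof. by []. Qed.
Lemma to_quot1 : to_quot (pre_one P) = 1. Proof. by []. Qed.
Lemma to_quotN x : to_quot (pre_opp P x) = - to_quot x.
Proof. by rewrite -oppE. Qed.
Lemma to_quotD x y : to_quot (pre_add P x y) = to_quot x + to_quot y.
Proof. by rewrite -addE. Qed.
Lemma to_quotM x y : to_quot (pre_mul P x y) = to_quot x * to_quot y.
Proof. by rewrite -mulE. Qed.

End PreQuot.

Section Ideals.
Variable T : comPzRingType.
Implicit Types (A I J M P : set T).

(* [A] is meant to be a subring of [T]; take [A = setT] for [T] itself. *)
Definition submodule A M :=
  [/\ M 0, (forall x y, M x -> M y -> M (x + y))
    & forall a x, A a -> M x -> M (a * x)].

Definition subring A :=
  [/\ A 1, (forall x y, A x -> A y -> A (x - y))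
    & forall x y, A x -> A y -> A (x * y)].

Definition ideal A I := submodule A I /\ I `<=` A.

Definition prime_ideal A P :=
  [/\ ideal A P, P <> A
    & forall x y, A x -> A y -> P (x * y) -> P x \/ P y].

Definition maximal_ideal A M :=
  [/\ ideal A M, M <> A
    & forall I, ideal A I -> M `<=` I -> I = M \/ I = A].

Definition regular (x : T) := forall y, x * y = 0 -> y = 0.

Definition reg_part (E : set T) := E `&` [set x | regular x].

Definition span_mul I J : set T :=
  [set x | exists2 s : seq (T * T), (forall p, p \in s -> I p.1 /\ J p.2)
                                  & x = \sum_(p <- s) p.1 * p.2].

Definition ideal_power A I n : set T := iter n (fun K => span_mul K I) A.

Definition colon I J : set T := [set x | forall y, J y -> I (x * y)].

(* The ideal of [T] itself generated by the entries of [s]. *)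
Definition gen_ideal (s : seq T) : set T :=
  [set x | exists c : nat -> T, x = \sum_(i < size s) c i * s`_i].

Definition reduced := forall (x : T) n, x ^+ n = 0 -> x = 0.

End Ideals.

Notation max_ideal R := (@maximal_ideal R setT).

Definition jacobson (R : comPzRingType) : set R :=
  [set x | forall M, max_ideal R M -> M x].

Arguments jacobson : clear implicits.

Definition noetherian (R : comPzRingType) :=
  forall I : set R, ideal setT I -> exists s, I = gen_ideal s.

Definition prime_chain (R : comPzRingType) n :=
  exists P : nat -> set R,
    (forall i, (i <= n)%N -> prime_ideal setT (P i)) /\
    (forall i, (i < n)%N -> P i `<` P i.+1).

Definition krull_dim (R : comPzRingType) n :=
  prime_chain R n /\ forall k, prime_chain R k -> (k <= n)%N.

Definition semilocal (R : comPzRingType) := finite_set [set M | max_ideal R M].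

Record mulset (R : comPzRingType) := MulSet {
  mulset_mem :> R -> Prop;
  mulset1 : mulset_mem 1;
  mulsetM : forall x y, mulset_mem x -> mulset_mem y -> mulset_mem (x * y)
}.

Section Localization.
Variables (R : comPzRingType) (S : mulset R).

Local Notation ratio := (R * set_type (S : set R))%type.

Definition num (x : ratio) : R := x.1.
Definition den (x : ratio) : R := \val x.2.

Lemma den_in x : S (den x). Proof. by rewrite /den; case: x.2 => s /= /set_mem. Qed.

Definition mk_ratio (r s : R) (Ss : S s) : ratio := (r, SigSub (mem_set Ss)).

Definition ratio_eqv (x y : ratio) : bool :=
  `[< exists2 t, S t & t * (num x * den y - num y * den x) = 0 >].

Lemma ratio_eqv_refl : reflexive ratio_eqv.
Proof. by move=> x; apply/asboolP; exists 1; rewrite ?subrr ?mulr0//; apply: mulset1. Qed.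

Let eqv_sym x y : ratio_eqv x y -> ratio_eqv y x.
Proof.
move=> /asboolP[t St e]; apply/asboolP; exists t => //.
by rewrite -opprB mulrN e oppr0.
Qed.

Lemma ratio_eqv_sym : symmetric ratio_eqv.
Proof. by move=> x y; apply/idP/idP; apply: eqv_sym. Qed.

Lemma ratio_eqv_trans : transitive ratio_eqv.
Proof.
move=> y x z /asboolP[t St e] /asboolP[u Su f]; apply/asboolP.
exists (t * u * den y); first by apply: mulsetM (den_in y); apply: mulsetM.
transitivity ((t * (num x * den y - num y * den x)) * (u * den z)
            + (u * (num y * den z - num z * den y)) * (t * den x)).
  ring.
by rewrite e f !mul0r addr0.
Qed.

Canonical ratio_equiv :=
  EquivRel ratio_eqv ratio_eqv_refl ratio_eqv_sym ratio_eqv_trans.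

Definition ratio_opp (x : ratio) := mk_ratio (- num x) (den_in x).
Definition ratio_add (x y : ratio) :=
  mk_ratio (num x * den y + num y * den x) (mulsetM (den_in x) (den_in y)).
Definition ratio_mul (x y : ratio) :=
  mk_ratio (num x * num y) (mulsetM (den_in x) (den_in y)).

Let numE : ((forall x, num (ratio_opp x) = - num x)
  * (forall x y, num (ratio_add x y) = (num x * den y + num y * den x)%R)
  * (forall x y, num (ratio_mul x y) = (num x * num y)%R)
  * (forall r s (Ss : S s), num (mk_ratio r Ss) = r))%type.
Proof. by []. Qed.

Let denE : ((forall x, den (ratio_opp x) = den x)
  * (forall x y, den (ratio_add x y) = (den x * den y)%R)
  * (forall x y, den (ratio_mul x y) = (den x * den y)%R)
  * (forall r s (Ss : S s), den (mk_ratio r Ss) = s))%type.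
Proof. by []. Qed.

Let eqv_id x y : num x * den y = num y * den x -> ratio_eqv x y.
Proof.
by move=> e; apply/asboolP; exists 1; [exact: mulset1|rewrite e subrr mulr0].
Qed.

Definition ratio_preRing : preRing ratio.
Proof.
apply: (@PreRing _ ratio_equiv (mk_ratio 0 (mulset1 S)) (mk_ratio 1 (mulset1 S))
  ratio_opp ratio_add ratio_mul) => /=.
- move=> x x' /asboolP[t St e]; apply/asboolP; exists t => //.
  by rewrite !numE !denE !mulNr -opprD mulrN e oppr0.
- move=> x x' y y' /asboolP[t St e] /asboolP[u Su f]; apply/asboolP.
  exists (t * u); first exact: mulsetM.
  rewrite !numE !denE.
  transitivity ((t * (num x * den x' - num x' * den x)) * (u * den y * den y')
    + (u * (num y * den y' - num y' * den y)) * (t * den x * den x')); first ring.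
  by rewrite e f !mul0r addr0.
- move=> x x' y y' /asboolP[t St e] /asboolP[u Su f]; apply/asboolP.
  exists (t * u); first exact: mulsetM.
  rewrite !numE !denE.
  transitivity ((t * (num x * den x' - num x' * den x)) * (u * num y * den y')
    + (u * (num y * den y' - num y' * den y)) * (t * num x' * den x)); first ring.
  by rewrite e f !mul0r addr0.
- by move=> x y z; apply: eqv_id; rewrite !numE !denE; ring.
- by move=> x y; apply: eqv_id; rewrite !numE !denE; ring.
- by move=> x; apply: eqv_id; rewrite !numE !denE; ring.
- by move=> x; apply: eqv_id; rewrite !numE !denE; ring.
- by move=> x y z; apply: eqv_id; rewrite !numE !denE; ring.
- by move=> x y; apply: eqv_id; rewrite !numE !denE; ring.
- by move=> x; apply: eqv_id; rewrite !numE !denE; ring.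
- by move=> x y z; apply: eqv_id; rewrite !numE !denE; ring.
Defined.

Definition loc : comPzRingType := preQuot ratio_preRing.

Definition to_loc (r : R) : loc := to_quot ratio_preRing (mk_ratio r (mulset1 S)).

End Localization.

Section RegularMulset.
Variable R : comPzRingType.

Let regular1 : @regular R 1. Proof. by move=> y; rewrite mul1r. Qed.

Let regularM (x y : R) : regular x -> regular y -> regular (x * y).
Proof. by move=> rx ry z; rewrite -mulrA => /rx/ry. Qed.

Definition regular_mulset : mulset R := MulSet regular1 regularM.

End RegularMulset.

Definition total_ring (R : comPzRingType) : comPzRingType :=
  loc (regular_mulset R).

Definition to_total (R : comPzRingType) (r : R) : total_ring R :=
  to_loc (regular_mulset R) r.

Section LocalizationAtMaximal.
Variables (R : comPzRingType) (M : set R) (maxM : max_ideal R M).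

Let M0 : M 0. Proof. by have [[[? _ _] _] _ _] := maxM. Qed.
Let MD x y : M x -> M y -> M (x + y).
Proof. by have [[[_ H _] _] _ _] := maxM; apply: H. Qed.
Let MM a x : M x -> M (a * x).
Proof. by have [[[_ _ H] _] _ _] := maxM; apply: H. Qed.

Let notM1 : ~ M 1.
Proof.
move=> M1; have [_ + _] := maxM; apply; rewrite -subTset => x _.
by rewrite -(mulr1 x); apply: MM.
Qed.

Let notM_inv x : ~ M x -> exists a, M (1 - a * x).
Proof.
move=> nMx; have [_ _ /(_ [set z | exists a, M (z - a * x)])] := maxM.
case.
- split=> //; split.
  + by exists 0; rewrite mul0r subr0.
  + move=> y z [a Ma] [b Mb]; exists (a + b).
    by rewrite mulrDl opprD addrACA; apply: MD.
  + by move=> b y _ [a Ma]; exists (b * a); rewrite -mulrA -mulrBr; apply: MM.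
- by move=> z Mz; exists 0; rewrite mul0r subr0.
- move=> e; case: nMx; rewrite -e; exists 1; rewrite mul1r subrr; exact: M0.
- move=> e; have : [set z | exists a, M (z - a * x)] 1 by rewrite e.
  by [].
Qed.

Let notM_mul x y : ~ M x -> ~ M y -> ~ M (x * y).
Proof.
move=> /notM_inv[a Ma] nMy Mxy; apply: nMy.
have -> : y = y * (1 - a * x) + a * (x * y) by ring.
by apply: MD; apply: MM.
Qed.

Definition max_mulset : mulset R := @MulSet R (fun x => ~ M x) notM1 notM_mul.

Definition loc_at : comPzRingType := loc max_mulset.

End LocalizationAtMaximal.

Section Completion.
Variables (R : comPzRingType) (J : set R).

Local Notation "J ^^ n" := (ideal_power setT J n) (at level 30).

Lemma ideal_power_ideal n : ideal setT (J ^^ n).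
Proof.
split=> //; elim: n => [|n [_ _ IH]]; first by split.
split.
- by exists [::]; rewrite ?big_nil.
- move=> x y [s Hs ->] [t Ht ->]; exists (s ++ t); last by rewrite big_cat.
  by move=> p; rewrite mem_cat => /orP[/Hs|/Ht].
- move=> a x _ [s Hs ->]; exists [seq (a * p.1, p.2) | p <- s].
    by move=> _ /mapP[p /Hs[Ip Jp] ->]; split=> //; apply: IH.
  by rewrite big_map mulr_sumr; apply: eq_bigr => p _; rewrite mulrA.
Qed.

Let pow0 n : (J ^^ n) 0. Proof. by have [[]] := ideal_power_ideal n. Qed.
Let powD n x y : (J ^^ n) x -> (J ^^ n) y -> (J ^^ n) (x + y).
Proof. by have [[_ H _] _] := ideal_power_ideal n; apply: H. Qed.
Let powM n a x : (J ^^ n) x -> (J ^^ n) (a * x).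
Proof. by have [[_ _ H] _] := ideal_power_ideal n; apply: H. Qed.
Let powN n x : (J ^^ n) x -> (J ^^ n) (- x).
Proof. by rewrite -mulN1r; apply: powM. Qed.

(* The sequence [a] stands for the element [(a n mod J ^ n)_n] of the inverse
   limit of the rings [R / J ^ n]. *)
Definition coherent : set (nat -> R) :=
  [set a | forall n, (J ^^ n) (a n.+1 - a n)].

Local Notation cseq := (set_type coherent).

Definition term (a : cseq) : nat -> R := \val a.

Definition mk_cseq (a : nat -> R) (Ha : coherent a) : cseq := SigSub (mem_set Ha).

Let termP (a : cseq) : coherent (term a).
Proof. by rewrite /term; case: a => a /= /set_mem. Qed.

Definition cseq_eqv (a b : cseq) : bool :=
  `[< forall n, (J ^^ n) (term a n - term b n) >].

Lemma cseq_eqv_refl : reflexive cseq_eqv.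
Proof. by move=> a; apply/asboolP => n; rewrite subrr. Qed.

Let eqv_sym a b : cseq_eqv a b -> cseq_eqv b a.
Proof. by move=> /asboolP e; apply/asboolP => n; rewrite -opprB; apply: powN. Qed.

Lemma cseq_eqv_sym : symmetric cseq_eqv.
Proof. by move=> a b; apply/idP/idP; apply: eqv_sym. Qed.

Lemma cseq_eqv_trans : transitive cseq_eqv.
Proof.
move=> b a c /asboolP e /asboolP f; apply/asboolP => n.
by rewrite -(subrKA (term b n)); apply: powD.
Qed.

Canonical cseq_equiv :=
  EquivRel cseq_eqv cseq_eqv_refl cseq_eqv_sym cseq_eqv_trans.

Let powB2 n x x' y y' : (J ^^ n) (x - x') -> (J ^^ n) (y - y') ->
  (J ^^ n) ((x + y) - (x' + y')).
Proof. by move=> e f; rewrite opprD addrACA; apply: powD. Qed.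

Let powM2 n x x' y y' : (J ^^ n) (x - x') -> (J ^^ n) (y - y') ->
  (J ^^ n) (x * y - x' * y').
Proof.
move=> e f; have -> : x * y - x' * y' = y * (x - x') + x' * (y - y') by ring.
by apply: powD; apply: powM.
Qed.

Let coherent_cst (r : R) : coherent (fun=> r).
Proof. by move=> n; rewrite subrr. Qed.

Let coherentN (a : cseq) : coherent (fun n => - term a n).
Proof. by move=> n; rewrite -opprD; apply/powN/termP. Qed.

Let coherentD (a b : cseq) : coherent (fun n => term a n + term b n).
Proof. by move=> n; apply: powB2; apply: termP. Qed.

Let coherentM (a b : cseq) : coherent (fun n => term a n * term b n).
Proof. by move=> n; apply: powM2; apply: termP. Qed.

Let eqv_id (a b : cseq) : (forall n, term a n = term b n) -> cseq_eqv a b.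
Proof. by move=> e; apply/asboolP => n; rewrite e subrr. Qed.

Definition cseq_preRing : preRing cseq.
Proof.
apply: (@PreRing _ cseq_equiv
  (mk_cseq (coherent_cst 0)) (mk_cseq (coherent_cst 1))
  (fun a => mk_cseq (coherentN a)) (fun a b => mk_cseq (coherentD a b))
  (fun a b => mk_cseq (coherentM a b))).
- move=> a a' /asboolP e; apply/asboolP => n /=.
  by rewrite -opprD; apply: powN.
- by move=> a a' b b' /asboolP e /asboolP f; apply/asboolP => n; apply: powB2.
- by move=> a a' b b' /asboolP e /asboolP f; apply/asboolP => n; apply: powM2.
- by move=> a b c; apply: eqv_id => n; apply: addrA.
- by move=> a b; apply: eqv_id => n; apply: addrC.
- by move=> a; apply: eqv_id => n; apply: add0r.
- by move=> a; apply: eqv_id => n; apply: addNr.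
- by move=> a b c; apply: eqv_id => n; apply: mulrA.
- by move=> a b; apply: eqv_id => n; apply: mulrC.
- by move=> a; apply: eqv_id => n; apply: mul1r.
- by move=> a b c; apply: eqv_id => n; apply: mulrDl.
Defined.

Definition completion : comPzRingType := preQuot cseq_preRing.

End Completion.

Definition regular_sequence (A : comPzRingType) (I : set A) (s : seq A) :=
  [/\ forall x, x \in s -> I x,
      forall i y, (i < size s)%N ->
        gen_ideal (take i s) (s`_i * y) -> gen_ideal (take i s) y
    & gen_ideal s <> setT].

(* The depth of a local ring: its Jacobson radical is its maximal ideal. *)
Definition depth (A : comPzRingType) (n : nat) :=
  (exists2 s : seq A, regular_sequence (jacobson A) s & size s = n) /\
  forall s : seq A, regular_sequence (jacobson A) s -> (size s <= n)%N.

Definition cohen_macaulay1 (R : comPzRingType) :=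
  [/\ noetherian R, krull_dim R 1
    & forall (M : set R) (maxM : max_ideal R M), depth (loc_at maxM) 1].

Definition injective_module (A : comPzRingType) (M : lmodType A) :=
  forall (X Y : lmodType A) (i : {linear X -> Y}) (f : {linear X -> M}),
    injective i -> exists g : {linear Y -> M}, forall x, g (i x) = f x.

(* [M] has an injective resolution [0 -> M -> I_0 -> ... -> I_n -> 0]. *)
Fixpoint inj_dim_le (A : comPzRingType) (n : nat) (M : lmodType A) : Prop :=
  if n is n'.+1 then
    exists (I C : lmodType A) (f : {linear M -> I}) (g : {linear I -> C}),
      [/\ injective_module I, injective f,
          forall x, g x = 0 <-> exists m, f m = x,
          forall c, exists x, g x = c
        & inj_dim_le n' C]
  else injective_module M.

Definition gorenstein_local (A : comPzRingType) :=
  exists n, @inj_dim_le A n (A^o : lmodType A).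

Definition gorenstein (R : comPzRingType) :=
  noetherian R /\
  forall (M : set R) (maxM : max_ideal R M), gorenstein_local (loc_at maxM).

Section Values.
Variable R : comPzRingType.
Local Notation Q := (total_ring R).

Definition base_ring : set Q := range (@to_total R).

Definition integral_closure : set Q :=
  [set x | exists n (c : nat -> R),
     x ^+ n + \sum_(i < n) to_total (c i) * x ^+ i = 0].

Definition fractional_ideal (E : set Q) :=
  submodule base_ring E /\
  exists2 r, reg_part base_ring r & forall x, E x -> base_ring (r * x).

Definition regular_fractional_ideal (E : set Q) :=
  fractional_ideal E /\ reg_part E !=set0.

Definition valuation_rings : set (set Q) :=
  [set V | [/\ subring V, base_ring `<=` V, V <> setT
             & forall x y, ~ V x -> ~ V y -> ~ V (x * y)]].

(* [m_V], the unique regular maximal ideal of [V]; here and below the default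
   value of [xget] is only reached outside discrete valuation rings. *)
Definition val_ideal (V : set Q) : set Q :=
  xget set0 [set m | maximal_ideal V m /\ reg_part m !=set0].

(* [m_V ^ k] for [k : int], the inverse of [m_V] being [V : m_V]. *)
Definition val_power (V : set Q) (k : int) : set Q :=
  match k with
  | Posz n => ideal_power V (val_ideal V) n
  | Negz n => ideal_power V (colon V (val_ideal V)) n.+1
  end.

Definition valuation (V : set Q) (x : Q) : \bar int :=
  if `[< forall k, val_power V k x >] then +oo%E
  else (xget 0 [set k : int | val_power V k x /\
                  forall j, val_power V j x -> (j <= k)%R])%:E.

Definition value_index : Type := set_type valuation_rings.

(* [alpha] is integer valued: regular elements have finite valuations. *)
Definition value_set (E : set Q) : set (value_index -> int) :=
  [set alpha | exists2 x, reg_part E x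
     & forall V : value_index, valuation (\val V) x = (alpha V)%:E].

End Values.

Arguments base_ring : clear implicits.
Arguments integral_closure : clear implicits.
Arguments valuation_rings : clear implicits.

Definition analytically_reduced (R : comPzRingType) :=
  reduced (completion (jacobson R)).

(* The injection [R / (n \cap R) -> Rbar / n] is onto. *)
Definition residually_rational (R : comPzRingType) :=
  forall n : set (total_ring R), maximal_ideal (integral_closure R) n ->
    forall x, integral_closure R x -> exists r : R, n (x - to_total r).

(* The underlying set of [R / M]. *)
Definition residue_classes (R : comPzRingType) (M : set R) : set (set R) :=
  [set C | exists r, C = [set x | M (x - r)]].

Definition large_residue_fields (R : comPzRingType) :=
  forall (M : set R) (maxM : max_ideal R M),
    (valuation_rings (loc_at maxM) #<= residue_classes M)%card.

Definition admissible (R : comPzRingType) :=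
  [/\ cohen_macaulay1 R, semilocal R, analytically_reduced R,
      residually_rational R & large_residue_fields R].

Section Semigroup.
Variable I : Type.
Implicit Types (G E : set (I -> int)) (alpha beta : I -> int).

Definition conductor_set G : set (I -> int) :=
  [set alpha | forall n : I -> nat, G (fun i => alpha i + (n i)%:Z)].

(* The componentwise minimum, which exists for value semigroups of admissible
   rings. *)
Definition conductor G : I -> int :=
  xget (fun=> 0) [set gamma | conductor_set G gamma /\
    forall alpha, conductor_set G alpha -> forall i, (gamma i <= alpha i)%R].

Definition tau G : I -> int := fun i => conductor G i - 1.

Definition Delta alpha : set (I -> int) :=
  [set beta | exists i, beta i = alpha i /\
                        forall j, j <> i -> (alpha j < beta j)%R].

Definition Delta_in E alpha : set (I -> int) := Delta alpha `&` E.

End Semigroup.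

(* Main.v *)
(* Say that a regular fractional ideal [E] jumps at [b] in the direction [i] if it
   has an element whose values are at least [b], with equality at [i].  Large
   residue fields make [a] a value of [E] as soon as [E] jumps at [a] in every
   direction, so the formula says that [R : E] jumps at [a] in the direction [i]
   iff [E] does not jump at [gamma - a - e_i].  One implication always holds,
   since the conductor [gamma] cannot be lowered in a single coordinate.  If the
   regular fractional ideals are reflexive, separating [E + W (gamma - a)] from
   [E + W (gamma - a - e_i)] by an element of the colon gives the other one, where
   [W b] consists of the elements of values at least [b].  Conversely, the formula
   shows that [E] and [R : (R : E)] have the same jumps, hence are equal.

   Reflexivity means that for a regular [x] in a maximal ideal [M] the socle of
   [R / x] at [M] has dimension at most one: this bounds the lengths of duals,
   and conversely applies to [E = R + R (r / x)] with [M r] in [x R].  If it holds,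
   [0 -> R_M -> Q -> Q / R_M -> 0] is an injective resolution by Baer's criterion;
   if [R_M] has finite injective dimension, then [R_M / x] is self-injective and
   its socle is simple. *)

From HB Require Import structures.
Require Import Defs.
From mathcomp Require Import all_boot all_order all_algebra.
From mathcomp Require Import generic_quotient perm.
From mathcomp Require Import boolp classical_sets functions cardinality.
From mathcomp Require Import constructive_ereal.
From mathcomp Require Import ring zify.

Set Implicit Arguments.
Unset Strict Implicit.
Unset Printing Implicit Defensive.

Import Order.TTheory GRing.Theory Num.Theory.
Local Open Scope classical_set_scope.
Local Open Scope ring_scope.

(** * Ideals and composition series *)

(** Definitions such as [valuation] and [conductor] rest on facts that have to be established: the
    valuation rings of [Q] are discrete and finitely many, and some regular element carries the
    integral closure into [R]. All of this comes from one number. The Jacobson radical contains a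
    regular element [y], and [R / y] has a finite length [L]. Multiplication by a regular element
    preserves lengths, so a strict chain of submodules between [y E] and [E] has at most [L] steps
    for every regular fractional ideal [E]; suitable choices of [E] bound the degrees of integral
    equations, yield uniformizers and bound the number of valuations. The zero divisors of [Q] are
    the other obstacle. As [R] is reduced, each element of [Q] is an idempotent times a unit, and an
    idempotent has value zero or infinity, which reduces questions about valuations to units.
    Analytic reducedness enters twice: a nonzero nilpotent of [R], or elements of [y^N Rbar cap R]
    outside [y R] for every [N], would give a nonzero nilpotent of the completion. *)

Notation idl := (ideal setT).

Lemma properI T (A B : set T) : A `<=` B -> A <> B -> A `<` B.
Proof. by move=> AB nAB; split=> // BA; apply/nAB/seteqP. Qed.

(** [Zorn_bigcup] also asks for the union of the empty chain, so the empty set is adjoined to [P];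
    if it turns out to be maximal, all members of [P] are empty. *)
Lemma zorn_sets T (P : set (set T)) : P !=set0 ->
  (forall F, F !=set0 -> F `<=` P -> total_on F subset -> P (\bigcup_(X in F) X)) ->
  exists2 A, P A & forall B, P B -> A `<=` B -> B = A.
Proof.
move=> [I0 PI0] cP.
have max A : P A -> (forall B, A `<` B -> ~ (P `|` [set set0]) B) ->
    forall B, P B -> A `<=` B -> B = A.
  move=> _ maxA B PB AB; apply: contrapT => nBA.
  by apply: (maxA B); [apply: properI => // e; apply: nBA|left].
have [|A [[PA|/= A0] maxA]] := @Zorn_bigcup T (P `|` [set set0]).
- move=> F FP tF.
  have [[I [FI PI]]|nF] := pselect (exists I, F I /\ P I); last first.
    right; rewrite /= -subset0 => x [X FX Xx]; apply: nF.
    have [PX|/= X0] := FP _ FX; first by exists X.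
    by move: Xx; rewrite X0.
  left; have -> : \bigcup_(X in F) X = \bigcup_(X in F `&` P) X.
    apply/seteqP; split=> [x [X FX Xx]|x [X [FX _] Xx]]; last by exists X.
    by exists X => //; split=> //; have [//|/= X0] := FP _ FX; move: Xx; rewrite X0.
  apply: cP; first by exists I.
  - by move=> X [].
  - by move=> X Y [FX _] [FY _]; apply: tF.
- by exists A => //; apply: max.
- exists I0 => // B PB IB; apply: contrapT => nB.
  have sB : A `<=` B by rewrite A0; exact: sub0set.
  have BA : B = A.
    by apply: contrapT => nBA; apply: (maxA B); [exact: properI (nesym nBA)|left].
  by apply: nB; apply/seteqP; split=> //; rewrite BA A0; exact: sub0set.
Qed.

Section NoetherianRings.
Variable R : comPzRingType.
Implicit Types (I J E F G M P : set R) (x y e : R).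

Lemma mk_idl I : I 0 -> (forall x y, I x -> I y -> I (x + y)) ->
  (forall a x, I x -> I (a * x)) -> idl I.
Proof. by move=> I0 ID IM; split=> //; split=> // a x _; apply: IM. Qed.

Lemma idl0 I : idl I -> I 0. Proof. by case=> [[]]. Qed.

Lemma idlD I x y : idl I -> I x -> I y -> I (x + y).
Proof. by case=> [[_ H _] _]; apply: H. Qed.

Lemma idlM I a x : idl I -> I x -> I (a * x).
Proof. by case=> [[_ _ H] _]; apply: H. Qed.

Lemma idlMr I a x : idl I -> I x -> I (x * a).
Proof. by rewrite mulrC; apply: idlM. Qed.

Lemma idlN I x : idl I -> I x -> I (- x).
Proof. by rewrite -mulN1r; apply: idlM. Qed.

Lemma idlB I x y : idl I -> I x -> I y -> I (x - y).
Proof. by move=> iI Ix Iy; apply: idlD => //; apply: idlN. Qed.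

Lemma idl1 I : idl I -> I 1 -> I = setT.
Proof. by move=> iI I1; rewrite -subTset => x _; rewrite -[x]mulr1; apply: idlM. Qed.

Lemma idlT : idl [set: R]. Proof. exact: mk_idl. Qed.

Definition pri x : set R := [set y | exists a, y = a * x].

Lemma idl_pri x : idl (pri x).
Proof.
apply: mk_idl; first by exists 0; rewrite mul0r.
- by move=> _ _ [a ->] [b ->]; exists (a + b); rewrite mulrDl.
- by move=> c _ [a ->]; exists (c * a); rewrite mulrA.
Qed.

Lemma pri_id x : pri x x. Proof. by exists 1; rewrite mul1r. Qed.

Lemma pri_sub x I : idl I -> I x -> pri x `<=` I.
Proof. by move=> iI Ix _ [a ->]; apply: idlM. Qed.

Definition adj F e : set R := [set z | exists f a, F f /\ z = f + a * e].

Lemma idl_adj F e : idl F -> idl (adj F e).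
Proof.
move=> iF; apply: mk_idl.
- by exists 0, 0; split; [exact: idl0|rewrite mul0r addr0].
- move=> _ _ [f [a [Ff ->]]] [g [b [Gg ->]]]; exists (f + g), (a + b).
  by split; [exact: idlD|ring].
- move=> c _ [f [a [Ff ->]]]; exists (c * f), (c * a).
  by split; [exact: idlM|ring].
Qed.

Lemma sub_adj F e : F `<=` adj F e.
Proof. by move=> f Ff; exists f, 0; split=> //; rewrite mul0r addr0. Qed.

Lemma adj_id F e : idl F -> adj F e e.
Proof. by move=> iF; exists 0, 1; split; [exact: idl0|rewrite mul1r add0r]. Qed.

Lemma adj_sub F G e : idl G -> F `<=` G -> G e -> adj F e `<=` G.
Proof.
by move=> iG FG Ge _ [f [a [Ff ->]]]; apply: idlD => //; [exact: FG|exact: idlM].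
Qed.

Definition colonI F e : set R := [set k | F (k * e)].

Lemma idl_colonI F e : idl F -> idl (colonI F e).
Proof.
move=> iF; apply: mk_idl; rewrite /colonI /=.
- by rewrite mul0r; apply: idl0.
- by move=> x y; rewrite mulrDl; apply: idlD.
- by move=> a x; rewrite -mulrA; apply: idlM.
Qed.

Lemma gen_idealP (s : seq R) I : idl I -> (forall x, x \in s -> I x) ->
  gen_ideal s `<=` I.
Proof.
move=> iI sI _ [c ->]; apply: (big_ind I) => [|x y|i _].
- exact: idl0.
- exact: idlD.
- by apply: idlM => //; apply: sI; apply: mem_nth.
Qed.

Lemma mem_gen_ideal (s : seq R) x : x \in s -> gen_ideal s x.
Proof.
move=> xs; exists (fun i => (i == index x s)%:R).
rewrite -index_mem in xs.
rewrite (bigD1 (Ordinal xs)) //= eqxx mul1r nth_index -?index_mem //.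
rewrite big1 ?addr0 // => i ni; case: eqP => [e|_]; last by rewrite mul0r.
by move: ni; rewrite -val_eqE /= e eqxx.
Qed.

Lemma idl_gen (s : seq R) : idl (gen_ideal s).
Proof.
apply: mk_idl.
- by exists (fun=> 0); rewrite big1 // => i _; rewrite mul0r.
- move=> _ _ [c ->] [d ->]; exists (fun i => c i + d i).
  by rewrite -big_split /=; apply: eq_bigr => i _; rewrite mulrDl.
- move=> a _ [c ->]; exists (fun i => a * c i).
  by rewrite mulr_sumr; apply: eq_bigr => i _; rewrite mulrA.
Qed.

Lemma chain_finite (F : set (set R)) (s : seq R) I0 : total_on F subset -> F I0 ->
  (forall x, x \in s -> exists2 I, F I & I x) ->
  exists2 I, F I & forall x, x \in s -> I x.
Proof.
move=> tF FI0; elim: s => [|a s IH] H; first by exists I0.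
have [|I FI sI] := IH; first by move=> x xs; apply: H; rewrite inE xs orbT.
have [J FJ Ja] := H a (mem_head _ _).
have [IJ|JI] := tF _ _ FI FJ.
  by exists J => // x; rewrite inE => /orP[/eqP->//|/sI/IJ].
by exists I => // x; rewrite inE => /orP[/eqP->|/sI//]; apply: JI.
Qed.

(** Noetherian means that ideals are finitely generated, so the maximum condition goes through Zorn:
    the finitely many generators of the union of a chain lie in one member of it. *)
Lemma noetherian_max (P : set (set R)) : noetherian R -> P !=set0 ->
  (forall I, P I -> idl I) ->
  exists2 I, P I & forall J, P J -> I `<=` J -> J = I.
Proof.
move=> nR P0 iP; apply: zorn_sets => // F [I FI] FP tF; set U := \bigcup_(X in F) X.
have iF Y : F Y -> idl Y by move=> /FP/iP.
have iU : idl U.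
  apply: mk_idl.
  - by exists I => //; apply: idl0 (iF _ FI).
  - move=> x y [X FX Xx] [Y FY Yy].
    have [XY|YX] := tF _ _ FX FY.
    + exists Y => //; apply: idlD (iF _ FY) _ Yy; exact: XY.
    + exists X => //; apply: idlD (iF _ FX) Xx _; exact: YX.
  - move=> a x [X FX Xx]; exists X => //; apply: idlM => //.
    exact: iF.
have [s Us] := nR _ iU.
have [x xs|J FJ sJ] := chain_finite (s := s) tF FI.
  have : U x by rewrite Us; apply: mem_gen_ideal.
  by case=> X; exists X.
suff -> : U = J by apply: FP.
apply/seteqP; split=> [x|x Jx]; last by exists J.
by rewrite Us; apply: gen_idealP => //; exact: iF.
Qed.

Definition ann J : set R := [set b | forall j, J j -> b * j = 0].

Lemma idl_ann J : idl (ann J).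
Proof.
apply: mk_idl => [j _|x y ax ay j Jj|a x ax j Jj]; first by rewrite mul0r.
  by rewrite mulrDl ax // ay // addr0.
by rewrite -mulrA ax // mulr0.
Qed.

Lemma reduced_sqr x : reduced R -> x * x = 0 -> x = 0.
Proof. by move=> rR xx; apply: (rR x 2); rewrite expr2. Qed.

(* In each maximality argument, a witness of failure would enlarge the
   double annihilator of the chosen element. *)
Lemma reduced_reg J : noetherian R -> reduced R -> idl J ->
  exists r b, [/\ J r, ann J b & regular (r + b)].
Proof.
move=> nR rR iJ; pose aa r := ann (ann [set r]).
have aaE r w z : aa r w -> z * r = 0 -> w * z = 0.
  by move=> + zr; apply=> _ ->.
have [||_ [r Jr <-] maxr] := @noetherian_max [set aa r | r in J] nR.
- by exists (aa 0); exists 0 => //; exact: idl0.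
- by move=> _ [r _ <-]; apply: idl_ann.
have annr z : z * r = 0 -> ann J z.
  move=> zr j Jj; apply: (reduced_sqr rR).
  have zjr : z * j * r = 0 by rewrite mulrAC zr mul0r.
  have key w : w * (r + z * j) = 0 -> w * (z * j) = 0.
    move=> h; apply: (reduced_sqr rR).
    transitivity (w * z * j * (w * (r + z * j)) - w * w * (z * j * r)); first ring.
    by rewrite h zjr !mulr0 subrr.
  apply: (aaE r _ _ _ zjr).
  rewrite -(maxr (aa (r + z * j))).
  - by move=> w /(_ _ erefl)/key; rewrite mulrC.
  - by exists (r + z * j) => //; apply: idlD => //; apply: idlM.
  - move=> w aw t /(_ _ erefl) h; apply: (aaE _ _ _ aw).
    by move: (h); rewrite mulrDr key // addr0.
have [||_ [b ab <-] maxb] := @noetherian_max [set aa (r + b) | b in ann J] nR.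
- by exists (aa (r + 0)); exists 0 => //; exact: idl0 (idl_ann J).
- by move=> _ [b _ <-]; apply: idl_ann.
exists r, b; split=> // z; rewrite mulrC => h.
have br : b * r = 0 by apply: ab.
have zr : z * r = 0.
  apply: (reduced_sqr rR).
  transitivity (z * r * (z * (r + b)) - z * z * (b * r)); first ring.
  by rewrite h br !mulr0 subrr.
have zb : z * b = 0 by move: h; rewrite mulrDr zr add0r.
have key w : w * (r + (b + z)) = 0 -> w * z = 0.
  move=> hw; apply: (reduced_sqr rR).
  transitivity (w * z * (w * (r + (b + z))) - w * w * (z * r) - w * w * (z * b)).
    ring.
  by rewrite hw zr zb !mulr0 !subr0.
apply: (reduced_sqr rR); apply: (aaE (r + b) _ _ _ h).
rewrite -(maxb (aa (r + (b + z)))).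
- by move=> w /(_ _ erefl)/key; rewrite mulrC.
- by exists (b + z) => //; exact: (idlD (idl_ann J) ab (annr _ zr)).
- move=> w aw t /(_ _ erefl) ht; apply: (aaE _ _ _ aw).
  by move: (ht); rewrite addrA mulrDr key // addr0.
Qed.

(** Take [b] annihilating [a] with a multiple of [a] plus [b] regular: adding [b * x] repairs [a]
    exactly where it vanishes. *)
Lemma adj_regular a x : noetherian R -> reduced R -> regular x ->
  exists c, regular (a + c * x).
Proof.
move=> nR rR rx; have [_ [b [[r ->] ab rb]]] := reduced_reg nR rR (idl_pri a).
exists b => z; rewrite mulrC => h.
have ba : b * a = 0 by apply: ab; exact: pri_id.
have za : z * a = 0.
  apply: (reduced_sqr rR).
  transitivity (z * a * (z * (a + b * x)) - z * z * x * (b * a)); first ring.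
  by rewrite h ba !mulr0 subrr.
have zb : z * b = 0.
  by apply: rx; move: h; rewrite mulrDr za add0r => <-; ring.
by apply: rb; rewrite mulrC mulrDr zb mulrCA za mulr0 addr0.
Qed.

Lemma max_ideal_above I : noetherian R -> idl I -> ~ I 1 ->
  exists2 M, max_ideal R M & I `<=` M.
Proof.
move=> nR iI nI1.
have [||M [iM IM nM1] maxM] := @noetherian_max [set M | [/\ idl M, I `<=` M & ~ M 1]] nR.
- by exists I; split.
- by move=> J [].
exists M => //; split=> // [MT|J iJ MJ]; first by apply: nM1; rewrite MT.
have [J1|nJ1] := pselect (J 1); first by right; apply: idl1.
by left; apply: maxM => //; split=> // x /IM/MJ.
Qed.

Lemma max_idl M : max_ideal R M -> idl M. Proof. by case. Qed.

Lemma max_n1 M : max_ideal R M -> ~ M 1.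
Proof. by case=> iM nM _ M1; apply/nM/idl1. Qed.

Lemma max_inv M x : max_ideal R M -> ~ M x -> exists a, M (1 - a * x).
Proof.
move=> mM nMx; have [iM _ /(_ (adj M x) (idl_adj x iM) (@sub_adj M x))] := mM.
case=> e; first by case: nMx; rewrite -e; apply: adj_id.
have : adj M x 1 by rewrite e.
by move=> [m [a [Mm ->]]]; exists a; rewrite addrK.
Qed.

Lemma max_prime M : max_ideal R M -> prime_ideal setT M.
Proof.
move=> mM; have iM := max_idl mM.
split=> //; first by case: mM.
move=> x y _ _ Mxy; have [|nMx] := pselect (M x); first by left.
right; have [a Ma] := max_inv mM nMx.
have -> : y = y * (1 - a * x) + a * (x * y) by ring.
by apply: idlD => //; apply: idlM.
Qed.

Lemma max_eq M N : max_ideal R M -> max_ideal R N -> M `<=` N -> M = N.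
Proof.
move=> mM mN MN; have [_ _ /(_ N (max_idl mN) MN)] := mM.
by case=> [->//|NT]; case: mN => _ /(_ NT).
Qed.

Lemma prime_idl P : prime_ideal setT P -> idl P. Proof. by case. Qed.

Lemma prime_n1 P : prime_ideal setT P -> ~ P 1.
Proof. by case=> iP nP _ P1; apply/nP/idl1. Qed.

Lemma primeM P x y : prime_ideal setT P -> ~ P x -> ~ P y -> ~ P (x * y).
Proof. by case=> _ _ /(_ x y I I) H nx ny /H[]. Qed.

(* A regular element of [P] produces a prime strictly below [P]. *)
Lemma prime_regular_max P x : noetherian R -> ~ prime_chain R 2 ->
  prime_ideal setT P -> P x -> regular x -> max_ideal R P.
Proof.
move=> nR nch pP Px rx.
have [M mM PM] := max_ideal_above nR (prime_idl pP) (prime_n1 pP).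
have [->//|nPM] := pselect (P = M).
have rX n y : x ^+ n * y = 0 -> y = 0.
  elim: n y => [|n IH] y; first by rewrite expr0 mul1r.
  by rewrite exprSr -mulrA => /IH/rx.
have [||Q [iQ dQ] maxQ] := @noetherian_max
  [set I | idl I /\ forall n s, ~ P s -> ~ I (x ^+ n * s)] nR.
- exists (pri 0); split; first exact: idl_pri.
  move=> n s nPs [a]; rewrite mulr0 => /rX s0; apply: nPs; rewrite s0.
  exact: idl0 (prime_idl pP).
- by move=> I [].
have meet a : ~ Q a -> exists n s, ~ P s /\ adj Q a (x ^+ n * s).
  move=> nQa; apply: contrapT => H; apply: nQa.
  rewrite -(maxQ (adj Q a)); [exact: adj_id| |exact: sub_adj].
  split; first exact: idl_adj.
  by move=> n s nPs adjs; apply: H; exists n, s.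
have pQ : prime_ideal setT Q.
  split=> //.
    move=> QT; apply: (dQ 0 1 (prime_n1 pP)); by rewrite QT.
  move=> a b _ _ Qab; apply: contrapT => /not_orP[/meet[n [s [ns [q [r [Qq e]]]]]]].
  move=> /meet[m [t [nt [q' [r' [Qq' e']]]]]].
  apply: (dQ (n + m)%N (s * t) (primeM pP ns nt)).
  have -> : x ^+ (n + m) * (s * t) = (x ^+ n * s) * (x ^+ m * t).
    by rewrite exprD; ring.
  rewrite e e'.
  have -> : (q + r * a) * (q' + r' * b)
    = (q' + r' * b) * q + r * a * q' + r * r' * (a * b) by ring.
  by apply: idlD => //; [apply: idlD => //|]; apply: idlM.
exfalso; apply: nch; exists (fun i => if i is i'.+1 then if i' is 0%N then P else M else Q).
split.
  by case=> [|[|[|//]]] _ //; apply: max_prime.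
case=> [|[|//]] _; apply: properI => //.
- move=> q Qq; apply: contrapT => nPq.
  by apply: (dQ 0%N q nPq); rewrite expr0 mul1r.
- move=> QP; apply: (dQ 1%N 1 (prime_n1 pP)).
  by rewrite mulr1 expr1 QP.
Qed.

(** A maximal colon ideal of [F] by an element outside [F] is prime; it contains the regular [x],
    hence is maximal in dimension one. Taking [e] among the multiples of [e0] keeps it inside any
    ideal that contains [e0]. *)
Lemma socle F x e0 : noetherian R -> ~ prime_chain R 2 -> idl F -> F x ->
  regular x -> ~ F e0 ->
  exists e M, [/\ pri e0 e, max_ideal R M, ~ F e & forall m, M m -> F (m * e)].
Proof.
move=> nR nch iF Fx rx nFe0.
have [||_ [e [[r er] nFe] <-] maxe] := @noetherian_max
    [set colonI F e | e in [set e | pri e0 e /\ ~ F e]] nR.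
- by exists (colonI F e0); exists e0 => //; split=> //; exact: pri_id.
- by move=> _ [e _ <-]; apply: idl_colonI.
exists e, (colonI F e); split=> //; first by exists r.
apply: (@prime_regular_max _ x) => //; last by apply: idlMr.
split; first exact: idl_colonI.
  by move=> eT; apply: nFe; rewrite -[e]mul1r; have : colonI F e 1 by rewrite eT.
move=> a b _ _ Hab; apply: contrapT => /not_orP[na nb].
apply: nb; rewrite -(maxe (colonI F (a * e))).
- by rewrite /colonI /= mulrA [b * a]mulrC.
- exists (a * e) => //; split=> //; rewrite er mulrA; by exists (a * r).
- by move=> k; rewrite /colonI /= mulrCA; apply: idlM.
Qed.

(** The factor [F1 / F] is generated by the class of [e] and isomorphic to [R / M]. *)
Definition step F F1 := idl F /\ exists M e,
  [/\ max_ideal R M, ~ F e, forall m, M m -> F (m * e) & F1 = adj F e].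

(* [cs n F E]: there is a composition series of length [n] from [F] to [E]. *)
Inductive cs : nat -> set R -> set R -> Prop :=
| cs0 F : idl F -> cs 0 F F
| csS n F F1 E : step F F1 -> cs n F1 E -> cs n.+1 F E.

Lemma cs_idl n F E : cs n F E -> [/\ idl F, idl E & F `<=` E].
Proof.
elim=> [{}F iF|{}n {}F F1 {}E [iF [M [e [_ _ _ ->]]]] _ [_ iE sE]]; first by split.
by split=> // x Fx; apply/sE/sub_adj.
Qed.

Lemma cs_cat m n F G E : cs m F G -> cs n G E -> cs (m + n) F E.
Proof.
elim=> [//|{}m {}F F1 {}G st _ IH] /IH; exact: csS.
Qed.

Lemma cs_0 F E : cs 0 F E -> F = E.
Proof. by move=> H; inversion H. Qed.

(** A maximal [G] between [F] and [E] without a series up to [E] could be enlarged by a socle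
    element of [E / G]. *)
Lemma cs_exists F E x : noetherian R -> ~ prime_chain R 2 -> idl F -> idl E ->
  F `<=` E -> F x -> regular x -> exists n, cs n F E.
Proof.
move=> nR nch iF iE FE Fx rx; apply: contrapT => nocs.
have [||G [iG [FG GE] nG] maxG] := @noetherian_max
    [set G | [/\ idl G, F `<=` G /\ G `<=` E & ~ exists n, cs n G E]] nR.
- by exists F; split=> //; split.
- by move=> I [].
have [e0 Ee0 nGe0] : exists2 e0, E e0 & ~ G e0.
  apply: contrapT => H; apply: nG; exists 0%N.
  suff -> : G = E by apply: cs0.
  rewrite predeqE => y; split=> [/GE//|Ey].
  by apply: contrapT => nGy; apply: H; exists y.
have [e [M [e0e mM nGe Me]]] := socle nR nch iG (FG _ Fx) rx nGe0.
have Ee : E e by apply: (pri_sub iE Ee0).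
have : ~ ~ exists n, cs n (adj G e) E.
  move=> nadj; apply: nGe; rewrite -(maxG (adj G e)); first exact: adj_id.
  - split=> //; first exact: idl_adj.
    by split=> [y /FG/sub_adj//|]; apply: adj_sub.
  - exact: sub_adj.
move=> /contrapT[n csn]; apply: nG; exists n.+1.
by apply: csS csn; split=> //; exists M, e; split.
Qed.

Lemma csI n F1 G1 G : cs n F1 G1 -> idl G ->
  (forall x, G1 x -> exists f g, [/\ F1 f, G g & x = f + g]) ->
  cs n (F1 `&` G) (G1 `&` G).
Proof.
have iI I J : idl I -> idl J -> idl (I `&` J).
  move=> iI iJ; apply: mk_idl; first by split; apply: idl0.
    by move=> x y [? ?] [? ?]; split; apply: idlD.
  by move=> a x [? ?]; split; apply: idlM.
move=> + iG; elim=> [F iF _|{}n F F2 E [iF [M [e [mM nFe Me ->]]]] csn IH H].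
  by apply: cs0; apply: iI.
have [_ iE sE] := cs_idl csn.
have [f [g [Ff Gg eE]]] := H _ (sE _ (adj_id e iF)).
have ge : g = e - f by rewrite eE [f + g]addrC addrK.
apply: (@csS _ _ (adj F e `&` G)); last first.
  apply: IH => x /H[f' [g' [Ff' Gg' ->]]]; exists f', g'; split=> //.
  exact: sub_adj.
split; first exact: iI.
exists M, g; split=> //.
- move=> [Fg _]; apply: nFe; rewrite eE; exact: idlD.
- move=> m Mm; split; last exact: idlM.
  by rewrite ge mulrBr; apply: idlB => //; [exact: Me|exact: idlM].
- rewrite predeqE => y; split.
    move=> [[f' [a [Ff' ye]] Gy]]; exists (f' + a * f), a; split.
      split; first by apply: idlD => //; apply: idlM.
      have -> : f' + a * f = y - a * g by rewrite ye ge; ring.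
      by apply: idlB => //; apply: idlM.
    by rewrite ye ge; ring.
  move=> [f' [a [[Ff' Gf'] ->]]]; split; last by apply: idlD => //; apply: idlM.
  exists (f' - a * f), a; split; last by rewrite ge; ring.
  by apply: idlB => //; apply: idlM.
Qed.

Lemma step_mem F M e G a : idl F -> max_ideal R M -> (forall m, M m -> F (m * e)) ->
  idl G -> F `<=` G -> ~ G e -> G (a * e) -> F (a * e).
Proof.
move=> iF mM Me iG FG nGe Gae; apply: (Me); apply: contrapT => /(max_inv mM)[c Mc].
apply: nGe; have -> : e = (1 - c * a) * e + c * (a * e) by ring.
by apply: idlD => //; [exact: FG (Me _ Mc)|exact: idlM].
Qed.

(** By induction on the series: a step with [e] in [G] stays below [G]; otherwise it is moved above
    [G], and the series up to [adj G e] is cut down by [csI]. *)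
Lemma cs_split n F E G : cs n F E -> idl G -> F `<=` G -> G `<=` E ->
  exists a b, [/\ cs a F G, cs b G E & (a + b)%N = n].
Proof.
move=> H; elim: H G => [{}F iF|{}n {}F F1 {}E [iF [M [e [mM nFe Me ->]]]] csn IH] G iG FG GE.
  have -> : G = F by apply/seteqP.
  by exists 0%N, 0%N; split=> //; apply: cs0.
have [_ iE sE] := cs_idl csn.
have [Ge|nGe] := pselect (G e).
  have [||//|a [b [ca cb <-]]] := IH G; first by [].
    exact: adj_sub.
  exists a.+1, b; split=> //; apply: csS ca; split=> //; by exists M, e; split.
have Ee := sE _ (adj_id e iF).
have iG1 : idl (adj G e) by apply: idl_adj.
have [||a [b [ca cb <-]]] := IH (adj G e) iG1.
- by apply: adj_sub => // [x /FG/sub_adj//|]; exact: adj_id.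
- exact: adj_sub.
exists a, b.+1; split; last by rewrite addnS.
  have := csI ca iG.
  have -> : adj F e `&` G = F.
    apply/seteqP; split=> [x [[f [c [Ff ->]]] Gx]|x Fx]; last first.
      by split; [exact: sub_adj|exact: FG].
    apply: idlD => //; apply: (step_mem iF mM Me iG FG nGe).
    by rewrite -[c * e](addKr f) addrC; apply: idlB => //; exact: FG.
  have -> : adj G e `&` G = G.
    by apply/seteqP; split=> [x []//|x Gx]; split=> //; exact: sub_adj.
  apply=> _ [g [c [Gg ->]]]; exists (c * e), g; rewrite addrC; split=> //.
  by exists 0, c; rewrite add0r; split=> //; exact: idl0.
apply: csS cb; split=> //; exists M, e; split=> // m Mm; exact/FG/Me.
Qed.

(** Only lengths matter later, so this monotonicity stands in for the Jordan-Hoelder theorem;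
    uniqueness of the length is its antisymmetry. *)
Lemma cs_le m n F G E : cs m F E -> idl G -> F `<=` G -> cs n G E -> (n <= m)%N.
Proof.
move=> cm iG FG cn; have [_ iE GE] := cs_idl cn.
elim: n m F G iG FG cm cn GE => [//|n IH] m F G iG FG cm cn GE.
inversion_clear cn as [|? ? G1 ? [_ [M [e [mM nGe Me eG1]]]] cn1].
have [_ _ G1E] := cs_idl cn1.
have iG1 : idl G1 by rewrite eG1; exact: idl_adj.
have GG1 : G `<=` G1 by rewrite eG1; exact: sub_adj.
have [|a [b [ca cb <-]]] := cs_split cm iG1 _ G1E; first by move=> x /FG/GG1.
case: a ca => [/cs_0 FG1|a _].
  by exfalso; apply: nGe; apply: FG; rewrite FG1 eG1; apply: adj_id.
have := IH _ _ _ iG1 (@subset_refl _ _) cb cn1 G1E; lia.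
Qed.

Lemma cs_uniq m n F E : cs m F E -> cs n F E -> m = n.
Proof.
move=> cm cn; have [iF _ _] := cs_idl cm.
by apply/eqP; rewrite eqn_leq (cs_le cm iF _ cn) ?(cs_le cn iF _ cm).
Qed.

Lemma cs_pos n F E : cs n F E -> F <> E -> (0 < n)%N.
Proof. by case: n => // /cs_0. Qed.

Lemma cs_chain n F E (G : nat -> set R) m : cs n F E ->
  (forall i, (i <= m)%N -> idl (G i)) ->
  (forall i, (i < m)%N -> G i `<` G i.+1) ->
  F `<=` G 0%N -> G m `<=` E -> (m <= n)%N.
Proof.
elim: m n E => [//|m IH] n E cn iG sG FG GE.
have FGk k : (k <= m.+1)%N -> F `<=` G k.
  elim: k => // k IHk km; apply: subset_trans (IHk _) _; first by lia.
  by case: (sG k km).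
have [GmE _] := sG m (ltnSn m).
have [a [b [ca cb <-]]] : exists a b, [/\ cs a F (G m), cs b (G m) E & (a + b)%N = n].
  by apply: cs_split => //; [exact: iG|exact: FGk|move=> x /GmE/GE].
have := IH a (G m) ca (fun i im => iG i (leqW im)) (fun i im => sG i (leqW im)) FG (@subset_refl _ _).
have : (0 < b)%N.
  apply: cs_pos cb _ => GmE'; have [_] := sG m (ltnSn m); apply.
  by rewrite GmE'.
lia.
Qed.

(** Each factor is killed by a maximal ideal, hence by the Jacobson radical; [n] factors are killed
    by its [n]-th power. *)
Lemma cs_jacobson n F E x e : cs n F E -> ideal_power setT (jacobson R) n x -> E e ->
  F (x * e).
Proof.
move=> H; elim: H x e => [{}F iF|{}n {}F F1 {}E [iF [M [e [mM nFe Me ->]]]] csn IH] x e'.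
  by move=> _; apply: idlM.
move=> [s Hs ->] Ee; rewrite mulr_suml big_seq; apply: (big_ind F) => [|y z|p ps].
- exact: idl0.
- exact: idlD.
- have [px py] := Hs p ps.
  have [f [a [Ff e1]]] := IH _ _ px Ee.
  rewrite [p.1 * _]mulrC -mulrA e1 mulrDr; apply: idlD => //; first exact: idlM.
  by rewrite mulrCA; apply: idlM => //; apply: Me; apply: py.
Qed.

Definition scale x F : set R := [set x * f | f in F].

Lemma idl_scale x F : idl F -> idl (scale x F).
Proof.
move=> iF; apply: mk_idl; first by exists 0; [exact: idl0|rewrite mulr0].
- by move=> _ _ [f Ff <-] [g Fg <-]; exists (f + g); [exact: idlD|rewrite mulrDr].
- by move=> a _ [f Ff <-]; exists (a * f); [exact: idlM|rewrite mulrCA].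
Qed.

Lemma scaleI x f g : regular x -> x * f = x * g -> f = g.
Proof. by move=> rx e; apply/eqP; rewrite -subr_eq0; apply/eqP/rx; rewrite mulrBr e subrr. Qed.

Lemma cs_scale n F E x : regular x -> cs n F E -> cs n (scale x F) (scale x E).
Proof.
move=> rx; elim=> [{}F iF|{}n {}F F1 {}E [iF [M [e [mM nFe Me ->]]]] csn IH].
  exact/cs0/idl_scale.
apply: csS IH; split; first exact: idl_scale.
exists M, (x * e); split=> //.
- by move=> [f Ff /(scaleI rx) fe]; apply: nFe; rewrite -fe.
- by move=> m Mm; exists (m * e); [exact: Me|rewrite mulrCA].
- apply/seteqP; split=> [_ [_ [f [a [Ff ->]]] <-]|_ [_ [a [[f Ff <-] ->]]]].
    by exists (x * f), a; split; [exists f|rewrite mulrDr mulrCA].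
  by exists (f + a * e); [exists f, a|rewrite mulrDr mulrCA].
Qed.

Lemma scale_pri x y : scale x (pri y) = pri (x * y).
Proof.
apply/seteqP; split=> [_ [_ [a ->] <-]|_ [a ->]].
  by exists a; rewrite mulrCA.
by exists (a * y); [exists a|rewrite mulrCA].
Qed.

Lemma scale_sub x F : idl F -> scale x F `<=` F.
Proof. by move=> iF _ [f Ff <-]; apply: idlM. Qed.

Lemma pri1 : pri 1 = setT.
Proof. by apply/seteqP; split=> // x _; exists x; rewrite mulr1. Qed.

Lemma scaleT x : scale x setT = pri x.
Proof. by rewrite -pri1 scale_pri mulr1. Qed.

Lemma regularX x n : regular x -> regular (x ^+ n).
Proof.
move=> rx; elim: n => [|n IH] y; first by rewrite expr0 mul1r.
by rewrite exprSr -mulrA => /IH/rx.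
Qed.

Lemma regularM x y : regular x -> regular y -> regular (x * y).
Proof. by move=> rx ry z; rewrite -mulrA => /rx/ry. Qed.

(* A composition series of [R / x R] bounds the chains from [x E] to [E]. *)
Lemma cs_scale_len L x E : noetherian R -> ~ prime_chain R 2 -> regular x ->
  cs L (pri x) setT -> idl E -> (exists2 z, E z & regular z) -> cs L (scale x E) E.
Proof.
move=> nR nch rx cL iE [z Ez rz].
have rxz : regular (x * z) by apply: regularM.
have xEz : scale x E (x * z) by exists z.
have [n cn] := cs_exists nR nch (idl_scale x iE) iE (scale_sub iE) xEz rxz.
have [a ca] := cs_exists nR nch iE idlT (@subsetT _ E) Ez rz.
have := cs_scale rx ca; rewrite scaleT => cxa.
have := cs_uniq (cs_cat cxa cL) (cs_cat cn ca).
by rewrite addnC => /addIn ->.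
Qed.

Lemma cs_pow L x k : regular x -> cs L (pri x) setT -> cs (k * L) (pri (x ^+ k)) setT.
Proof.
move=> rx cL; elim: k => [|k IH]; first by rewrite expr0 pri1; exact/cs0/idlT.
have := cs_scale rx IH; rewrite scale_pri scaleT -exprS => c.
by rewrite mulSn addnC; apply: cs_cat cL.
Qed.

(* The ideals generated by the quotients of [x] by the powers of [y] increase. *)
Lemma separated y x : noetherian R -> regular y -> jacobson R y ->
  (forall k, pri (y ^+ k) x) -> x = 0.
Proof.
move=> nR ry Jy H.
have /choice[r Hr] : forall k, exists a, x = a * y ^+ k by [].
have rS k : r k = r k.+1 * y.
  apply: (scaleI (regularX (n:=k) ry)); rewrite mulrC -Hr {1}(Hr k.+1) exprS; ring.
have [||_ [k _ <-] maxk] := @noetherian_max [set pri (r k) | k in setT] nR.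
- by exists (pri (r 0%N)), 0%N.
- by move=> _ [k _ <-]; apply: idl_pri.
have : pri (r k) (r k.+1).
  rewrite -(maxk (pri (r k.+1))); [exact: pri_id|by exists k.+1|].
  by apply: (pri_sub (idl_pri _)); exists y; rewrite {1}rS mulrC.
move=> [a e].
have [[b eb]|nu] := pselect (pri (1 - a * y) 1); last first.
  have [M mM sM] := max_ideal_above nR (idl_pri _) nu.
  exfalso; apply: (max_n1 mM); rewrite -[1](subrK (a * y)).
  apply: (idlD (max_idl mM)); first by apply: sM; exact: pri_id.
  by apply: (idlM _ (max_idl mM)); exact: Jy.
have r0 : r k.+1 = 0.
  have h : (1 - a * y) * r k.+1 = 0 by rewrite mulrBl mul1r {1}e rS; ring.
  by rewrite -[r _]mul1r eb -mulrA h mulr0.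
by rewrite (Hr k.+1) r0 mul0r.
Qed.

End NoetherianRings.

(** * Localization *)

Section LocalizationTheory.
Variables (R : comPzRingType) (S : mulset R).
Local Notation l := (@to_loc R S).

Let quotP (x y : R * set_type (S : set R)) :
  reflect (to_quot (ratio_preRing S) x = to_quot (ratio_preRing S) y) (ratio_eqv x y).
Proof. by apply: (iffP idP) => /(to_quot_eq (ratio_preRing S)). Qed.

Let idE r s r' s' (Ss : S s) (Ss' : S s') : r * s' = r' * s ->
  to_quot (ratio_preRing S) (mk_ratio r Ss) = to_quot (ratio_preRing S) (mk_ratio r' Ss').
Proof.
move=> e; apply/quotP/asboolP; exists 1; [exact: mulset1|].
by change (1 * (r * s' - r' * s) = 0); rewrite e subrr mulr0.
Qed.

Lemma to_loc0 : l 0 = 0. Proof. by []. Qed.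
Lemma to_loc1 : l 1 = 1. Proof. by []. Qed.

Lemma to_locD x y : l (x + y) = l x + l y.
Proof. by rewrite -to_quotD; apply: idE; rewrite ?/num ?/den /=; ring. Qed.

Lemma to_locM x y : l (x * y) = l x * l y.
Proof. by rewrite -to_quotM; apply: idE; rewrite ?/num ?/den /=; ring. Qed.

Lemma to_locN x : l (- x) = - l x.
Proof. by rewrite -to_quotN; apply: idE; rewrite ?/num ?/den /=; ring. Qed.

Lemma to_locB x y : l (x - y) = l x - l y.
Proof. by rewrite to_locD to_locN. Qed.

Lemma to_locX x n : l (x ^+ n) = l x ^+ n.
Proof. by elim: n => [|n IH]; rewrite ?expr0 ?to_loc1 // !exprS to_locM IH. Qed.

Lemma to_loc_sum I (s : seq I) (F : I -> R) :
  l (\sum_(i <- s) F i) = \sum_(i <- s) l (F i).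
Proof.
by elim: s => [|i s IH]; rewrite ?big_nil ?to_loc0 // !big_cons to_locD IH.
Qed.

Lemma to_loc_eq0 x : l x = 0 <-> exists2 t, S t & t * x = 0.
Proof.
split=> [/quotP/asboolP[t St]|[t St tx]].
  by rewrite /num /den /= !(mulr1, mul0r) subr0; exists t.
apply/quotP/asboolP; exists t => //.
by rewrite /num /den /= !(mulr1, mul0r) subr0.
Qed.

Lemma loc_frac a : exists r s, S s /\ l s * a = l r.
Proof.
move: a; apply: to_quotW => x; exists (num x), (den x); split; first exact: den_in.
by rewrite -to_quotM; apply: idE; rewrite ?/num ?/den /=; ring.
Qed.

Lemma loc_unit s : S s -> exists u, l s * u = 1.
Proof.
move=> Ss; exists (to_quot (ratio_preRing S) (mk_ratio 1 Ss)).
by rewrite -to_quotM -to_loc1; apply: idE; rewrite ?/num ?/den /=; ring.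
Qed.

(** Choosing the inverse by [xget] makes it a function of [s] alone, without a membership proof as
    argument; it is only meaningful for [s] in [S]. *)
Definition linv s : loc S := xget 0 [set u | l s * u = 1].

Lemma linvP s : S s -> l s * linv s = 1.
Proof. by move=> /loc_unit; apply: (@xgetPex _ 0 [set u | l s * u = 1]). Qed.

Lemma loc_fracE a : exists r s, S s /\ a = l r * linv s.
Proof.
have [r [s [Ss e]]] := loc_frac a; exists r, s; split=> //.
by rewrite -e mulrAC (linvP Ss) mul1r.
Qed.

Definition contract (I : set (loc S)) : set R := [set r | I (l r)].

Lemma idl_contract I : idl I -> idl (contract I).
Proof.
move=> iI; apply: mk_idl; rewrite /contract /=; first by rewrite to_loc0; exact: idl0.
- by move=> x y; rewrite to_locD; exact: idlD.
- by move=> a x; rewrite to_locM; exact: idlM.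
Qed.

Lemma contract_in I r s : idl I -> S s -> I (l r * linv s) <-> contract I r.
Proof.
move=> iI Ss; split=> [Irs|Ir]; last exact: (idlMr _ iI Ir).
by rewrite /contract /= -[l r]mulr1 -(linvP Ss) mulrCA; exact: (idlM _ iI Irs).
Qed.

Lemma contract_sub I J : idl I -> idl J -> contract I `<=` contract J -> I `<=` J.
Proof.
move=> iI iJ e a; have [r [s [Ss ->]]] := loc_fracE a.
by rewrite !contract_in // => /e.
Qed.

Lemma loc_noetherian : noetherian R -> noetherian (loc S).
Proof.
move=> nR I iI; have [s e] := nR _ (idl_contract iI).
exists (map l s).
have iG := idl_gen (map l s).
apply/seteqP; split; last first.
  apply: gen_idealP => // _ /mapP[x xs ->].
  by have : contract I x by rewrite e; apply: mem_gen_ideal.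
apply: contract_sub => //; rewrite e; apply: gen_idealP; first exact: idl_contract.
by move=> x xs; apply: mem_gen_ideal; apply: map_f.
Qed.

Lemma contract_prime P : prime_ideal setT P -> prime_ideal setT (contract P).
Proof.
move=> pP; have iP := prime_idl pP; split; first exact: idl_contract.
  by move=> e; apply: (prime_n1 pP); have : contract P 1 by rewrite e.
move=> x y _ _; rewrite /contract /= to_locM.
by case: pP => _ _ H; apply: H.
Qed.

Lemma loc_chain : ~ prime_chain R 2 -> ~ prime_chain (loc S) 2.
Proof.
move=> nch [P [pP sP]]; apply: nch; exists (fun i => contract (P i)); split.
  by move=> i /pP/contract_prime.
move=> i i2; have [s ns] := sP i i2; split; first by move=> x /s.
by move=> H; apply: ns; apply: contract_sub H; apply: prime_idl; apply: pP => //; exact: ltnW.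
Qed.

End LocalizationTheory.

(** * The local ring at a maximal ideal *)

Section LocalRing.
Variables (R : comPzRingType) (M : set R) (maxM : max_ideal R M).
Local Notation A := (loc_at maxM).
Local Notation S := (max_mulset maxM).
Local Notation l := (@to_loc R S).

Lemma loc_at_eq0 x : l x = 0 <-> exists2 t, ~ M t & t * x = 0.
Proof. exact: to_loc_eq0. Qed.

Definition mloc : set A := [set a | exists r s, [/\ M r, ~ M s & a = l r * linv S s]].

Lemma mlocE r s : ~ M s -> mloc (l r * linv S s) <-> M r.
Proof.
have iM := max_idl maxM.
move=> nMs; split=> [[r' [s' [Mr nMs' e]]]|Mr]; last by exists r, s.
have : l (s' * r - s * r') = 0.
  rewrite to_locB !to_locM.
  have -> : l r = l r * linv S s * l s by rewrite -mulrA [linv _ _ * _]mulrC linvP // mulr1.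
  rewrite e.
  transitivity (l r' * l s * (l s' * linv S s') - l s * l r'); first ring.
  by rewrite linvP // mulr1; ring.
move=> /loc_at_eq0[t nMt h].
have Mts : M (t * s' * r).
  have -> : t * s' * r = t * (s' * r - s * r') + t * s * r' by ring.
  by rewrite h add0r; apply: idlM.
apply: contrapT => nMr; apply: (primeM (max_prime maxM) _ nMr Mts).
exact: (primeM (max_prime maxM)).
Qed.

Lemma mloc_to r : mloc (l r) <-> M r.
Proof.
have n1 := max_n1 maxM.
have -> : l r = l r * linv S 1.
  by have := linvP (S := S) n1; rewrite to_loc1 mul1r => ->; rewrite mulr1.
exact: mlocE.
Qed.

Lemma mloc_unit a : ~ mloc a -> exists u, a * u = 1.
Proof.
have [r [s [Ss ->]]] := loc_fracE a; rewrite mlocE // => nMr.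
exists (l s * linv S r).
transitivity ((l s * linv S s) * (l r * linv S r)); first ring.
by rewrite !linvP // mulr1.
Qed.

Lemma idl_mloc : idl mloc.
Proof.
have iM := max_idl maxM.
apply: mk_idl.
- by rewrite -(to_loc0 S) mloc_to; apply: idl0.
- move=> _ _ [r [s [Mr nMs ->]]] [r' [s' [Mr' nMs' ->]]].
  have nss := primeM (max_prime maxM) nMs nMs'.
  have e : linv S (s * s') = linv S s * linv S s'.
    rewrite -[RHS]mulr1 -(linvP (S := S) nss) to_locM.
    transitivity (linv S (s * s') * (l s * linv S s) * (l s' * linv S s')); last ring.
    by rewrite !linvP // !mulr1.
  have -> : l r * linv S s + l r' * linv S s' = l (r * s' + r' * s) * linv S (s * s').
    rewrite e to_locD !to_locM.
    transitivity (l r * linv S s * (l s' * linv S s') + l r' * linv S s' * (l s * linv S s)).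
      by rewrite !linvP // !mulr1.
    ring.
  by rewrite mlocE //; apply: idlD => //; apply: idlMr.
- move=> a _ [r [s [Mr nMs ->]]]; have [r' [s' [Ss' ->]]] := loc_fracE a.
  have nss := primeM (max_prime maxM) Ss' nMs.
  exists (r' * r), (s' * s); split=> //; first exact: idlM.
  have e : linv S (s' * s) = linv S s' * linv S s.
    rewrite -[RHS]mulr1 -(linvP (S := S) nss) to_locM.
    transitivity (linv S (s' * s) * (l s' * linv S s') * (l s * linv S s)); last ring.
    by rewrite !linvP // !mulr1.
  by rewrite e to_locM; ring.
Qed.

Lemma mloc_n1 : ~ mloc 1.
Proof. by rewrite -(to_loc1 S) mloc_to; exact: max_n1. Qed.

Lemma mloc_top I : idl I -> ~ I 1 -> I `<=` mloc.
Proof.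
move=> iI nI1 a Ia; apply: contrapT => /mloc_unit[u e]; apply: nI1.
by rewrite -e; apply: idlMr.
Qed.

Lemma mloc_max : max_ideal A mloc.
Proof.
split; [exact: idl_mloc|by move=> e; apply: mloc_n1; rewrite e|].
move=> I iI sI; have [I1|nI1] := pselect (I 1); first by right; apply: idl1.
by left; apply/seteqP; split=> //; apply: mloc_top.
Qed.

Lemma mloc_uniq N : max_ideal A N -> N = mloc.
Proof.
by move=> mN; apply: max_eq mloc_max _ => //; apply: mloc_top (max_n1 mN); exact: max_idl.
Qed.

Lemma jacobson_loc : jacobson A = mloc.
Proof.
apply/seteqP; split=> [a|a ma N /mloc_uniq->//]; apply; exact: mloc_max.
Qed.

Lemma ideal_power_loc (J : set R) k x : J `<=` M -> ideal_power setT J k x ->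
  ideal_power setT (jacobson A) k (l x).
Proof.
move=> JM; rewrite jacobson_loc.
elim: k x => [//|k IH] _ [s Hs ->].
exists [seq (l p.1, l p.2) | p <- s].
  by move=> _ /mapP[p /Hs[p1 p2] ->]; split; [exact: IH|apply/mloc_to/JM].
by rewrite big_map to_loc_sum; apply: eq_bigr => p _; rewrite to_locM.
Qed.

Lemma depth1_regular : depth A 1 -> exists2 y, M y & regular (l y).
Proof.
move=> [[[//|y [|//]] [memy regy _] _] _].
have my : mloc y by rewrite -jacobson_loc; apply: memy; rewrite inE.
have nil0 z : gen_ideal [::] z <-> z = 0 :> A.
  split; first by move=> [c ->]; rewrite big_ord0.
  by move=> ->; exists (fun=> 0); rewrite big_ord0.
have ry : regular y.
  by move=> z yz; apply/nil0; apply: (regy 0%N z) => //; apply/nil0.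
have [r [s [Mr nMs e]]] := my.
exists r => // z rz; apply: ry.
by rewrite e mulrAC rz mul0r.
Qed.

End LocalRing.

(* Vanishing is local, and each localization is separated because a regular
   element of its maximal ideal has a quotient of finite length. *)
Lemma admissible_reduced (R : comPzRingType) : cohen_macaulay1 R ->
  analytically_reduced R -> reduced R.
Proof.
move=> [nR [_ dim1] dep] ar x n xn.
have nch : ~ prime_chain R 2 by move=> /dim1.
(* The constant sequence [x] is nilpotent in the completion, hence zero there. *)
have xJ k : ideal_power setT (jacobson R) k x.
  have coh : coherent (jacobson R) (fun=> x).
    by move=> j; rewrite subrr; apply: idl0; apply: ideal_power_ideal.
  pose c := to_quot (cseq_preRing (jacobson R)) (mk_cseq coh).
  have powE m : exists2 a : set_type (coherent (jacobson R)),
      (forall j, term a j = x ^+ m) & c ^+ m = to_quot (cseq_preRing (jacobson R)) a.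
    elim: m => [|m [a Ha e]].
      eexists; last by rewrite expr0 -to_quot1.
      by move=> j; rewrite expr0.
    eexists; last by rewrite exprS e -to_quotM.
    by move=> j; rewrite /= /term /= exprS -(Ha j).
  have [a Ha e] := powE n.
  have : c = 0.
    apply: (ar _ n); rewrite e -to_quot0; apply/to_quot_eq/asboolP => j.
    by rewrite Ha xn /term /= subr0; apply: idl0; apply: ideal_power_ideal.
  by rewrite -to_quot0 => /to_quot_eq/asboolP/(_ k); rewrite /term /= subr0.
have locx M (mM : max_ideal R M) : to_loc (max_mulset mM) x = 0.
  have [y My ry] := depth1_regular (dep M mM).
  have nA := loc_noetherian (S := max_mulset mM) nR.
  have nchA := loc_chain (S := max_mulset mM) nch.
  have [L cL] := cs_exists nA nchA (idl_pri (to_loc (max_mulset mM) y)) (idlT _)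
    (@subsetT _ _) (@pri_id _ _) ry.
  apply: (separated nA ry).
    by rewrite jacobson_loc; apply/mloc_to.
  move=> k; rewrite -[to_loc _ x]mulr1; apply: (cs_jacobson (cs_pow k ry cL)) => //.
  by apply: ideal_power_loc (xJ _) => z; apply.
apply: contrapT => nx.
have [|M mM aM] := max_ideal_above nR (idl_ann [set x]).
  by move=> /(_ x erefl); rewrite mul1r.
have /loc_at_eq0[t nMt tx] := locx M mM.
by apply: nMt; apply: aM => _ ->.
Qed.

(* An element [b] killing [M] with [r + b] regular vanishes, since it vanishes
   locally at [M] and elsewhere. *)
Lemma max_regular (R : comPzRingType) (M : set R) : cohen_macaulay1 R -> reduced R ->
  max_ideal R M -> exists2 y, M y & regular y.
Proof.
move=> [nR _ dep] rR mM.
have [r [b [Mr ab rb]]] := reduced_reg nR rR (max_idl mM).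
have [y My ry] := depth1_regular (dep M mM).
suff b0 : b = 0 by exists r => //; rewrite -[r]addr0 -b0.
apply: contrapT => nb.
have lb : to_loc (max_mulset mM) b = 0.
  by apply: ry; rewrite -to_locM mulrC ab.
have /loc_at_eq0[t nMt tb] := lb.
have [a Ma] := max_inv mM nMt.
apply: nb; have -> : b = b * (1 - a * t) + a * (t * b) by ring.
by rewrite tb ab // mulr0 addr0.
Qed.

(** * The total ring of fractions *)

Section TotalRing.
Variable R : comPzRingType.
Local Notation Q := (total_ring R).
Local Notation t := (@to_total R).
Implicit Types (q : Q).

Lemma to_total0 : t 0 = 0. Proof. by []. Qed.
Lemma to_total1 : t 1 = 1. Proof. by []. Qed.
Lemma to_totalD x y : t (x + y) = t x + t y. Proof. exact: to_locD. Qed.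
Lemma to_totalM x y : t (x * y) = t x * t y. Proof. exact: to_locM. Qed.
Lemma to_totalN x : t (- x) = - t x. Proof. exact: to_locN. Qed.
Lemma to_totalB x y : t (x - y) = t x - t y. Proof. exact: to_locB. Qed.
Lemma to_totalX x n : t (x ^+ n) = t x ^+ n. Proof. exact: to_locX. Qed.
Lemma to_total_sum I (s : seq I) (F : I -> R) :
  t (\sum_(i <- s) F i) = \sum_(i <- s) t (F i).
Proof. exact: to_loc_sum. Qed.

Lemma to_total_eq0 x : t x = 0 -> x = 0.
Proof. by move=> /to_loc_eq0[s Ss]; apply: Ss. Qed.

Lemma to_total_inj x y : t x = t y -> x = y.
Proof.
move=> e; apply/eqP; rewrite -subr_eq0; apply/eqP/to_total_eq0.
by rewrite to_totalB e subrr.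
Qed.

Definition tinv (s : R) : Q := linv (regular_mulset R) s.

Lemma tinvP s : regular s -> t s * tinv s = 1.
Proof. exact: (@linvP _ (regular_mulset R)). Qed.

Lemma totalE q : exists r s, regular s /\ q = t r * tinv s.
Proof. by have [r [s [Ss ->]]] := loc_fracE q; exists r, s. Qed.

Lemma total_frac q : exists r s, regular s /\ t s * q = t r.
Proof. by have [r [s [Ss e]]] := loc_frac q; exists r, s. Qed.

Lemma unit_regular (T : comPzRingType) (x y : T) : x * y = 1 -> regular x.
Proof. by move=> xy z xz; rewrite -[z]mul1r -xy mulrAC xz mul0r. Qed.

Lemma regular_total s : regular s -> regular (t s).
Proof. by move=> rs; apply: unit_regular (tinvP rs). Qed.

Lemma regular_to_total s : regular (t s) -> regular s.
Proof.
move=> rs z sz; apply/to_total_eq0/rs.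
by rewrite -to_totalM sz.
Qed.

Lemma regular_unit q : regular q -> exists u, q * u = 1.
Proof.
have [r [s [rs sq]]] := total_frac q => rq.
have rr : regular r.
  apply: regular_to_total; rewrite -sq; apply: regularM => //.
  exact: regular_total.
exists (t s * tinv r); by rewrite mulrA [q * _]mulrC sq tinvP.
Qed.

(** Write [q = r / s'] and take [s = c r + b] regular with [b r = 0]. The idempotent [c r / s] is
    the support of [r]: on it [b] vanishes, off it [r] does. The unit [(r s + b) / (s s')] equals
    [r / s'] on the support and [1 / s'] off it. *)
Lemma total_vonNeumann : noetherian R -> reduced R ->
  forall q, exists e u v : Q, [/\ e * e = e, q = e * u & u * v = 1].
Proof.
move=> nR rR q; have [r [s' [rs' sq]]] := total_frac q.
have [_ [b [[c ->] ab rs]]] := reduced_reg nR rR (idl_pri r).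
have br : b * r = 0 by apply: ab; exact: pri_id.
set s := c * r + b in rs.
have ru : regular (r * s + b).
  move=> z; rewrite mulrC => h.
  have zr : z * r = 0.
    apply: (reduced_sqr rR); apply: rs.
    transitivity (z * r * (z * (r * s + b)) - z * z * (b * r)); first ring.
    by rewrite h br !mulr0 subrr.
  apply: rs; move: h; rewrite mulrDr mulrA zr mul0r add0r => zb.
  by rewrite mulrC mulrDr zb mulrCA zr mulr0 addr0.
have tis := tinvP rs; have tis' := tinvP rs'; have tiu := tinvP ru.
exists (t (c * r) * tinv s), (t (r * s + b) * tinv s * tinv s'),
  (tinv (r * s + b) * t s * t s').
have e1 : t (c * r) * t s = t (c * r) * t (c * r).
  rewrite -!to_totalM; congr to_total.
  have -> : c * r * s = c * r * (c * r) + c * (b * r) by rewrite /s; ring.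
  by rewrite br mulr0 addr0.
split.
- transitivity (t (c * r) * t (c * r) * tinv s * tinv s); first ring.
  rewrite -e1; transitivity (t (c * r) * (t s * tinv s) * tinv s); first ring.
  by rewrite tis mulr1.
- have e2 : t (c * r) * t (r * s + b) = t r * t s * t s.
    rewrite -!to_totalM; congr to_total.
    transitivity (r * s * (c * r) + c * (b * r)); first ring.
    rewrite br mulr0 addr0.
    transitivity (r * s * (c * r + b) - s * (b * r)); first ring.
    by rewrite br mulr0 subr0.
  transitivity (t (c * r) * t (r * s + b) * tinv s * tinv s * tinv s'); last ring.
  rewrite e2; transitivity (t r * (t s * tinv s) * (t s * tinv s) * tinv s'); last ring.
  rewrite tis !mulr1 -sq mulrAC; by rewrite tis' mul1r.
- transitivity ((t (r * s + b) * tinv (r * s + b)) * (t s * tinv s) * (t s' * tinv s')).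
    ring.
  by rewrite tis tis' tiu !mulr1.
Qed.

Lemma base_ringP q : base_ring R q <-> exists r, q = t r.
Proof. by split=> [[r _ <-]|[r ->]]; exists r. Qed.

Lemma base_ring_to r : base_ring R (t r). Proof. by exists r. Qed.

Section Submodules.
Variable E : set Q.
Hypothesis sE : submodule (base_ring R) E.

Lemma sub0 : E 0. Proof. by case: sE. Qed.
Lemma subD x y : E x -> E y -> E (x + y). Proof. by case: sE => _ H _; apply: H. Qed.
Lemma subM r x : E x -> E (t r * x).
Proof. by case: sE => _ _ H; apply: H; exact: base_ring_to. Qed.
Lemma subN x : E x -> E (- x).
Proof. by move=> /(subM (-1)); rewrite to_totalN to_total1 mulN1r. Qed.
Lemma subB x y : E x -> E y -> E (x - y).
Proof. by move=> Ex Ey; apply: subD => //; apply: subN. Qed.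

(** When [c] is a denominator of [E], this is the ideal [c E]; it makes lengths of ideals available
    for fractional ideals. *)
Definition pull c : set R := [set r | E (t r * tinv c)].

Lemma idl_pull c : idl (pull c).
Proof.
apply: mk_idl; rewrite /pull /=; first by rewrite to_total0 mul0r; exact: sub0.
- by move=> x y; rewrite to_totalD mulrDl; exact: subD.
- by move=> a x; rewrite to_totalM -mulrA; exact: subM.
Qed.

End Submodules.

Lemma mk_sub (E : set Q) : E 0 -> (forall x y, E x -> E y -> E (x + y)) ->
  (forall r x, E x -> E (t r * x)) -> submodule (base_ring R) E.
Proof. by move=> E0 ED EM; split=> // _ x [r _ <-]; apply: EM. Qed.

Lemma fractional_den (E : set Q) : fractional_ideal E ->
  exists2 c, regular c & forall x, E x -> exists r, t c * x = t r.
Proof.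
move=> [_ [_ [[c _ <-] rc] H]]; exists c; first exact: regular_to_total.
by move=> x /H[r _ <-]; exists r.
Qed.

Lemma pull_in (E : set Q) c x : regular c -> (exists r, t c * x = t r) ->
  E x -> exists2 r, pull E c r & x = t r * tinv c.
Proof.
move=> rc [r e] Ex; have ex : x = t r * tinv c by rewrite -e mulrAC tinvP // mul1r.
by exists r => //; rewrite /pull /= -ex.
Qed.

Lemma regular_fractional_in (E : set Q) : regular_fractional_ideal E ->
  exists2 z, regular z & E (t z).
Proof.
move=> [[sE _] [x [Ex rx]]]; have [r [s [rs e]]] := total_frac x.
exists r; last by rewrite -e; apply: subM.
apply: regular_to_total; rewrite -e; apply: regularM => //; exact: regular_total.
Qed.

End TotalRing.

(** * Injective modules and Gorenstein rings *)

Section LinearMaps.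
Variable A : comPzRingType.

Definition linclosed (V : lmodType A) (N : set V) :=
  N 0 /\ forall (a : A) x y, N x -> N y -> N (a *: x + y).

Lemma linclosedD (V : lmodType A) (N : set V) x y :
  linclosed N -> N x -> N y -> N (x + y).
Proof. by case=> _ H Nx Ny; rewrite -[x]scale1r; apply: H. Qed.

Lemma linclosedZ (V : lmodType A) (N : set V) a x :
  linclosed N -> N x -> N (a *: x).
Proof. by case=> N0 H Nx; rewrite -[_ *: _]addr0; apply: H. Qed.

Lemma linclosedN (V : lmodType A) (N : set V) x : linclosed N -> N x -> N (- x).
Proof. by rewrite -scaleN1r; apply: linclosedZ. Qed.

Lemma linear_pack (U V : lmodType A) (f : U -> V) : linear f ->
  exists g : {linear U -> V}, g =1 f.
Proof.
move=> lf; pose g : {linear U -> V} := HB.pack f (GRing.isLinear.Build _ _ _ _ f lf).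
by exists g.
Qed.

Section Submodule.
Variables (V : lmodType A) (N : set V) (hN : linclosed N).

Definition sub_pred : pred V := fun x => `[< N x >].
(** The proof of closure is an argument of the type, so that the module structure is inferred from
    the type alone. *)
Definition submod_of (h : linclosed N) := {x : V | sub_pred x}.

Local Notation W := (submod_of hN).
HB.instance Definition _ := SubType.on W.
HB.instance Definition _ := Choice.on W.

Let closed : subsemimod_closed sub_pred.
Proof.
split=> [|a x /asboolP Nx]; last by apply/asboolP; exact: linclosedZ.
split; first by apply/asboolP; case: hN.
by move=> x y /asboolP Nx /asboolP Ny; apply/asboolP; exact: linclosedD.
Qed.

HB.instance Definition _ := GRing.SubChoice_isSubLmodule.Build A V sub_pred W closed.

Lemma submod_ex x : N x -> exists w : W, val w = x.
Proof. by move=> /asboolP Nx; exists (exist _ x Nx). Qed.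

Lemma submod_val (w : W) : N (val w). Proof. by apply/asboolP; exact: (valP w). Qed.

End Submodule.

Section Quotient.
Variables (V : lmodType A) (N : set V) (hN : linclosed N).

Definition mq_rel (x y : V) := `[< N (x - y) >].

Lemma mq_refl : reflexive mq_rel.
Proof. by move=> x; apply/asboolP; rewrite subrr; case: hN. Qed.

Let mq_sym' x y : mq_rel x y -> mq_rel y x.
Proof. by move=> /asboolP h; apply/asboolP; rewrite -opprB; exact: linclosedN. Qed.

Lemma mq_sym : symmetric mq_rel.
Proof. by move=> x y; apply/idP/idP; exact: mq_sym'. Qed.

Lemma mq_trans : transitive mq_rel.
Proof.
move=> y x z /asboolP h /asboolP h'; apply/asboolP.
by rewrite -(subrKA y); exact: linclosedD.
Qed.

Definition mq_equiv := EquivRel mq_rel mq_refl mq_sym mq_trans.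
Definition mquot := {eq_quot mq_equiv}%qT.
Local Notation W := mquot.
HB.instance Definition _ := EqQuotient.on W.
HB.instance Definition _ := Choice.on W.

Definition mpi (x : V) : W := \pi_(W)%qT x.

Lemma mpi_eq x y : mpi x = mpi y <-> N (x - y).
Proof. by split=> [/eqmodP/asboolP|h]; last exact/eqmodP/asboolP. Qed.

Lemma mpiW (w : W) : exists x, mpi x = w.
Proof. by elim/quotW: w => x; exists x. Qed.

Lemma repr_mpi x : N (repr (mpi x) - x).
Proof. by apply/mpi_eq; rewrite /mpi reprK. Qed.

Let opp (w : W) := mpi (- repr w).
Let add (w w' : W) := mpi (repr w + repr w').
Let scale (a : A) (w : W) := mpi (a *: repr w).

Let oppE x : opp (mpi x) = mpi (- x).
Proof. by apply/mpi_eq; rewrite -opprD; apply: linclosedN => //; exact: repr_mpi. Qed.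

Let addE x y : add (mpi x) (mpi y) = mpi (x + y).
Proof.
by apply/mpi_eq; rewrite opprD addrACA; apply: linclosedD => //; exact: repr_mpi.
Qed.

Let scaleE a x : scale a (mpi x) = mpi (a *: x).
Proof. by apply/mpi_eq; rewrite -scalerBr; apply: linclosedZ => //; exact: repr_mpi. Qed.

Let ind (P : W -> Prop) : (forall x, P (mpi x)) -> forall w, P w.
Proof. by move=> H w; have [x <-] := mpiW w. Qed.

Let addA : associative add.
Proof. by elim/ind=> x; elim/ind=> y; elim/ind=> z; rewrite !addE addrA. Qed.
Let addC : commutative add.
Proof. by elim/ind=> x; elim/ind=> y; rewrite !addE addrC. Qed.
Let add0 : left_id (mpi 0) add.
Proof. by elim/ind=> x; rewrite addE add0r. Qed.
Let addN : left_inverse (mpi 0) opp add.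
Proof. by elim/ind=> x; rewrite oppE addE addNr. Qed.

HB.instance Definition _ := GRing.isZmodule.Build W addA addC add0 addN.

Let mpiD x y : mpi x + mpi y = mpi (x + y). Proof. exact: addE. Qed.

Let scaleA a b w : scale a (scale b w) = scale (a * b) w.
Proof. by move: w; elim/ind=> x; rewrite !scaleE scalerA. Qed.
Let scale1 : left_id 1 scale.
Proof. by elim/ind=> x; rewrite scaleE scale1r. Qed.
Let scaleD : right_distributive scale +%R.
Proof. by move=> a; elim/ind=> x; elim/ind=> y; rewrite mpiD !scaleE mpiD scalerDr. Qed.
Let scaleDl w : {morph scale^~ w : a b / a + b}.
Proof. by move: w; elim/ind=> x a b; rewrite /= !scaleE mpiD scalerDl. Qed.

HB.instance Definition _ := GRing.Zmodule_isLmodule.Build A W scaleA scale1 scaleD scaleDl.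

Lemma mpi_linear : linear mpi.
Proof. by move=> a x y; rewrite -mpiD; congr (_ + _); rewrite -scaleE. Qed.

End Quotient.

(* Partial linear maps from ideals of [A] to [M] are represented by their
   graphs. *)
Definition baer (M : lmodType A) := forall G : set (A^o * M)%type,
  linclosed G -> (forall m, G (0, m) -> m = 0) ->
  exists m, forall a n, G (a, n) -> n = a *: m.

(** The graph itself serves as the smaller module: its first projection is injective because the
    graph is functional, and the second projection is extended along it. *)
Lemma injective_baer (M : lmodType A) : injective_module M -> baer M.
Proof.
move=> iM G hG fG.
have [|i iE] := @linear_pack (submod_of hG) A^o (fun w => (val w).1).
  by move=> a x y; rewrite linearP.
have [|f fE] := @linear_pack (submod_of hG) M (fun w => (val w).2).
  by move=> a x y; rewrite linearP.
have [x y|g gf] := iM _ _ i f.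
  rewrite !iE => e; apply/eqP; rewrite -subr_eq0; apply/eqP/val_inj.
  rewrite linearB linear0 /=.
  have key (p q : A^o * M) : p.1 = q.1 -> G (p - q) -> p - q = 0.
    case: p q => [p1 p2] [q1 q2] /= ->.
    have -> : (q1, p2) - (q1, q2) = (0, p2 - q2) :> (A^o * M) by congr (_, _); rewrite /= ?subrr.
    by move=> /fG ->.
  by apply: key => //; have := submod_val (x - y); rewrite linearB.
exists (g 1) => a n /(submod_ex hG)[w e].
have := gf w; rewrite iE fE e /= => <-.
by rewrite -linearZ; congr (g _); rewrite /GRing.scale /= mulr1.
Qed.

(** Baer's criterion on graphs. In a maximal functional graph containing that of [f], the scalars
    [a] with [a *: y] in the domain form an ideal; the element [m] representing the map on it
    extends the graph to [y]. *)
Lemma baer_injective (M : lmodType A) : baer M -> injective_module M.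
Proof.
move=> bM X Y i f inj_i.
pose G0 : set (Y * M)%type := [set (i x, f x) | x in setT].
pose P := [set G : set (Y * M)%type |
  [/\ linclosed G, forall m, G (0, m) -> m = 0 & G0 `<=` G]].
have P0 : P G0.
  split=> //; last first.
    move=> m [x _ [ix <-]]; have -> : x = 0 by apply: inj_i; rewrite linear0.
    by rewrite linear0.
  split; first by exists 0 => //; rewrite !linear0.
  move=> a _ _ [x _ <-] [y _ <-]; exists (a *: x + y) => //.
  by rewrite !linearP.
have [||G [lG fG sG] maxG] := @zorn_sets _ P; first by exists G0.
  move=> F [G FG] FP tF; split.
  - split; first by exists G => //; have [[]] := FP _ FG.
    move=> a x y [D FD Dx] [Z FZ Zy].
    have [DZ|ZD] := tF _ _ FD FZ.
      exists Z => //; have [[_ H] _ _] := FP _ FZ; apply: H => //; exact: DZ.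
    exists D => //; have [[_ H] _ _] := FP _ FD; apply: H => //; exact: ZD.
  - by move=> m [D /FP[_ H _] /H].
  - by move=> x G0x; exists G => //; have [_ _] := FP _ FG; apply.
have total y : exists m, G (y, m).
  pose H : set (A^o * M)%type := [set p | G ((p.1 : A) *: y, p.2)].
  have [||m Hm] := bM H.
  - split; first by rewrite /H /= scale0r; case: lG.
    move=> a [b n] [b' n'] /= h h'; rewrite /H /=.
    have -> : ((a *: b + b' : A^o) *: y, a *: n + n') = a *: (b *: y, n) + (b' *: y, n') :> (Y * M).
      congr (_, _); rewrite /= scalerDl scalerA //.
    by case: lG => _; apply.
  - by move=> m; rewrite /H /= scale0r; apply: fG.
  pose G1 : set (Y * M)%type := [set p + a *: (y, m) | p in G & a in @setT A].
  exists m; suff <- : G1 = G.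
    by exists 0; [case: lG|exists 1 => //; rewrite add0r scale1r].
  apply: maxG; last by move=> p Gp; exists p => //; exists 0 => //; rewrite scale0r addr0.
  split; last by move=> p /sG Gp; exists p => //; exists 0 => //; rewrite scale0r addr0.
  - split; first by exists 0; [case: lG|exists 0 => //; rewrite scale0r addr0].
    move=> c _ _ [p Gp [a _ <-]] [q Gq [b _ <-]]; exists (c *: p + q); first by case: lG => _; apply.
    exists (c * a + b) => //; rewrite scalerDr scalerDl scalerA addrACA; reflexivity.
  - move=> n [[y1 n1] Gp [a _ [ey en]]].
    have : H (a, - n1).
      rewrite /H /=; have -> : (a *: y, - n1) = - (y1, n1) :> (Y * M).
        congr (_, _); apply/eqP; rewrite -addr_eq0 addrC; apply/eqP; exact: ey.
      exact: linclosedN.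
    by move=> /Hm e; rewrite -en -e subrr.
have /choice[g Hg] := total.
have uniqG y m m' : G (y, m) -> G (y, m') -> m = m'.
  move=> h h'; apply/eqP; rewrite -subr_eq0; apply/eqP/fG.
  have -> : (0, m - m') = (y, m) - (y, m') :> (Y * M) by congr (_, _); rewrite /= ?subrr.
  by apply: linclosedD => //; apply: linclosedN.
have [|gl glE] := @linear_pack _ _ g.
  move=> a x y; apply: (uniqG (a *: x + y)) => //.
  have -> : (a *: x + y, a *: g x + g y) = a *: (x, g x) + (y, g y) :> (Y * M) by [].
  by case: lG => _; apply.
exists gl => x; rewrite glE; apply: uniqG (Hg _) _; apply: sG; by exists x.
Qed.

End LinearMaps.

Section TotalModule.
Variable A : comPzRingType.

Definition total_mod : Type := total_ring A.
HB.instance Definition _ := GRing.Zmodule.on total_mod.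

Let scale (a : A) (q : total_mod) : total_mod := to_total a * (q : total_ring A).

Let scaleA a b w : scale a (scale b w) = scale (a * b) w.
Proof. by rewrite /scale to_totalM mulrA. Qed.
Let scale1 : left_id 1 scale.
Proof. by move=> w; rewrite /scale to_total1 mul1r. Qed.
Let scaleD : right_distributive scale +%R.
Proof. by move=> a x y; rewrite /scale mulrDr. Qed.
Let scaleDl w : {morph scale^~ w : a b / a + b}.
Proof. by move=> a b; rewrite /scale to_totalD mulrDl. Qed.

HB.instance Definition _ :=
  GRing.Zmodule_isLmodule.Build A total_mod scaleA scale1 scaleD scaleDl.

Lemma total_modZ (a : A) (q : total_mod) : a *: q = to_total a * (q : total_ring A).
Proof. by []. Qed.

End TotalModule.

Section GraphTools.
Variables (A : comPzRingType) (M : lmodType A).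
Implicit Types (G : set (A^o * M)%type).

Lemma graphD G (a b : A^o) (m n : M) : linclosed G -> G (a, m) -> G (b, n) -> G (a + b, m + n).
Proof. exact: linclosedD. Qed.

Lemma graphZ G (c : A) (a : A^o) (m : M) : linclosed G -> G (a, m) -> G (c * a, c *: m).
Proof. exact: linclosedZ. Qed.

Lemma graphN G (a : A^o) (m : M) : linclosed G -> G (a, m) -> G (- a, - m).
Proof. exact: linclosedN. Qed.

Lemma graphB G (a b : A^o) (m n : M) : linclosed G -> G (a, m) -> G (b, n) -> G (a - b, m - n).
Proof. by move=> lG h h'; apply: graphD => //; exact: graphN. Qed.

Lemma graph_uniq G a m n : linclosed G -> (forall m, G (0, m) -> m = 0) ->
  G (a, m) -> G (a, n) -> m = n.
Proof.
move=> lG fG h h'; apply/eqP; rewrite -subr_eq0; apply/eqP/fG.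
by rewrite -(subrr a); exact: graphB.
Qed.

Lemma mk_graph G : G (0, 0) ->
  (forall c a b m n, G (a, m) -> G (b, n) -> G (c * a + b, c *: m + n)) -> linclosed G.
Proof. by move=> G0 GD; split=> // c [a m] [b n]; apply: GD. Qed.

Definition gdom G : set A := [set a | exists m, G (a, m)].

Lemma idl_gdom G : linclosed G -> idl (gdom G).
Proof.
move=> lG; apply: mk_idl; first by exists 0; case: lG.
- by move=> a b [m h] [n h']; exists (m + n); exact: graphD.
- by move=> c a [m h]; exists (c *: m); exact: graphZ.
Qed.

(* A partial map on [J] extends by zero to [J + ann J], which contains a
   regular element. *)
Lemma baer_regular : noetherian A -> reduced A ->
  (forall G, linclosed G -> (forall m, G (0, m) -> m = 0) ->
    (exists2 z, regular z & gdom G z) ->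
    exists m, forall a n, G (a, n) -> n = a *: m) -> baer M.
Proof.
move=> nA rA H G lG fG.
pose G' : set (A^o * M)%type := [set p | exists a b, [/\ G (a, p.2), ann (gdom G) b & p.1 = a + b]].
have ia := idl_ann (gdom G).
have [|||m Hm] := H G'.
- apply: mk_graph; first by exists 0, 0; split; [case: lG|exact: idl0|rewrite addr0].
  move=> c _ _ m n [a [b [/= Ga ab ->]]] [a' [b' [/= Ga' ab' ->]]].
  exists (c * a + a'), (c * b + b'); split=> /=.
  + by apply: graphD => //; exact: graphZ.
  + exact: (idlD ia (idlM c ia ab) ab').
  + by ring.
- move=> m [a [b [/= Ga ab e]]]; apply: fG; suff a0 : a = 0 by rewrite -a0.
  apply: (reduced_sqr rA).
  have -> : a * a = a * (a + b) - b * a by ring.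
  rewrite -e mulr0 sub0r.
  by rewrite ab ?oppr0 //; exists m.
- have [r [b [[n Grn] ab rb]]] := reduced_reg nA rA (idl_gdom lG).
  by exists (r + b) => //; exists n, r, b.
- exists m => a n Gan; apply: Hm; exists a, 0; split=> //; first exact: idl0.
  by rewrite addr0.
Qed.

End GraphTools.

(* For a regular [x] in the maximal ideal [M]: the socle of [R / x] at [M] has
   dimension at most one, that is, [R] localized at [M] has type one. *)
Definition typ1 (R : comPzRingType) (M : set R) (x : R) := forall r s,
  (forall m, M m -> pri x (m * r)) -> (forall m, M m -> pri x (m * s)) ->
  ~ pri x r -> exists a, pri x (s - a * r).

(** For a regular [x] in [F] this is [x] times the colon of [R] by [F] in the total ring of
    fractions, so that duality of fractional ideals can be studied among ideals containing [x]. *)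
Definition dual (R : comPzRingType) (x : R) (F : set R) : set R :=
  [set a | forall b, F b -> pri x (a * b)].

(** * Duality of ideals modulo an element *)

Section DualIdeals.
Variables (R : comPzRingType) (x : R).
Implicit Types (F E : set R).
Local Notation "F ^*" := (dual x F).

Lemma idl_dual F : idl F^*.
Proof.
have ip := idl_pri x; apply: mk_idl; rewrite /dual /=.
- by move=> b _; rewrite mul0r; apply: idl0.
- by move=> a a' h h' b Fb; rewrite mulrDl; apply: idlD => //; [exact: h|exact: h'].
- by move=> c a h b Fb; rewrite -mulrA; apply: idlM => //; exact: h.
Qed.

Lemma dual_in F : F^* x. Proof. by move=> b _; exists b; rewrite mulrC. Qed.

Lemma dual_mono F E : F `<=` E -> E^* `<=` F^*.
Proof. by move=> FE a h b /FE; apply: h. Qed.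

Lemma dual_dual F : F `<=` F^*^*.
Proof. by move=> a Fa b h; rewrite mulrC; apply: h. Qed.

Lemma dualT : [set: R]^* = pri x.
Proof.
apply/seteqP; split=> [a /(_ 1 I)|a [c ->] b _]; first by rewrite mulr1.
by exists (c * b); rewrite mulrAC.
Qed.

Lemma dual_pri : (pri x)^* = setT.
Proof. by apply/seteqP; split=> // a _ _ [c ->]; exists (a * c); rewrite mulrA. Qed.

Lemma dual_adj F e a : idl F -> (adj F e)^* a <-> F^* a /\ pri x (a * e).
Proof.
have ip := idl_pri x; move=> iF; split=> [h|[h ae] _ [f [k [Ff ->]]]].
  by split=> [b Fb|]; apply: h; [exact: sub_adj|exact: adj_id].
by rewrite mulrDr mulrCA; apply: idlD => //; [exact: h|exact: idlM].
Qed.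

(* If every socle modulo [x] is simple, then [dual x] does not increase
   lengths; applied to [F] and to the quotient by [F] this forces [F^** = F]. *)
Lemma dual_cs n F E : (forall M, max_ideal R M -> M x -> typ1 M x) ->
  F x -> cs n F E -> exists2 m, (m <= n)%N & cs m E^* F^*.
Proof.
have ip := idl_pri x; move=> t1 + H; elim: H => [{}F iF|{}n {}F F1 {}E [iF [M [e [mM nFe Me ->]]]] csn IH] Fx.
  by exists 0%N => //; exact: cs0 (idl_dual _).
have [m mn cm] := IH (sub_adj e Fx).
have Mx : M x.
  apply: contrapT => /(max_inv mM)[a Ma]; apply: nFe.
  have -> : e = (1 - a * x) * e + a * e * x by ring.
  by apply: idlD => //; [exact: Me|exact: idlM].
have sD := dual_mono (@sub_adj _ F e).
have [eq|neq] := pselect (F^* `<=` (adj F e)^*).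
  exists m; first by lia.
  by have -> : F^* = (adj F e)^* by apply/seteqP.
have [w Fw nw] : exists2 w, F^* w & ~ (adj F e)^* w.
  apply: contrapT => H; apply: neq => w Fw; apply: contrapT => nw; apply: H.
  by exists w.
have nwe : ~ pri x (w * e) by move=> we; apply: nw; apply/dual_adj.
exists (m + 1)%N; first by lia.
apply: cs_cat cm _; apply: (@csS _ _ _ F^*); last exact: cs0 (idl_dual _).
split; first exact: idl_dual.
exists M, w; split=> //.
  move=> k Mk; apply/dual_adj => //; split; first exact: (idlM _ (idl_dual _) Fw).
  by rewrite mulrAC mulrC; apply: Fw; exact: Me.
apply/seteqP; split; last by apply: adj_sub => //; exact: idl_dual.
move=> v Fv; have [||//|a ha] := t1 M mM Mx (w * e) (v * e).
- by move=> k Mk; rewrite mulrCA; apply: Fw; exact: Me.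
- by move=> k Mk; rewrite mulrCA; apply: Fv; exact: Me.
exists (v - a * w), a; split; last by rewrite subrK.
apply/dual_adj => //; split; last by rewrite mulrBl -mulrA.
exact: (idlB (idl_dual _) Fv (idlM a (idl_dual _) Fw)).
Qed.

Lemma dualK F : noetherian R -> ~ prime_chain R 2 -> regular x ->
  (forall M, max_ideal R M -> M x -> typ1 M x) -> idl F -> F x -> F^*^* = F.
Proof.
move=> nR nch rx t1 iF Fx; have ip := idl_pri x.
apply/seteqP; split; last exact: dual_dual.
have d3 : F^*^*^* = F^*.
  by apply/seteqP; split; [exact: dual_mono (@dual_dual _)|exact: dual_dual].
have iFF := idl_dual F^*.
have sF : pri x `<=` F by exact: pri_sub.
have [a ca] := cs_exists nR nch ip iF sF (pri_id x) rx.
have [b cb] := cs_exists nR nch iF iFF (@dual_dual F) Fx rx.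
have [c cc] := cs_exists nR nch iFF (@idlT _) (@subsetT _ _) (dual_dual Fx) rx.
have [a' aa ca'] := dual_cs t1 (pri_id x) ca.
have [c' cc' cc2] := dual_cs t1 (dual_dual Fx) cc.
rewrite d3 dualT in cc2; rewrite dual_pri in ca'.
(* Both series go from [pri x] to [setT], so [a + b + c = c' + a']; with [a' <= a] and [c' <= c]
   this leaves [b = 0]. *)
have := cs_uniq (cs_cat (cs_cat ca cb) cc) (cs_cat cc2 ca').
have b0 : b = 0%N -> F^*^* `<=` F by move=> b0; move: cb; rewrite b0 => /cs_0 <-.
by move=> e; apply: b0; lia.
Qed.

(** The dual of the sum [S] of the two duals lies in both biduals, that is in [F] and in [E]; hence
    the dual of the intersection lies in the bidual of [S], which is [S]. *)
Lemma dual_cap F E w : noetherian R -> ~ prime_chain R 2 -> regular x ->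
  (forall M, max_ideal R M -> M x -> typ1 M x) -> idl F -> F x -> idl E -> E x ->
  (F `&` E)^* w -> exists i j, [/\ F^* i, E^* j & w = i + j].
Proof.
move=> nR nch rx t1 iF Fx iE Ex hw.
pose S := [set w | exists i j, [/\ F^* i, E^* j & w = i + j]].
have iS : idl S.
  apply: mk_idl; first by exists 0, 0; split; [exact: idl0 (idl_dual _)|exact: idl0 (idl_dual _)|rewrite addr0].
    move=> _ _ [i [j [Fi Ej ->]]] [i' [j' [Fi' Ej' ->]]]; exists (i + i'), (j + j').
    by split; [exact: (idlD (idl_dual _) Fi Fi')|exact: (idlD (idl_dual _) Ej Ej')|ring].
  move=> a _ [i [j [Fi Ej ->]]]; exists (a * i), (a * j).
  by split; [exact: (idlM _ (idl_dual _) Fi)|exact: (idlM _ (idl_dual _) Ej)|ring].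
have FS : F^* `<=` S.
  by move=> i Fi; exists i, 0; split=> //; [exact: idl0 (idl_dual _)|rewrite addr0].
have ES : E^* `<=` S.
  by move=> i Fi; exists 0, i; split=> //; [exact: idl0 (idl_dual _)|rewrite add0r].
have Sx : S x by apply: FS; exact: dual_in.
suff: S w by [].
rewrite -(dualK nR nch rx t1 iS Sx); apply: (dual_mono _ hw) => a ha; split.
  by rewrite -(dualK nR nch rx t1 iF Fx); apply: (dual_mono _ ha).
by rewrite -(dualK nR nch rx t1 iE Ex); apply: (dual_mono _ ha).
Qed.

End DualIdeals.

Definition divisible (A : comPzRingType) (C : lmodType A) :=
  forall x : A, regular x -> forall c : C, exists c', c = x *: c'.

Lemma baer_divisible (A : comPzRingType) (M : lmodType A) : baer M -> divisible M.
Proof.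
move=> bM x rx c; pose G : set (A^o * M)%type := [set p | exists a, p = (a * x, a *: c)].
have [||m Hm] := bM G.
- apply: mk_graph; first by exists 0; rewrite mul0r scale0r.
  move=> k _ _ _ _ [a [-> ->]] [b [-> ->]]; exists (k * a + b).
  by rewrite mulrDl -mulrA scalerDl scalerA.
- by move=> m [a [/esym e ->]]; rewrite (rx a) ?scale0r // mulrC.
- by exists m; apply: Hm; exists 1; rewrite mul1r scale1r.
Qed.

(** * Finite injective dimension over a one-dimensional local ring *)

Section LocalModules.
Variables (A : comPzRingType) (N : set A) (x : A).
Hypotheses (nA : noetherian A) (nch : ~ prime_chain A 2) (rA : reduced A).
Hypotheses (mN : max_ideal A N) (uN : forall M, max_ideal A M -> M = N).
Hypotheses (Nx : N x) (rx : regular x).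

Let iN : idl N := max_idl mN.
Let ip : idl (pri x) := idl_pri x.

Lemma local_npri1 : ~ pri x 1.
Proof. by move=> /(pri_sub iN Nx)/(max_n1 mN). Qed.

Lemma local_killed F y b : idl F -> ~ F y -> F (b * y) -> N b.
Proof.
move=> iF nFy Fby; apply: contrapT => /(max_inv mN)[a Na].
have [u e] : exists u, u * (a * b) = 1.
  have nu : pri (a * b) 1.
    apply: contrapT => /(max_ideal_above nA (idl_pri _))[M /[dup] mM /uN -> sM].
    apply: (max_n1 mN); rewrite -[1](subrK (a * b)).
    by apply: idlD => //; apply: sM; exact: pri_id.
  by have [u ->] := nu; exists u.
by apply: nFy; rewrite -[y]mul1r -e -!mulrA; do 2![apply: idlM => //].
Qed.

Lemma local_socle : exists y, ~ pri x y /\ forall m, N m -> pri x (m * y).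
Proof.
have [y [M [_ /uN -> nxy My]]] := socle nA nch ip (pri_id x) rx local_npri1.
by exists y.
Qed.

Section Cosyzygy.
Variables (C I D : lmodType A) (f : {linear C -> I}) (g : {linear I -> D}).
Hypotheses (bI : baer I) (bD : baer D) (dC : divisible C) (inj_f : injective f).
Hypotheses (exact_fg : forall z, g z = 0 <-> exists c, f c = z).
Hypothesis (surj_g : forall d, exists z, g z = d).

(** Since [D] is injective, the map [x -> 0], [y -> c] is given by some [d] with [x d = 0] and
    [y d = c]. For a lift [z0] of [d], the element [x z0] comes from [C], where it can be divided by
    [x]; correcting [z0] accordingly makes [x] kill it, and then [y] times it is killed by [N]. *)
Lemma socle_lift (c : D) : (forall m, N m -> m *: c = 0) ->
  exists z : I, g z = c /\ forall m, N m -> m *: z = 0.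
Proof.
move=> Nc; have [y [nxy Ny]] := local_socle.
pose G : set (A^o * D)%type := [set p | exists a b : A, p = (a * x + b * y, b *: c)].
have [||d Hd] := bD (G := G).
- apply: mk_graph; first by exists 0, 0; rewrite !mul0r addr0 scale0r.
  move=> k _ _ _ _ [a [b [-> ->]]] [a' [b' [-> ->]]]; exists (k * a + a'), (k * b + b').
  by congr (_, _); [ring|rewrite scalerDl scalerA].
- move=> m [a [b [/esym e ->]]]; apply: Nc; apply: (local_killed ip nxy).
  by exists (- a); apply/eqP; rewrite -subr_eq0 mulNr opprK addrC; apply/eqP.
have xd : x *: d = 0.
  by symmetry; apply: Hd; exists 1, 0; rewrite mul1r mul0r addr0 scale0r.
have yd : c = y *: d.
  by apply: Hd; exists 0, 1; rewrite mul1r mul0r add0r scale1r.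
have [z0 gz0] := surj_g d.
have [c1 fc1] : exists c1, f c1 = x *: z0 by apply/exact_fg; rewrite linearZ gz0.
have [c2 ec2] := dC rx c1.
have xz : x *: (z0 - f c2) = 0 by rewrite scalerBr -fc1 ec2 linearZ subrr.
have gf c' : g (f c') = 0 by apply/exact_fg; exists c'.
exists (y *: (z0 - f c2)); split; first by rewrite linearZ linearB gf subr0 gz0.
move=> m /Ny[a e]; rewrite scalerA e -scalerA xz scaler0; reflexivity.
Qed.

(** This is the vanishing of [Ext^1 (A / N, C)]: by [socle_lift], the maps from [A / N] to [D] lift
    to [I]. *)
Lemma maximal_extend (H : set (A^o * C)%type) : linclosed H ->
  (forall m, N m -> exists n, H (m, n)) -> (forall n, H (0, n) -> n = 0) ->
  exists c, forall m n, N m -> H (m, n) -> n = m *: c.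
Proof.
move=> lH dH fH; pose H' : set (A^o * I)%type := [set p | exists2 n, H (p.1, n) & p.2 = f n].
have [||i Hi] := bI (G := H').
- apply: mk_graph; first by exists 0; [case: lH|rewrite /= linear0].
  move=> k a b m m' [n /= Hn ->] [n' /= Hn' ->]; exists (k *: n + n').
    by apply: graphD => //; exact: graphZ.
  by rewrite /= linearP.
- by move=> m [n /= /fH -> ->]; rewrite linear0.
have [m Nm|z [gz Nz]] := socle_lift (c := g i).
  have [n Hn] := dH m Nm; rewrite -linearZ; apply/exact_fg; exists n.
  by apply: Hi; exists n.
have [c fc] : exists c, f c = i - z by apply/exact_fg; rewrite linearB gz subrr.
exists c => m n Nm Hn; apply: inj_f; rewrite linearZ /= fc scalerBr Nz // subr0.
by apply: Hi; exists n.
Qed.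

(** All factors of a series from the domain to [A] are [A / N], so [maximal_extend] enlarges the
    domain one step at a time. *)
Lemma baer_cs n J T : cs n J T -> T = setT -> forall G : set (A^o * C)%type, linclosed G ->
  (forall n, G (0, n) -> n = 0) -> gdom G = J ->
  exists m, forall a n, G (a, n) -> n = a *: m.
Proof.
elim=> [F _ ->|{}n F F1 {}T st csn IH ET] G lG fG dG.
  have [m Gm] : gdom G 1 by rewrite dG.
  exists m => a n' Gan; apply: (graph_uniq lG fG Gan).
  by have := graphZ a lG Gm; rewrite mulr1.
have [iF [M [e [/uN -> nFe Ne eF1]]]] := st.
pose H : set (A^o * C)%type := [set p | G (p.1 * e, p.2)].
have lH : linclosed H.
  apply: mk_graph; first by rewrite /H /= mul0r; case: lG.
  move=> k a b m m' h h'; rewrite /H /= mulrDl -mulrA.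
  by apply: graphD => //; exact: graphZ.
have [||c Hc] := maximal_extend lH.
- by move=> m /Ne; rewrite -dG.
- by move=> m; rewrite /H /= mul0r; exact: fG.
pose G1 : set (A^o * C)%type := [set p | exists a n k, G (a, n) /\ p = (a + k * e, n + k *: c)].
have [|||m Hm] := IH ET G1.
- apply: mk_graph; first by exists 0, 0, 0; rewrite mul0r scale0r !addr0; case: lG.
  move=> k _ _ _ _ [a [n1 [b [h [-> ->]]]]] [a' [n1' [b' [h' [-> ->]]]]].
  exists (k * a + a'), (k *: n1 + n1'), (k * b + b'); split.
    by apply: graphD => //; exact: graphZ.
  by congr (_, _); [ring|rewrite scalerDr scalerDl scalerA addrACA].
- move=> m [a [n1 [k [h [/esym e0 ->]]]]].
  have ak : a = - (k * e) by apply/eqP; rewrite -addr_eq0; apply/eqP.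
  have Hk : H (k, - n1) by rewrite /H /= -[k * e]opprK -ak; exact: graphN.
  have Nk : N k.
    apply: (local_killed iF nFe); rewrite -dG; by exists (- n1).
  by rewrite -(Hc _ _ Nk Hk) subrr.
- rewrite eF1; apply/seteqP; split.
    move=> _ [_ [a [n1 [k [h [-> _]]]]]]; exists a, k; split=> //.
    by rewrite -dG; exists n1.
  move=> _ [a [k [Fa ->]]]; have [n1 h] : gdom G a by rewrite dG.
  by exists (n1 + k *: c), a, n1, k.
exists m => a n' h; apply: Hm; exists a, n', 0; split=> //.
by rewrite mul0r scale0r !addr0.
Qed.

Lemma cosyzygy_baer : baer C.
Proof.
apply: baer_regular => // G lG fG [z rz dz].
have [n cn] := cs_exists nA nch (idl_gdom lG) (@idlT _) (@subsetT _ _) dz rz.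
exact: (baer_cs cn erefl lG fG erefl).
Qed.

End Cosyzygy.

(** Injective modules are divisible and so are their quotients, hence the cosyzygy [D] is injective
    by induction and [cosyzygy_baer] applies. Used for the first cosyzygy of [A], this makes the
    injective dimension of [A] at most one. *)
Lemma divisible_injective n (C : lmodType A) : divisible C -> inj_dim_le n C -> baer C.
Proof.
elim: n C => [|n IH] C dC; first exact: injective_baer.
move=> [I [D [f [g [iI inj_f ex surj idD]]]]].
have bI := injective_baer iI.
have dD : divisible D.
  move=> y ry d; have [z <-] := surj d.
  by have [z' ->] := baer_divisible bI ry z; exists (g z'); rewrite linearZ.
exact: cosyzygy_baer bI (IH _ dD idD) dC inj_f ex surj.
Qed.

Section SelfInjective.
Variables (I D : lmodType A) (f : {linear A^o -> I}) (g : {linear I -> D}).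
Hypotheses (bI : baer I) (bD : baer D) (inj_f : injective f).
Hypotheses (exact_fg : forall z, g z = 0 <-> exists c, f c = z).
Hypothesis (surj_g : forall d, exists z, g z = d).

(* [A / x] is self-injective: [i1] with [x i1 = f 1] plays the role of [1 / x]. *)
Lemma quotient_self_injective (G : set (A^o * A^o)%type) : linclosed G ->
  (forall n, G (0, n) -> pri x n) -> G (x, 0) ->
  exists w, forall a n, G (a, n) -> pri x (n - a * w).
Proof.
move=> lG fG Gx; have [i1 ei1] := baer_divisible bI rx (f 1).
have fE (a : A^o) : f a = (a : A) *: f 1.
  by rewrite -linearZ; congr (f _); rewrite /GRing.scale /= mulr1.
have gf c : g (f c) = 0 by apply/exact_fg; exists c.
pose H : set (A^o * D)%type := [set p | exists2 n : A, G (p.1, n) & p.2 = g (n *: i1)].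
have [||d Hd] := bD (G := H).
- apply: mk_graph; first by exists 0; [exact: lG.1|rewrite /= scale0r linear0].
  move=> k a b m m' [n /= h ->] [n' /= h' ->]; exists (k * n + n').
    exact: (graphD (M := A^o) lG (graphZ (M := A^o) k lG h) h').
  by rewrite /= scalerDl linearD -scalerA [g (k *: (n *: i1))]linearZ.
- move=> m [n /= /fG[b ->] ->].
  by rewrite -scalerA -ei1 -fE gf.
have [i2 gi2] := surj_g d.
have lift (a n : A) : G (a, n) -> exists s : A, f s = n *: i1 - a *: i2.
  move=> h; have [s fs] : exists s, f s = n *: i1 - a *: i2; last by exists s.
  apply/exact_fg; rewrite linearB [g (a *: i2)]linearZ /= gi2.
  by apply/eqP; rewrite subr_eq0; apply/eqP; apply: Hd; exists n.
have key (a n s : A) : f s = n *: i1 - a *: i2 -> f (n - x * s) = a *: (x *: i2).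
  move=> fs; rewrite (linearB f) (fE n) ei1.
  have -> : f (x * s) = x *: f s by rewrite -linearZ.
  by rewrite fs scalerBr !scalerA [x * n]mulrC [x * a]mulrC opprB addrC subrK.
have [s0 /key e0] := lift _ _ Gx.
exists (- s0) => a n /lift[s fs]; exists s.
have e := key _ _ _ fs.
suff : n - x * s = a * (- s0) by move=> <-; ring.
apply: (scaleI rx); apply: inj_f.
have -> : f (x * (n - x * s)) = x *: f (n - x * s) by rewrite -linearZ.
have -> : f (x * (a * - s0)) = a *: f (0 - x * s0).
  have -> : x * (a * - s0) = a *: (0 - x * s0 : A^o) by rewrite /GRing.scale /=; ring.
  exact: linearZ.
by rewrite e e0 !scalerA; congr (_ *: _); ring.
Qed.

Section TypeOne.
Variables r s : A.
Hypotheses (Nr : forall m, N m -> pri x (m * r)) (Ns : forall m, N m -> pri x (m * s)).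
Hypotheses (nr : ~ pri x r) (ind : forall a, ~ pri x (s - a * r)).

Local Notation "F ^*" := (dual x F).

(** Self-injectivity of [A / x] is applied to the map on [F + (e)] that kills [F] and sends [e] to
    [u]: it is multiplication by [w]. *)
Lemma socle_dual F e u : idl F -> F x -> ~ F e -> (forall m, N m -> F (m * e)) ->
  (forall m, N m -> pri x (m * u)) -> exists2 w, F^* w & pri x (u - e * w).
Proof.
move=> iF Fx nFe Ne Nu.
pose G : set (A^o * A^o)%type := [set p | exists a k b : A, F a /\ p = (a + k * e, k * u + b * x)].
have [|||w Hw] := @quotient_self_injective G.
- apply: mk_graph; first by exists 0, 0, 0; rewrite !mul0r !addr0; split=> //; exact: idl0.
  move=> c _ _ _ _ [a [k [b [Fa [-> ->]]]]] [a' [k' [b' [Fa' [-> ->]]]]].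
  exists (c * a + a'), (c * k + k'), (c * b + b'); split.
    by apply: idlD => //; exact: idlM.
  by rewrite /GRing.scale /=; congr (_, _); ring.
- move=> _ [a [k [b [Fa [/esym e0 ->]]]]]; apply: idlD => //; last by exists b.
  apply: Nu; apply: (local_killed iF nFe).
  by rewrite -[k * e](addKr a) e0 addr0; exact: idlN.
- by exists x, 0, 0; split=> //; rewrite !mul0r !addr0.
exists w.
  move=> a Fa; have -> : w * a = - (0 - a * w) by ring.
  apply: idlN => //; apply: Hw; exists a, 0, 0; split=> //.
  by rewrite !mul0r !addr0.
by apply: Hw; exists 0, 1, 0; split; [exact: idl0|rewrite !mul1r mul0r addr0 add0r].
Qed.

(** By [socle_dual] the independent socle elements [r] and [s] give two steps between the duals for
    each step of the series. Between [pri x] and [setT], which duality exchanges, such doubling is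
    impossible. *)
Lemma dual_cs_double n F E : cs n F E -> F x -> exists2 m, (2 * n <= m)%N & cs m E^* F^*.
Proof.
elim=> [{}F iF|{}n {}F F1 {}E [iF [M [e [/uN -> nFe Ne ->]]]] csn IH] Fx.
  by exists 0%N => //; exact: cs0 (idl_dual _ _).
have [m mn cm] := IH (sub_adj e Fx).
have [wr Fwr hr] := socle_dual iF Fx nFe Ne Nr.
have [ws Fws hs] := socle_dual iF Fx nFe Ne Ns.
have iE := idl_dual x (adj F e); have iF' := idl_dual x F.
have EG := @sub_adj _ (adj F e)^* wr.
have GF : adj (adj F e)^* wr `<=` F^*.
  by apply: adj_sub => //; apply: dual_mono; exact: sub_adj.
have [k1 c1] := cs_exists nA nch iE (idl_adj wr iE) EG (@dual_in _ x _) rx.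
have [k2 c2] := cs_exists nA nch (idl_adj wr iE) iF' GF (EG _ (@dual_in _ x _)) rx.
have p1 : (0 < k1)%N.
  apply: cs_pos c1 _ => e1.
  have /dual_adj[//|_ we] : (adj F e)^* wr by rewrite e1; exact: adj_id.
  by apply: nr; rewrite -[r](subrK (e * wr)); apply: idlD => //; rewrite mulrC.
have p2 : (0 < k2)%N.
  apply: cs_pos c2 _ => e2.
  have : adj (adj F e)^* wr ws by rewrite e2.
  move=> [h [a [/dual_adj[//|_ he] ews]]]; apply: (ind (a := a)).
  have -> : s - a * r = (s - e * ws) - a * (r - e * wr) + h * e by rewrite ews; ring.
  by apply: idlD => //; apply: idlB => //; exact: idlM.
exists (m + (k1 + k2))%N; first by lia.
by apply: cs_cat cm _; apply: cs_cat c2.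
Qed.

Lemma typ1_contra : False.
Proof.
have [n cn] := cs_exists nA nch ip (@idlT _) (@subsetT _ _) (pri_id x) rx.
have [m nm] := dual_cs_double cn (pri_id x).
rewrite dualT dual_pri => cm; have e := cs_uniq cm cn.
have n0 : n = 0%N by lia.
move: cn; rewrite n0 => /cs_0 eT.
by apply: local_npri1; rewrite eT.
Qed.

End TypeOne.
End SelfInjective.

Lemma gorenstein_local_typ1 : gorenstein_local A -> typ1 N x.
Proof.
move=> [[|n] id].
  (* In injective dimension zero, [1] would be divisible by [x]. *)
  have [c e] := baer_divisible (injective_baer id) rx (1 : A^o).
  by exfalso; apply: local_npri1; exists c; rewrite mulrC.
move: id => [I [D [f [g [iI inj_f ex surj idD]]]]].
have bI := injective_baer iI.
have dD : divisible D.
  move=> y ry d; have [z <-] := surj d.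
  by have [z' ->] := baer_divisible bI ry z; exists (g z'); rewrite linearZ.
have bD := divisible_injective dD idD.
move=> r s Nr Ns nr; apply: contrapT => H.
apply: (typ1_contra bI bD inj_f ex surj Nr Ns nr) => a h; apply: H; by exists a.
Qed.

End LocalModules.

(** * The injective resolution by the total ring of fractions *)

Section TotalResolution.
Variable A : comPzRingType.
Hypotheses (nA : noetherian A) (nch : ~ prime_chain A 2) (rA : reduced A).
Hypothesis t1 : forall x, regular x -> forall M, max_ideal A M -> M x -> typ1 M x.

Local Notation Q := (total_mod A).
Local Notation t := (@to_total A).

(** With [r] in the domain and [b] annihilating the domain such that [r + b] is regular, every value
    [m] at [a] satisfies [r m = a n] and [b m = 0], so the map is multiplication by
    [n / (r + b)]. *)
Lemma total_baer : baer Q.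
Proof.
move=> G lG fG.
have [r [b [[n Gr] ab rs]]] := reduced_reg nA rA (idl_gdom lG).
exists ((n : total_ring A) * tinv (r + b)) => a m Gam.
have e1 : r *: m = a *: n.
  apply: (graph_uniq lG fG (a := r * a)); first exact: graphZ.
  rewrite mulrC; exact: graphZ.
have e2 : b *: m = 0.
  apply: fG; have <- : b * a = 0 by apply: ab; exists m.
  exact: graphZ.
change (m = t a * ((n : total_ring A) * tinv (r + b)) :> total_ring A).
change (t r * m = t a * n :> total_ring A) in e1.
change (t b * m = 0 :> total_ring A) in e2.
apply: (scaleI (regular_total rs)).
rewrite to_totalD mulrDl e1 e2 addr0 -to_totalD.
transitivity (t a * (n : total_ring A) * (t (r + b) * tinv (r + b))); last ring.
by rewrite tinvP // mulr1.
Qed.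

Definition total_base : set Q := base_ring A.

Lemma total_base_lin : linclosed total_base.
Proof.
split; first by exists 0.
move=> a _ _ [x _ <-] [y _ <-]; exists (a * x + y) => //.
by rewrite to_totalD to_totalM.
Qed.

Local Notation QA := (mquot total_base_lin).
Local Notation pi := (mpi total_base_lin).

Let pi0 : pi 0 = 0.
Proof.
have := mpi_linear total_base_lin 1 0 0; rewrite !scale1r addr0 => e.
by apply: (addrI (pi 0)); rewrite addr0; exact/esym.
Qed.

Let piZ (a : A) q : a *: pi q = pi (a *: q).
Proof. by have := mpi_linear total_base_lin a q 0; rewrite addr0 pi0 addr0 => ->. Qed.

Let piD q q' : pi (q + q') = pi q + pi q'.
Proof. by have := mpi_linear total_base_lin 1 q q'; rewrite !scale1r. Qed.

(* A map that is multiplication by [u] on [I] and by [v] on [a A] is given by one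
   fraction, since [(x : I cap aA) = (x : I) + (x : aA)]. *)
Lemma total_quotient_baer : baer QA.
Proof.
apply: baer_regular => // G lG fG [z rz dz].
pose good (J : set A) (w : total_ring A) :=
  forall a n, J a -> G (a, n) -> n = pi (t a * w).
have good_pri a : gdom G a -> regular a -> exists w, good (pri a) w.
  move=> [n Gan] ra; have [q eq] := mpiW n; exists ((q : total_ring A) * tinv a).
  move=> _ m [k ->] Gm; have -> : m = k *: n.
    by apply: (graph_uniq lG fG Gm); exact: graphZ.
  rewrite -eq piZ total_modZ to_totalM; congr pi.
  transitivity (t k * (q : total_ring A) * (t a * tinv a)); last ring.
  by rewrite tinvP // mulr1.
have [||J [iJ Jz Jd [u gu]] maxJ] := @noetherian_max _
    [set J | [/\ idl J, J z, J `<=` gdom G & exists w, good J w]] nA.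
- exists (pri z); split; [exact: idl_pri|exact: pri_id| |exact: good_pri].
  by apply: pri_sub => //; exact: idl_gdom.
- by move=> J [].
suff dJ : gdom G `<=` J.
  exists (pi u) => a n Gan; rewrite piZ; apply: gu => //.
  by apply: dJ; exists n.
move=> a0 da0; apply: contrapT => nJa0.
(* Modulo [z], which lies in [J], the new element may be taken regular, so that the map on its
   multiples is given by a fraction. *)
have [c ra] := adj_regular a0 nA rA rz; set a := a0 + c * z in ra.
have da : gdom G a by apply: (idlD (idl_gdom lG) da0 (idlM _ (idl_gdom lG) dz)).
have nJa : ~ J a.
  move=> Ja; apply: nJa0; have -> : a0 = a - c * z by rewrite addrK.
  by apply: idlB => //; exact: idlM.
have [v gv] := good_pri a da ra.
set x := z * a; have rx : regular x by exact: regularM.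
have Jx : J x by exact: idlMr.
have ax : pri a x by exists z.
have cap b : J b -> pri a b -> exists d, t b * (u - v) = t d.
  move=> Jb ab; have [n Gbn] := Jd _ Jb.
  have := gu _ _ Jb Gbn; rewrite (gv _ _ ab Gbn) => /mpi_eq[d _ ed].
  by exists (- d); rewrite to_totalN ed mulrBr opprB.
have [d ed] := cap x Jx ax.
have [|i [j [Ji aj eij]]] := @dual_cap _ x J (pri a) d nA nch rx (t1 rx) iJ Jx (idl_pri a) ax.
  move=> b [Jb ab]; have [d' ed'] := cap b Jb ab.
  exists d'; apply: to_total_inj; rewrite [LHS]to_totalM [RHS]to_totalM -ed -ed'; ring.
(* The common fraction: [i / x] carries [J] into [A] and [j / x] carries [a A] into [A], so neither
   correction changes the map on its ideal. *)
have euv : u - t i * tinv x = v + t j * tinv x.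
  have -> : u = v + t d * tinv x.
    by rewrite -ed mulrAC tinvP // mul1r addrC subrK.
  by rewrite eij to_totalD; ring.
have corr b k (w : total_ring A) : pri x (k * b) -> pi (t b * (w + t k * tinv x)) = pi (t b * w).
  move=> [e he]; apply/mpi_eq; exists e => //.
  have -> : t b * (w + t k * tinv x) - t b * w = t (k * b) * tinv x by rewrite to_totalM; ring.
  by rewrite he to_totalM -mulrA tinvP // mulr1.
apply: nJa; rewrite -(maxJ (adj J a)); [exact: adj_id| |exact: sub_adj].
split; [exact: idl_adj|exact: sub_adj|apply: adj_sub => //; exact: idl_gdom|].
exists (u - t i * tinv x) => _ n [b [k [Jb ->]]] Gn.
have [n1 Gb] := Jd _ Jb; have [n2 Ga] := da.
have Gka := graphZ k lG Ga.
rewrite (graph_uniq lG fG Gn (graphD lG Gb Gka)) to_totalD mulrDl piD.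
congr (_ + _).
  rewrite -mulNr -to_totalN corr; first exact: gu.
  by rewrite mulNr; apply: idlN; [exact: idl_pri|exact: Ji].
rewrite euv corr; last by apply: aj; exists k.
by apply: gv => //; exists k.
Qed.

Lemma gorenstein_local_resolution : gorenstein_local A.
Proof.
exists 1%N.
have [|f fE] := @linear_pack A A^o Q (fun a => t a).
  by move=> a x y; rewrite to_totalD to_totalM.
have [|g gE] := @linear_pack A Q QA (fun q => pi q).
  exact: mpi_linear.
exists Q, QA, f, g; split.
- exact: baer_injective total_baer.
- by move=> x y; rewrite !fE => /to_total_inj.
- move=> q; rewrite gE -pi0; split.
    by move=> /mpi_eq; rewrite subr0 => -[a _ <-]; exists a; rewrite fE.
  by move=> [a <-]; apply/mpi_eq; rewrite subr0 fE; exists a.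
- by move=> c; have [q <-] := mpiW c; exists q; rewrite gE.
- exact: baer_injective total_quotient_baer.
Qed.

End TotalResolution.

(** * Type one at a maximal ideal and in its localization *)

Section TypeLocal.
Variables (R : comPzRingType) (M : set R) (maxM : max_ideal R M).
Local Notation A := (loc_at maxM).
Local Notation S := (max_mulset maxM).
Local Notation l := (@to_loc R S).
Let iM := max_idl maxM.
Let nMM s s' : ~ M s -> ~ M s' -> ~ M (s * s').
Proof. exact: (primeM (max_prime maxM)). Qed.

Lemma loc_reduced : reduced R -> reduced A.
Proof.
move=> rR a n; have [r [s [Ss ->]]] := loc_fracE a => e.
suff -> : l r = 0 by rewrite mul0r.
have : l (r ^+ n) = 0.
  rewrite to_locX; have -> : l r = l r * linv S s * l s.
    by rewrite -mulrA [linv _ _ * _]mulrC linvP // mulr1.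
  by rewrite exprMn e mul0r.
move=> /loc_at_eq0[t nMt tr]; apply/loc_at_eq0; exists t => //.
apply: (rR _ n.+1); rewrite exprMn exprS [r ^+ _]exprSr.
have -> : t * t ^+ n * (r ^+ n * r) = t ^+ n * r * (t * r ^+ n) by ring.
by rewrite tr mulr0.
Qed.

Lemma loc_regular x : regular x -> regular (l x).
Proof.
move=> rx a; have [r [s [Ss ->]]] := loc_fracE a => e.
suff -> : l r = 0 by rewrite mul0r.
have : l (x * r) = 0.
  rewrite to_locM; have -> : l r = l r * linv S s * l s.
    by rewrite -mulrA [linv _ _ * _]mulrC linvP // mulr1.
  by rewrite mulrA e mul0r.
move=> /loc_at_eq0[t nMt h]; apply/loc_at_eq0; exists t => //.
by apply: rx; rewrite mulrCA.
Qed.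

Lemma pri_loc x y : pri (l x) (l y) <-> exists2 t, ~ M t & pri x (t * y).
Proof.
split.
  move=> [a]; have [r [s [Ss ->]]] := loc_fracE a => e.
  have : l (s * y - r * x) = 0.
    rewrite to_locB !to_locM e.
    transitivity (l r * l x * (l s * linv S s) - l r * l x); first ring.
    by rewrite linvP // mulr1 subrr.
  move=> /loc_at_eq0[t nMt h]; exists (t * s); first exact: nMM.
  by exists (t * r); apply/eqP; rewrite -subr_eq0 -!mulrA -mulrBr h.
move=> [t nMt [a e]]; exists (l a * linv S t).
have -> : l a * linv S t * l x = l (a * x) * linv S t by rewrite to_locM; ring.
by rewrite -e to_locM mulrAC linvP // mul1r.
Qed.

Lemma pri_num x r s : ~ M s -> pri (l x) (l r * linv S s) <-> pri (l x) (l r).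
Proof.
move=> nMs; have ip := idl_pri (l x).
split=> h; last exact: idlMr.
have -> : l r = l s * (l r * linv S s) by rewrite mulrCA linvP // mulr1.
exact: idlM.
Qed.

(** Elements outside [M] act invertibly on the socle of [R / x] at [M], so localization neither
    kills socle elements nor changes their linear relations. *)
Lemma typ1_of_loc x : M x -> typ1 (mloc (maxM := maxM)) (l x) -> typ1 M x.
Proof.
have ip := idl_pri x; have ipl := idl_pri (l x).
have socP t r : (forall m, M m -> pri x (m * r)) -> ~ M t -> pri x (t * r) -> pri x r.
  move=> Mr nMt tr; have [a Ma] := max_inv maxM nMt.
  have -> : r = (1 - a * t) * r + a * (t * r) by ring.
  by apply: idlD => //; [exact: Mr|exact: idlM].
have socl r : (forall m, M m -> pri x (m * r)) -> forall m, mloc m -> pri (l x) (m * l r).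
  move=> Mr _ [m [s [Mm nMs ->]]].
  have [a e] := Mr m Mm; exists (l a * linv S s).
  have -> : l m * linv S s * l r = l (m * r) * linv S s by rewrite to_locM; ring.
  by rewrite e to_locM; ring.
move=> Mx t1 r s Mr Ms nr.
have [||//|a] := t1 (l r) (l s); [exact: socl|exact: socl| |].
  by move=> /pri_loc[t nMt tr]; apply: nr; apply: socP tr.
have [b [d [Sd ->]]] := loc_fracE a => h.
have /pri_loc[t nMt] : pri (l x) (l (d * s - b * r)).
  have -> : l (d * s - b * r) = l d * (l s - l b * linv S d * l r).
    rewrite to_locB !to_locM mulrBr; congr (_ - _).
    transitivity (l b * l r * (l d * linv S d)); last ring.
    by rewrite linvP // mulr1.
  exact: idlM.
move=> ht; have nMtd := nMM nMt Sd.
have [k Mk] := max_inv maxM nMtd; exists (k * t * b).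
have -> : s - k * t * b * r = (1 - k * (t * d)) * s + k * (t * (d * s - b * r)) by ring.
by apply: idlD => //; [exact: Ms|exact: idlM].
Qed.

(** Let [b] annihilate [x] with a multiple of [x] plus [b] regular. Then [x + b] is regular, and the
    image of [b] vanishes because it annihilates the regular image of [x]. *)
Lemma loc_regular_lift x : noetherian R -> reduced R -> regular (l x) ->
  exists2 x', regular x' & l x' = l x.
Proof.
move=> nR rR rX.
have [_ [b [[c ->] ab rs]]] := reduced_reg nR rR (idl_pri x).
have bx : b * x = 0 by apply: ab; exact: pri_id.
exists (x + b).
  move=> z; rewrite mulrC => h.
  have zx : z * x = 0.
    apply: (reduced_sqr rR).
    transitivity (z * x * (z * (x + b)) - z * z * (b * x)); first ring.
    by rewrite h bx !mulr0 subrr.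
  have zb : z * b = 0 by move: h; rewrite mulrDr zx add0r.
  by apply: rs; rewrite mulrC mulrDr zb addr0 mulrCA zx mulr0.
suff lb : l b = 0 by rewrite to_locD lb addr0.
by apply: rX; rewrite -to_locM mulrC bx to_loc0.
Qed.

Lemma loc_regular_num X : noetherian R -> reduced R -> regular X ->
  exists x s, [/\ regular x, ~ M s & X = l x * linv S s].
Proof.
move=> nR rR; have [x1 [s [Ss ->]]] := loc_fracE X => rX.
have [|x rx <-] := @loc_regular_lift x1 nR rR; last by exists x, s.
by move=> z h; apply: rX; rewrite mulrAC h mul0r.
Qed.

Lemma typ1_to_loc : noetherian R -> reduced R ->
  (forall x, regular x -> M x -> typ1 M x) ->
  forall X, regular X -> mloc (maxM := maxM) X -> typ1 (mloc (maxM := maxM)) X.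
Proof.
move=> nR rR t1 X rX.
have [x [sx [rx nMsx eX]]] := loc_regular_num nR rR rX.
rewrite eX mlocE // => Mx.
have ip := idl_pri x; have ipl := idl_pri (l x).
have priX a : pri (l x * linv S sx) a <-> pri (l x) a.
  split=> -[k ->].
    by exists (k * linv S sx); ring.
  exists (k * l sx); transitivity (k * l x * (l sx * linv S sx)); last ring.
  by rewrite linvP // mulr1.
have [g eM] := nR _ iM.
have soc a : (forall m, mloc (maxM := maxM) m -> pri (l x) (m * a)) ->
    exists r s, [/\ ~ M s, a = l r * linv S s & forall m, M m -> pri x (m * r)].
  have [r [s [Ss ->]]] := loc_fracE a => H.
  (* Finite generation of [M] allows one denominator [T] for all of its elements. *)
  have [T nMT hT] : exists2 T, ~ M T & forall m, m \in g -> pri x (T * (m * r)).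
    have : forall m, m \in g -> M m by move=> m mg; rewrite eM; exact: mem_gen_ideal.
    elim: {eM} g => [|m g IH] Hg; first by exists 1 => //; exact: max_n1.
    have [m' m'g|T nMT hT] := IH; first by apply: Hg; rewrite inE m'g orbT.
    have : pri (l x) (l (m * r)).
      apply/(pri_num _ _ Ss); rewrite to_locM -mulrA; apply: H.
      by apply/mloc_to/Hg; rewrite inE eqxx.
    move=> /pri_loc[T' nMT' hT']; exists (T' * T); first exact: nMM.
    move=> m'; rewrite inE => /orP[/eqP->|/hT h].
      by rewrite mulrAC; apply: idlMr.
    by rewrite -mulrA; apply: idlM.
  exists (T * r), (T * s); split; first exact: nMM.
    have nMTs : ~ M (T * s) by exact: nMM.
    have u : linv S (T * s) * (l T * l s) = 1 by rewrite mulrC -to_locM linvP.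
    transitivity (l r * linv S s * (linv S (T * s) * (l T * l s))); first by rewrite u mulr1.
    rewrite to_locM; transitivity (l T * l r * linv S (T * s) * (l s * linv S s)); first ring.
    by rewrite linvP // mulr1.
  move=> m; rewrite eM; apply: (gen_idealP (I := colonI (pri x) (T * r))).
    exact: idl_colonI.
  by move=> m' /hT; rewrite /colonI /= mulrCA.
move=> a b Ha Hb na.
have [|r [s [nMs ea Mr]]] := soc a; first by move=> m /Ha/priX.
have [|r' [s' [nMs' eb Mr']]] := soc b; first by move=> m /Hb/priX.
have [||||k hk] := t1 x rx _ r r' => //.
  move=> [k ek]; apply: na; apply/priX; rewrite ea pri_num //.
  by rewrite ek to_locM; exists (l k).
exists (l k * l s * linv S s'); apply/priX.
have -> : b - l k * l s * linv S s' * a = l (r' - k * r) * linv S s'.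
  rewrite ea eb to_locB to_locM.
  transitivity (l r' * linv S s' - l k * l r * linv S s' * (l s * linv S s)); first ring.
  by rewrite linvP // mulr1; ring.
rewrite pri_num //; have [c ->] := hk; exists (l c); exact: to_locM.
Qed.

End TypeLocal.

Lemma gorenstein_typ1 (R : comPzRingType) : cohen_macaulay1 R -> reduced R ->
  gorenstein R <->
  forall x, regular x -> forall M, max_ideal R M -> M x -> typ1 M x.
Proof.
move=> [nR [_ dim1] _] rR; have nch : ~ prime_chain R 2 by move=> /dim1.
split=> [[_ gR] x rx M mM Mx|t1].
  apply: (typ1_of_loc (maxM := mM)) => //.
  apply: gorenstein_local_typ1 (gR M mM).
  - exact: loc_noetherian.
  - exact: loc_chain.
  - exact: loc_reduced.
  - exact: mloc_max.
  - exact: mloc_uniq.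
  - exact/mloc_to.
  - exact: loc_regular.
split=> // M mM; apply: gorenstein_local_resolution.
- exact: loc_noetherian.
- exact: loc_chain.
- exact: loc_reduced.
- move=> X rX N mN; rewrite (mloc_uniq mN); apply: typ1_to_loc => // x rx Mx.
  exact: t1.
Qed.

(** * Integral closure and valuation rings *)

Section IntegralElements.
Variable T : comPzRingType.
Implicit Types (V W : set T) (q x y : T).

Lemma ring0 V : subring V -> V 0.
Proof. by case=> V1 VB _; rewrite -(subrr 1); apply: VB. Qed.

Lemma ring1 V : subring V -> V 1. Proof. by case. Qed.

Lemma ringB V x y : subring V -> V x -> V y -> V (x - y).
Proof. by case=> _ H _; apply: H. Qed.

Lemma ringN V x : subring V -> V x -> V (- x).
Proof. by move=> rV Vx; rewrite -sub0r; apply: ringB => //; exact: ring0. Qed.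

Lemma ringD V x y : subring V -> V x -> V y -> V (x + y).
Proof. by move=> rV Vx Vy; rewrite -[y]opprK; apply: ringB => //; exact: ringN. Qed.

Lemma ringM V x y : subring V -> V x -> V y -> V (x * y).
Proof. by case=> _ _ H; apply: H. Qed.

Lemma ringX V x n : subring V -> V x -> V (x ^+ n).
Proof.
move=> rV Vx; elim: n => [|n IH]; first by rewrite expr0; exact: ring1.
by rewrite exprS; apply: ringM.
Qed.

Lemma ring_sum V I (s : seq I) (P : pred I) (F : I -> T) : subring V ->
  (forall i, P i -> V (F i)) -> V (\sum_(i <- s | P i) F i).
Proof.
move=> rV H; apply: (big_ind V) => //; first exact: ring0.
by move=> x y; apply: ringD.
Qed.

Definition integral_over V q := exists n (c : nat -> T),
  (forall i, V (c i)) /\ q ^+ n = \sum_(i < n) c i * q ^+ i.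

Definition pspan V q n : set T := [set x | exists c : nat -> T,
  (forall i, V (c i)) /\ x = \sum_(i < n) c i * q ^+ i].

Section PolynomialSpan.
Variables (V : set T) (q : T).
Hypothesis rV : subring V.

Lemma pspan0 n : pspan V q n 0.
Proof.
exists (fun=> 0); split=> [_|]; first exact: ring0.
by rewrite big1 // => i _; rewrite mul0r.
Qed.

Lemma pspanD n x y : pspan V q n x -> pspan V q n y -> pspan V q n (x + y).
Proof.
move=> [c [Vc ->]] [d [Vd ->]]; exists (fun i => c i + d i); split.
  by move=> i; apply: ringD.
by rewrite -big_split; apply: eq_bigr => i _; rewrite mulrDl.
Qed.

Lemma pspanM n a x : V a -> pspan V q n x -> pspan V q n (a * x).
Proof.
move=> Va [c [Vc ->]]; exists (fun i => a * c i); split.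
  by move=> i; apply: ringM.
by rewrite mulr_sumr; apply: eq_bigr => i _; rewrite mulrA.
Qed.

Lemma pspanN n x : pspan V q n x -> pspan V q n (- x).
Proof. by rewrite -mulN1r; apply: pspanM; apply: ringN => //; exact: ring1. Qed.

Lemma pspanS n x : pspan V q n x -> pspan V q n.+1 x.
Proof.
move=> [c [Vc ->]]; exists (fun i => if (i < n)%N then c i else 0); split.
  by move=> i; case: ifP => // _; exact: ring0.
rewrite big_ord_recr /= ltnn mul0r addr0; apply: eq_bigr => i _.
by rewrite ltn_ord.
Qed.

Lemma pspan_le m n x : (m <= n)%N -> pspan V q m x -> pspan V q n x.
Proof.
move=> /subnK <-; elim: (n - m)%N => // k IH /IH; exact: pspanS.
Qed.

Lemma pspanX n : pspan V q n.+1 (q ^+ n).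
Proof.
exists (fun i => if i == n then 1 else 0); split.
  by move=> i; case: ifP => // _; [exact: ring1|exact: ring0].
rewrite big_ord_recr /= eqxx mul1r big1 ?add0r // => i _.
by rewrite ltn_eqF ?mul0r.
Qed.

Lemma pspan_mul n x : pspan V q n x -> pspan V q n.+1 (q * x).
Proof.
move=> [c [Vc ->]]; exists (fun i => if i is i'.+1 then c i' else 0); split.
  by case=> [|i]; [exact: ring0|exact: Vc].
rewrite big_ord_recl /= mul0r add0r mulr_sumr; apply: eq_bigr => i _.
by rewrite /bump /= add1n exprS mulrCA.
Qed.

Lemma pspan_sum n I (s : seq I) (P : pred I) (F : I -> T) :
  (forall i, P i -> pspan V q n (F i)) -> pspan V q n (\sum_(i <- s | P i) F i).
Proof.
move=> H; apply: (big_ind (pspan V q n)) => //; first exact: pspan0.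
by move=> x y; apply: pspanD.
Qed.

(** Only the identity permutation contributes [q ^+ n]: any other one has a factor off the diagonal,
    which is free of [q]. *)
Lemma det_integral n (M : 'M[T]_n) : (forall i j, V (M i j)) ->
  pspan V q n (\det (q%:M - M) - q ^+ n).
Proof.
move=> VM; have sz : size (index_enum 'I_n) = n.
  by rewrite /index_enum -enumT size_enum_ord.
have EM i j : (q%:M - M) i j = q *+ (i == j) - M i j by rewrite !mxE.
have diag (s : seq 'I_n) : pspan V q (size s) (\prod_(i <- s) (q - M i i) - q ^+ size s).
  elim: s => [|i s IH]; first by rewrite big_nil expr0 subrr; exact: pspan0.
  rewrite big_cons /=; set P := \prod_(j <- s) _ in IH *.
  have -> : (q - M i i) * P - q ^+ (size s).+1
    = q * (P - q ^+ size s) + - (M i i * ((P - q ^+ size s) + q ^+ size s)).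
    by rewrite exprS; ring.
  apply: pspanD; first exact: pspan_mul.
  apply/pspanN/pspanM => //; apply: pspanD; [exact: pspanS|exact: pspanX].
have term (f : 'I_n -> 'I_n) (s : seq 'I_n) :
    pspan V q (size s).+1 (\prod_(i <- s) (q *+ (i == f i) - M i (f i))) /\
    (has (fun i => f i != i) s -> pspan V q (size s) (\prod_(i <- s) (q *+ (i == f i) - M i (f i)))).
  elim: s => [|i s [IH1 IH2]]; first by rewrite big_nil -(expr0 q); split=> //; exact: pspanX.
  rewrite big_cons /= eq_sym; set P := \prod_(j <- s) _ in IH1 IH2 *.
  have mP k : pspan V q k P -> pspan V q k (- (M i (f i) * P)).
    by move=> h; apply/pspanN/pspanM.
  have [fi|nfi] := eqVneq (f i) i; rewrite /= ?mulr1n ?mulr0n mulrBl.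
    split=> [|/IH2 h]; apply: pspanD; [exact: pspan_mul|apply/mP/pspanS|exact: pspan_mul|apply/mP/pspanS] => //.
  rewrite mul0r add0r; split=> [|_]; apply: mP => //; exact: pspanS.
rewrite /determinant (bigD1 (1%g : 'S_n)) //= odd_perm1 expr0 mul1r addrAC.
apply: pspanD.
  have := diag (index_enum 'I_n); rewrite sz; congr (pspan V q n (_ - _)).
  by apply: eq_bigr => i _; rewrite perm1 EM eqxx.
apply: pspan_sum => s ns1; apply: pspanM.
  by apply: ringX => //; apply: ringN => //; exact: ring1.
have [_] := term s (index_enum 'I_n); rewrite sz => h.
have {}h : pspan V q n (\prod_i (q *+ (i == s i) - M i (s i))).
  apply: h; apply: contraNT ns1 => /hasPn H; apply/eqP/permP => i.
  by rewrite perm1; apply/eqP; have := H i (mem_index_enum i); rewrite negbK.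
by congr (pspan V q n _): h; apply: eq_bigr => i _; rewrite EM.
Qed.

(* The determinant trick, for a finite generating family of a module containing
   [1] and stable under [q]. *)
Lemma integral_of_module (b : seq T) (N : set T) :
  (forall x, N x -> exists c : nat -> T, (forall i, V (c i)) /\
     x = \sum_(i < size b) c i * b`_i) ->
  N 1 -> (forall x, x \in b -> N (q * x)) -> integral_over V q.
Proof.
move=> HN N1 qN; set n := size b.
have /choice[c Hc] : forall i : 'I_n, exists c : nat -> T, (forall j, V (c j)) /\
    q * b`_i = \sum_(j < n) c j * b`_j.
  by move=> i; apply/HN/qN/mem_nth.
pose M : 'M[T]_n := \matrix_(i, j) c i j.
pose bv : 'cV[T]_n := \col_i b`_i.
have Mb : (q%:M - M) *m bv = 0.
  apply/matrixP => i j; rewrite mulmxBl mul_scalar_mx !mxE (Hc i).2.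
  apply/eqP; rewrite subr_eq0; apply/eqP/eq_bigr => k _; by rewrite !mxE.
have db i : \det (q%:M - M) * bv i 0 = 0.
  have : (\det (q%:M - M))%:M *m bv = 0 by rewrite -mul_adj_mx -mulmxA Mb mulmx0.
  by move=> /matrixP/(_ i 0); rewrite mul_scalar_mx !mxE.
have d0 : \det (q%:M - M) = 0.
  have [u [_ e1]] := HN 1 N1.
  rewrite -[LHS]mulr1 e1 mulr_sumr big1 // => i _.
  by rewrite mulrCA; have := db i; rewrite mxE => ->; rewrite mulr0.
have [|d [Vd e]] := pspanN (det_integral (M := M) _).
  by move=> i j; rewrite mxE; apply: (Hc i).1.
by exists n, d; split=> //; rewrite -e d0 sub0r opprK.
Qed.

End PolynomialSpan.

Definition pring V x : set T := [set z | exists n, pspan V x n z].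

Lemma pring_sub V x : subring V -> V `<=` pring V x.
Proof.
move=> rV a Va; exists 1%N, (fun=> a); split=> //.
by rewrite big_ord1 expr0 mulr1.
Qed.

Lemma pring_id V x : subring V -> pring V x x.
Proof. by move=> rV; exists 2; rewrite -{2}(expr1 x); exact: pspanX. Qed.

Lemma subring_pring V x : subring V -> subring (pring V x).
Proof.
move=> rV; split.
- exact: pring_sub rV _ (ring1 rV).
- move=> y z [m hm] [n hn]; exists (maxn m n); apply: pspanD => //.
    by apply: pspan_le hm => //; exact: leq_maxl.
  by apply: pspanN => //; apply: pspan_le hn => //; exact: leq_maxr.
- move=> y z [m [c [Vc ->]]] [n hn]; exists (m + n)%N.
  rewrite mulr_suml; apply: pspan_sum => // i _.
  rewrite -mulrA; apply: pspanM => //.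
  have : pspan V x (i + n) (x ^+ i * z).
    elim: (i : nat) => [|k IH]; first by rewrite expr0 mul1r add0n.
    by rewrite exprS -mulrA addSn; apply: pspan_mul.
  by apply: pspan_le => //; rewrite leq_add2r ltnW.
Qed.

(** The coefficients get a common degree bound in [x], and multiplying the equation by [q] makes its
    exponent positive. *)
Lemma integral_over_pring V x q : subring V -> integral_over (pring V x) q ->
  exists m n (v : nat -> nat -> T), (forall i j, V (v i j)) /\
    q ^+ n.+1 = \sum_(i < n.+1) (\sum_(j < m.+1) v i j * x ^+ j) * q ^+ i.
Proof.
move=> rV [n [c [Hc e]]].
have /choice[k Hk] : forall i, exists m, pspan V x m (c i) by [].
pose m := (\max_(i < n) k i)%N.
have /choice[v Hv] : forall i, exists w : nat -> T, (forall j, V (w j)) /\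
    ((i < n)%N -> c i = \sum_(j < m.+1) w j * x ^+ j).
  move=> i; have [im|_] := ltnP i n; last first.
    by exists (fun=> 0); split=> // _; exact: ring0.
  have [|w [Vw ew]] := pspan_le (n := m.+1) rV _ (Hk i); last by exists w.
  by apply/leqW; rewrite /m; apply: (@leq_bigmax _ (fun i : 'I_n => k i) (Ordinal im)).
exists m, n, (fun i => if i is i'.+1 then v i' else fun=> 0); split.
  by case=> [|i] j; [exact: ring0|exact: (Hv i).1].
rewrite big_ord_recl /= [X in X * _]big1 ?mul0r ?add0r => [|j _]; last by rewrite mul0r.
rewrite exprS e mulr_sumr; apply: eq_bigr => i _.
by rewrite /bump /= add1n -(Hv i).2 // exprS mulrCA.
Qed.

Definition gspan V (b : seq T) : set T := [set x | exists c : nat -> T,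
  (forall i, V (c i)) /\ x = \sum_(i < size b) c i * b`_i].

Lemma gspanD V b x y : subring V -> gspan V b x -> gspan V b y -> gspan V b (x + y).
Proof.
move=> rV [c [Vc ->]] [d [Vd ->]]; exists (fun i => c i + d i); split.
  by move=> i; apply: ringD.
by rewrite -big_split; apply: eq_bigr => i _; rewrite mulrDl.
Qed.

Lemma gspanM V b a x : subring V -> V a -> gspan V b x -> gspan V b (a * x).
Proof.
move=> rV Va [c [Vc ->]]; exists (fun i => a * c i); split.
  by move=> i; apply: ringM.
by rewrite mulr_sumr; apply: eq_bigr => i _; rewrite mulrA.
Qed.

Lemma gspan_mem V b x : subring V -> x \in b -> gspan V b x.
Proof.
move=> rV xb; exists (fun i => (i == index x b)%:R); split.
  by move=> i; case: eqP => _; [exact: ring1|exact: ring0].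
rewrite -index_mem in xb.
rewrite (bigD1 (Ordinal xb)) //= eqxx mul1r nth_index -?index_mem //.
rewrite big1 ?addr0 // => i ni; case: eqP => [e|_]; last by rewrite mul0r.
by move: ni; rewrite -val_eqE /= e eqxx.
Qed.

Lemma gspan_sum V b I (s : seq I) (F : I -> T) : subring V ->
  (forall i, gspan V b (F i)) -> gspan V b (\sum_(i <- s) F i).
Proof.
move=> rV H; apply: (big_ind (gspan V b)) => //; last by move=> x y; exact: gspanD.
exists (fun=> 0); split=> [_|]; first exact: ring0.
by rewrite big1 // => i _; rewrite mul0r.
Qed.

Let rel V q x m n := exists v : nat -> nat -> T, (forall i j, V (v i j)) /\
  q ^+ n.+1 = \sum_(i < n.+1) (\sum_(j < m.+1) v i j * x ^+ j) * q ^+ i.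

Let rel_m V q x m n k : subring V -> rel V q x m n -> rel V q x (k + m) n.
Proof.
move=> rV [v [Vv e]]; exists (fun i j => if (j < m.+1)%N then v i j else 0); split.
  by move=> i j; case: ifP => // _; exact: ring0.
rewrite e; apply: eq_bigr => i _; congr (_ * _).
rewrite -addnS addnC big_split_ord /= [X in _ = _ + X]big1 ?addr0.
  by apply: eq_bigr => j _; rewrite ltn_ord.
by move=> j _; rewrite ltnNge leq_addr mul0r.
Qed.

Let rel_n V q x m n k : subring V -> rel V q x m n -> rel V q x m (k + n).
Proof.
move=> rV H; elim: k => // k [v [Vv e]].
exists (fun i => if i is i'.+1 then v i' else fun=> 0); split.
  by case=> [|i] j //; exact: ring0.
rewrite big_ord_recl /= [X in X * _]big1 ?mul0r ?add0r => [|j _]; last by rewrite mul0r.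
rewrite exprS e mulr_sumr; apply: eq_bigr => i _.
by rewrite /bump /= add1n exprS mulrCA.
Qed.

(* The module generated by the products of bounded powers of [q] with bounded
   powers of [x] or [y] is stable under [q]: lowering the power of [q] along the
   equation over [V[y]] multiplies [x ^ j] by powers of [y], and conversely. *)
Lemma integral_pair V q x y : subring V -> V (x * y) ->
  integral_over (pring V x) q -> integral_over (pring V y) q -> integral_over V q.
Proof.
move=> rV Vxy /(integral_over_pring rV)[m1 [n1 h1]] /(integral_over_pring rV)[m2 [n2 h2]].
pose m := (m1 + m2)%N; pose n := (n1 + n2)%N.
have {}h1 : rel V q x m n by rewrite /m /n addnC [(n1 + _)%N]addnC; apply/rel_n/rel_m.
have {}h2 : rel V q y m n by apply/rel_n/rel_m.
pose bb z := [seq q ^+ i * z ^+ j | i <- iota 0 n.+1, j <- iota 0 m.+1].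
have memb z i j : (i <= n)%N -> (j <= m)%N -> q ^+ i * z ^+ j \in bb z.
  by move=> hi hj; apply/allpairsP; exists (i, j); split; rewrite ?mem_iota.
pose b := bb x ++ bb y.
have memx i j : (i <= n)%N -> (j <= m)%N -> gspan V b (q ^+ i * x ^+ j).
  by move=> hi hj; apply: gspan_mem => //; rewrite mem_cat memb.
have memy i j : (i <= n)%N -> (j <= m)%N -> gspan V b (q ^+ i * y ^+ j).
  by move=> hi hj; apply: gspan_mem => //; rewrite mem_cat memb ?orbT.
have key i j k : (i <= n)%N -> (j <= m)%N -> (k <= m)%N ->
    gspan V b (q ^+ i * (x ^+ j * y ^+ k)).
  move=> hi hj hk; have [jk|/ltnW kj] := leqP j k.
    have -> : q ^+ i * (x ^+ j * y ^+ k) = (x * y) ^+ j * (q ^+ i * y ^+ (k - j)).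
      by rewrite -{1}(subnKC jk) exprD exprMn; ring.
    by apply: gspanM => //; [exact: ringX|apply: memy => //; lia].
  have -> : q ^+ i * (x ^+ j * y ^+ k) = (x * y) ^+ k * (q ^+ i * x ^+ (j - k)).
    by rewrite -{1}(subnKC kj) exprD exprMn; ring.
  by apply: gspanM => //; [exact: ringX|apply: memx => //; lia].
apply: (@integral_of_module V q rV b (gspan V b)) => //.
  by have := memx 0%N 0%N isT isT; rewrite !expr0 mulr1.
have top z w : rel V q w m n -> (forall i j k, (i <= n)%N -> (j <= m)%N -> (k <= m)%N ->
    gspan V b (q ^+ i * (z ^+ j * w ^+ k))) -> forall i j, (i <= n)%N -> (j <= m)%N ->
    gspan V b (q ^+ i.+1 * z ^+ j).
  move=> [v [Vv e]] kzw i j; rewrite leq_eqVlt => /orP[/eqP->|hi] hj; last first.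
    by have := kzw i.+1 j 0%N hi hj isT; rewrite expr0 mulr1.
  rewrite e mulr_suml; apply: gspan_sum => // i'.
  rewrite !mulr_suml; apply: gspan_sum => // k.
  have -> : v i' k * w ^+ k * q ^+ i' * z ^+ j = v i' k * (q ^+ i' * (z ^+ j * w ^+ k)) by ring.
  by apply: gspanM => //; apply: kzw => //; rewrite -ltnS.
have memi k i : i \in iota 0 k.+1 -> (i <= k)%N by rewrite mem_iota.
move=> z; rewrite mem_cat => /orP[] /allpairsP[[i j] [/memi hi /memi hj ->]].
  by rewrite mulrA -exprS; apply: (top x y).
rewrite mulrA -exprS; apply: (top y x) => // i' j' k' hi' hj' hk'.
by rewrite [y ^+ _ * _]mulrC; apply: key.
Qed.

(** Let [V] be maximal among the subrings over which [q] is not integral. Adjoining any element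
    outside [V] makes [q] integral, so by [integral_pair] two such elements cannot have their
    product in [V]. *)
Lemma valuation_exists V0 q : subring V0 -> ~ integral_over V0 q ->
  exists V, [/\ subring V, V0 `<=` V, ~ V q & forall x y, ~ V x -> ~ V y -> ~ V (x * y)].
Proof.
move=> r0 n0; pose P := [set V | [/\ subring V, V0 `<=` V & ~ integral_over V q]].
have [||V [rV sV nV] maxV] := @zorn_sets _ P.
- by exists V0; split.
- move=> F [W FW] FP tF; split.
  + split; first by exists W => //; have [rW _ _] := FP _ FW; exact: ring1.
      move=> x y [X FX Xx] [Y FY Yy].
      have [XY|YX] := tF _ _ FX FY.
        by exists Y => //; have [rY _ _] := FP _ FY; apply: ringB => //; exact: XY.
      by exists X => //; have [rX _ _] := FP _ FX; apply: ringB => //; exact: YX.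
    move=> x y [X FX Xx] [Y FY Yy].
    have [XY|YX] := tF _ _ FX FY.
      by exists Y => //; have [rY _ _] := FP _ FY; apply: ringM => //; exact: XY.
    by exists X => //; have [rX _ _] := FP _ FX; apply: ringM => //; exact: YX.
  + by move=> x V0x; exists W => //; have [_ sW _] := FP _ FW; exact: sW.
  + move=> [n [c [Uc e]]].
    have [x /mapP[i _ ->]|X FX sX] := chain_finite (s := [seq c i | i <- iota 0 n]) tF FW.
      by have [Y FY Yc] := Uc i; exists Y.
    have [rX _ nX] := FP _ FX; apply: nX.
    exists n, (fun i => if (i < n)%N then c i else 0); split.
      move=> i; case: ifP => [hi|_]; last exact: ring0.
      by apply: sX; apply: map_f; rewrite mem_iota.
    by rewrite e; apply: eq_bigr => i _; rewrite ltn_ord.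
have adjq x : ~ V x -> integral_over (pring V x) q.
  move=> nVx; apply: contrapT => nq; apply: nVx.
  rewrite -(maxV (pring V x)); [exact: pring_id| |exact: pring_sub].
  by split=> //; [exact: subring_pring|move=> z /sV; exact: pring_sub].
exists V; split=> //.
  move=> Vq; apply: nV; exists 1%N, (fun=> q); split=> //.
  by rewrite big_ord1 expr0 mulr1 expr1.
by move=> x y /adjq hx /adjq hy Vxy; apply: nV; exact: (integral_pair rV Vxy hx hy).
Qed.

(** Horner's scheme: for [z] outside [V], a product [z * w] in [V] forces [w] into [V], and this
    lowers the degree of the equation. *)
Lemma integral_in_valuation V z : subring V ->
  (forall x y, ~ V x -> ~ V y -> ~ V (x * y)) -> integral_over V z -> V z.
Proof.
move=> rV mV; have key n (c : nat -> T) : (forall i, V (c i)) ->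
    V (z ^+ n.+1 + \sum_(i < n.+1) c i * z ^+ i) -> V z.
  elim: n c => [|n IH] c Vc.
    rewrite big_ord1 expr0 mulr1 expr1 => h.
    by rewrite -[z](addrK (c 0%N)); apply: ringB.
  rewrite big_ord_recl expr0 mulr1 /= => h.
  apply: contrapT => nVz; apply: nVz; apply: (IH (fun i => c i.+1)) => [i|]; first exact: Vc.
  apply: contrapT => nw; apply: (mV z _ _ nw) => [Vz|]; last first.
    have -> : z * (z ^+ n.+1 + \sum_(i < n.+1) c i.+1 * z ^+ i)
      = (z ^+ n.+2 + (c 0%N + \sum_(i < n.+1) c (bump 0 i) * z ^+ bump 0 i)) - c 0%N.
      have -> : \sum_(i < n.+1) c (bump 0 i) * z ^+ bump 0 i
          = z * (\sum_(i < n.+1) c i.+1 * z ^+ i).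
        by rewrite mulr_sumr; apply: eq_bigr => i _; rewrite /bump /= add1n exprS mulrCA.
      by rewrite mulrDr -exprS; ring.
    exact: ringB.
  apply: nw; apply: ringD => //; first exact: ringX.
  by apply: ring_sum => // i _; apply: ringM => //; exact: ringX.
move=> [[|n] [c [Vc e]]].
  rewrite -[z]mulr1 -(expr0 z) e big_ord0 mulr0; exact: ring0.
apply: (key n (fun i => - c i)) => [i|]; first exact: ringN.
rewrite e -big_split /= big1; first exact: ring0.
by move=> i _; rewrite mulNr subrr.
Qed.

End IntegralElements.

Section IntegralClosure.
Variable R : comPzRingType.
Local Notation Q := (total_ring R).
Local Notation t := (@to_total R).

Lemma subring_base : subring (base_ring R).
Proof.
split; first by exists 1.
- by move=> _ _ [x _ <-] [y _ <-]; exists (x - y) => //; rewrite to_totalB.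
- by move=> _ _ [x _ <-] [y _ <-]; exists (x * y) => //; rewrite to_totalM.
Qed.

Lemma integral_closureE (q : Q) : integral_closure R q <-> integral_over (base_ring R) q.
Proof.
split=> [[n [c e]]|[n [c [Hc e]]]].
  exists n, (fun i => t (- c i)); split; first by move=> i; exact: base_ring_to.
  apply/eqP; rewrite -subr_eq0 -sumrN -[X in _ == X]e; apply/eqP; congr (_ + _).
  by apply: eq_bigr => i _; rewrite to_totalN mulNr opprK.
have /choice[d Hd] : forall i, exists r, c i = t r by move=> i; apply/base_ringP.
exists n, (fun i => - d i); rewrite e -big_split /= big1 // => i _.
by rewrite to_totalN -Hd mulNr subrr.
Qed.

Lemma integral_closure_vals (q : Q) :
  integral_closure R q <-> forall V, valuation_rings R V -> V q.
Proof.
rewrite integral_closureE; split=> [[n [c [Hc e]]] V [rV sV _ mV]|H].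
  by apply: integral_in_valuation => //; exists n, c; split=> // i; exact: sV.
apply: contrapT => /(valuation_exists subring_base)[V [rV sV nVq mV]].
by apply: (nVq); apply: H; split=> // VT; apply: nVq; rewrite VT.
Qed.

Lemma subring_integral_closure : subring (integral_closure R).
Proof.
split; first by apply/integral_closure_vals => V [[]].
- move=> x y /integral_closure_vals hx /integral_closure_vals hy.
  apply/integral_closure_vals => V vV; have [rV _ _ _] := vV.
  by apply: ringB; [|exact: hx|exact: hy].
- move=> x y /integral_closure_vals hx /integral_closure_vals hy.
  apply/integral_closure_vals => V vV; have [rV _ _ _] := vV.
  by apply: ringM; [|exact: hx|exact: hy].
Qed.

Lemma base_sub_closure r : integral_closure R (t r).
Proof. by apply/integral_closure_vals => V [_ sV _ _]; apply: sV; exists r. Qed.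

End IntegralClosure.

(** * The conductor of the integral closure *)

Lemma jacobson_regular (R : comPzRingType) : cohen_macaulay1 R -> reduced R ->
  semilocal R -> exists2 y, jacobson R y & regular y.
Proof.
move=> cm rR /(@finite_seqP {classic (set R)})[s es].
have [y [ry Hy]] : exists y, regular y /\ forall M, M \in s -> max_ideal R M -> M y.
  elim: {es} s => [|M s [y [ry Hy]]]; first by exists 1; split=> // z; rewrite mul1r.
  have [mM|nM] := pselect (max_ideal R M); last first.
    by exists y; split=> // N; rewrite inE => /orP[/eqP->//|]; exact: Hy.
  have [x Mx rx] := max_regular cm rR mM.
  exists (x * y); split; first exact: regularM.
  move=> N; rewrite inE => /orP[/eqP-> _|Ns mN].
    by apply: idlMr Mx; exact: max_idl.
  by apply: idlM; [exact: max_idl|exact: Hy].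
exists y => // M mM; apply: Hy => //.
by have : [set M | max_ideal R M] M by []; rewrite es.
Qed.

Section FiniteLength.
Variables (R : comPzRingType) (y : R) (L : nat).
Hypotheses (nR : noetherian R) (nch : ~ prime_chain R 2).
Hypotheses (Jy : jacobson R y) (ry : regular y) (cL : cs L (pri y) setT).
Local Notation Q := (total_ring R).
Local Notation t := (@to_total R).

Lemma jacobson_pow k : ideal_power setT (jacobson R) k (y ^+ k).
Proof.
elim: k => // k IH; exists [:: (y ^+ k, y)]; last by rewrite big_seq1 exprSr.
by move=> p; rewrite inE => /eqP->.
Qed.

(** [R / c] has some finite length [k], hence is killed by [y ^+ k]. So every denominator may be
    taken to be a power of [y]. *)
Lemma ypow_in c : regular c -> exists k, pri c (y ^+ k).
Proof.
move=> rc; have [k ck] := cs_exists nR nch (idl_pri c) (@idlT _) (@subsetT _ _) (pri_id c) rc.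
by exists k; rewrite -[y ^+ k]mulr1; apply: (cs_jacobson ck) => //; exact: jacobson_pow.
Qed.

Lemma ypow_total (q : Q) : exists k r, t (y ^+ k) * q = t r.
Proof.
have [r [s [rs e]]] := total_frac q; have [k [a ek]] := ypow_in rs.
by exists k, (a * r); rewrite ek !to_totalM -e mulrA.
Qed.

Lemma ypow_totals (s : seq Q) : exists k, forall q, q \in s -> exists r, t (y ^+ k) * q = t r.
Proof.
elim: s => [|q s [k Hk]]; first by exists 0%N.
have [l [r e]] := ypow_total q; exists (l + k)%N => q'; rewrite inE => /orP[/eqP->|/Hk[r' e']].
  by exists (y ^+ k * r); rewrite exprD !to_totalM -e; ring.
by exists (y ^+ l * r'); rewrite exprD !to_totalM -e' mulrA.
Qed.

Definition rspan (u : nat -> Q) n : set Q :=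
  [set x | exists c : nat -> R, x = \sum_(i < n) t (c i) * u i].

Lemma submodule_rspan u n : submodule (base_ring R) (rspan u n).
Proof.
apply: mk_sub; first by exists (fun=> 0); rewrite big1 // => i _; rewrite to_total0 mul0r.
  move=> _ _ [c ->] [d ->]; exists (fun i => c i + d i); rewrite -big_split.
  by apply: eq_bigr => i _; rewrite to_totalD mulrDl.
move=> r _ [c ->]; exists (fun i => r * c i); rewrite mulr_sumr.
by apply: eq_bigr => i _; rewrite to_totalM mulrA.
Qed.

Lemma rspan_mem u n i : (i < n)%N -> rspan u n (u i).
Proof.
move=> im; exists (fun j => if j == i then 1 else 0).
rewrite (bigD1 (Ordinal im)) //= eqxx to_total1 mul1r big1 ?addr0 // => j nj.
case: eqP => [e|_]; last by rewrite to_total0 mul0r.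
by move: nj; rewrite -val_eqE /= e eqxx.
Qed.

Lemma rspan_in (P : set Q) u n : submodule (base_ring R) P ->
  (forall i, (i < n)%N -> P (u i)) -> rspan u n `<=` P.
Proof.
move=> sP Pu _ [c ->]; apply: (big_ind P); first exact: sub0.
  by move=> a b; apply: subD.
by move=> i _; apply: subM => //; exact: Pu.
Qed.

Lemma rspan_den u n : exists k, forall x, rspan u n x -> exists r, t (y ^+ k) * x = t r.
Proof.
have [k Hk] := ypow_totals [seq u i | i <- iota 0 n].
exists k => _ [c ->]; rewrite mulr_sumr.
apply: (big_ind (fun x => exists r, x = t r)); first by exists 0.
  by move=> _ _ [a ->] [b ->]; exists (a + b); rewrite to_totalD.
move=> i _; have [|r er] := Hk (u i).
  by apply: map_f; rewrite mem_iota leq0n add0n ltn_ord.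
by exists (c i * r); rewrite mulrCA er to_totalM.
Qed.

(** The lengths over [pri c] do not increase along the sequence, and it is stationary from an index
    of minimal length on. *)
Lemma descending_stable (G : nat -> set R) c : regular c ->
  (forall n, idl (G n) /\ G n c) -> (forall n, G n.+1 `<=` G n) ->
  exists n, forall m, (n <= m)%N -> G n `<=` G m.
Proof.
move=> rc HG dG.
have dec n k : G (k + n)%N `<=` G n by elim: k => // k IH x /dG/IH.
have /choice[f Hf] : forall n, exists k, cs k (pri c) (G n).
  move=> n; have [iG Gc] := HG n.
  exact: (cs_exists nR nch (idl_pri c) iG (pri_sub iG Gc) (pri_id c) rc).
have mf m n : (n <= m)%N -> (f m <= f n)%N /\ (f m = f n -> G n `<=` G m).
  move=> /subnK e; have := dec n (m - n)%N; rewrite e => sG.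
  have [iG Gc] := HG m.
  have [a [b [ca cb fe]]] := cs_split (Hf n) iG (pri_sub iG Gc) sG.
  have em := cs_uniq ca (Hf m); split; first by lia.
  move=> h; move: cb; have -> : b = 0%N by lia.
  by move=> /cs_0 eG x; rewrite eG.
have [n Hn] : exists n, forall m, (f n <= f m)%N.
  have : exists k, `[< exists n, f n = k >] by exists (f 0%N); apply/asboolP; exists 0%N.
  move=> /ex_minnP[k /asboolP[n <-] kmin]; exists n => m; apply: kmin; apply/asboolP.
  by exists m.
exists n => m nm; apply: (mf m n nm).2; apply/eqP.
by rewrite eqn_leq Hn (mf m n nm).1.
Qed.

(* Clearing denominators turns chains of submodules between [y E] and [E] into
   chains of ideals, whose length is at most that of [R / y]. *)
Lemma submodule_chain (E : set Q) (H : nat -> set Q) m c z :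
  submodule (base_ring R) E -> regular c -> (forall x, E x -> exists r, t c * x = t r) ->
  regular z -> E (t z) -> (forall i, (i <= m)%N -> submodule (base_ring R) (H i)) ->
  (forall i, (i < m)%N -> H i `<=` H i.+1 /\ exists2 x, H i.+1 x & ~ H i x) ->
  (forall x, E x -> H 0%N (t y * x)) -> H m `<=` E -> (m <= L)%N.
Proof.
move=> sE rc dE rz Ez sH chH yE HE.
have Ezc : pull E c (z * c) by rewrite /pull /= to_totalM -mulrA tinvP ?mulr1.
have rzc : regular (z * c) by exact: regularM.
have csE := cs_scale_len nR nch ry cL (idl_pull sE c) (ex_intro2 _ _ _ Ezc rzc).
have HiE i : (i <= m)%N -> H i `<=` E.
  move=> im; apply: subset_trans HE.
  have : forall k, (i + k <= m)%N -> H i `<=` H (i + k)%N.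
    elim=> [|k IH] hk; first by rewrite addn0.
    apply: subset_trans (IH _) _; first by lia.
    by rewrite addnS; apply: (chH _ _).1; lia.
  by move=> /(_ (m - i)%N); rewrite subnKC //; apply.
apply: (cs_chain (G := fun i => pull (H i) c) csE).
- by move=> i im; apply/idl_pull/sH.
- move=> i im; have [sub [x Hx nHx]] := chH i im; split; first by move=> r /sub.
  move=> sub'; apply: nHx; have [|r Hr ->] := pull_in rc _ Hx.
    by apply: dE; apply: (HiE i.+1).
  by apply: sub'.
- by move=> _ [r Er <-]; rewrite /pull /= to_totalM -mulrA; apply: yE.
- by move=> r Hr; apply: HE.
Qed.

Lemma to_total_pow k : t (y ^+ k.+1) = t (y ^+ k) * t y.
Proof. by rewrite exprSr to_totalM. Qed.

Local Notation B := (base_ring R).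

(* [R[z]] and [R[z] / y R[z]]: the images of the submodules of polynomials of
   degree less than [i] stabilize after at most [L] steps, and [y] is in the
   Jacobson radical. *)
Lemma integral_degree (z : Q) : integral_over B z -> pspan B z L.+1 (z ^+ L.+1).
Proof.
move=> [n [c [Bc ez]]]; have rB := subring_base R.
have B1 := ring1 rB.
pose N := maxn n L.+1.
have zN : pspan B z N (z ^+ N).
  have zk k : pspan B z (k + n) (z ^+ (k + n)).
    elim: k => [|k IH]; first by exists c.
    by rewrite addSn exprS; apply: pspan_mul.
  by have := zk (N - n)%N; rewrite subnK // leq_maxl.
have stab i x : pspan B z i x -> pspan B z N x.
  have [iN|/ltnW Ni] := leqP i N; first exact: pspan_le.
  move=> [d [Bd ->]]; apply: pspan_sum => // j _; apply: pspanM => //.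
  elim: (j : nat) => [|k IH].
    by apply: (pspan_le rB _ (pspanX z rB 0)); rewrite /N; lia.
  have [e [Be e1]] := pspan_mul rB IH.
  rewrite exprS e1 big_ord_recr /=.
  apply: pspanD => //; first by exists e.
  exact: pspanM.
have smod k : submodule B (pspan B z k).
  apply: mk_sub; first exact: pspan0.
    by move=> x x'; exact: pspanD.
  by move=> r x; apply: pspanM => //; exact: base_ring_to.
pose E := pspan B z N; pose H i := [set x | exists u v, [/\ pspan B z i u, E v & x = u + t y * v]].
have [k Hk] := ypow_totals [seq z ^+ i | i <- iota 0 N].
have Ek x : E x -> exists r, t (y ^+ k) * x = t r.
  move=> [d [Bd ->]]; rewrite mulr_sumr.
  apply: (big_ind (fun x => exists r, x = t r)); first by exists 0.
    by move=> _ _ [a ->] [b ->]; exists (a + b); rewrite to_totalD.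
  move=> i _; have [|r er] := Hk (z ^+ i); first by apply: (map_f (fun i => z ^+ i)); rewrite mem_iota leq0n add0n ltn_ord.
  have /base_ringP[a ->] := Bd i; exists (a * r).
  by rewrite mulrCA er to_totalM.
have E1 : E 1 by apply: (stab 1%N); rewrite -(expr0 z); exact: pspanX.
have sHs i : submodule B (H i).
  apply: mk_sub.
  - by exists 0, 0; split; rewrite ?mulr0 ?addr0 //; exact: pspan0.
  - move=> _ _ [u [v [hu hv ->]]] [u' [v' [hu' hv' ->]]]; exists (u + u'), (v + v').
    by split; [exact: pspanD|exact: pspanD|ring].
  - move=> r _ [u [v [hu hv ->]]]; exists (t r * u), (t r * v); have Br := base_ring_to r.
    by split; [exact: pspanM|exact: pspanM|ring].
have HS i : H i `<=` H i.+1.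
  by move=> _ [u [v [hu hv ->]]]; exists u, v; split=> //; exact: pspanS.
(* Otherwise [H 0], ..., [H L.+1] would be a strict chain of [L.+1] steps between [y E] and [E]. *)
have [i iL Hi] : exists2 i, (i <= L)%N & H i (z ^+ i).
  apply: contrapT => nH.
  have : (L.+1 <= L)%N; last by rewrite ltnn.
  apply: (@submodule_chain E H L.+1 (y ^+ k) 1) => //.
  - exact: smod.
  - exact: (regularX (n := k) ry).
  - by move=> x; rewrite mul1r.
  - move=> i iL; split; first exact: HS.
    exists (z ^+ i); last by move=> Hzi; apply: nH; exists i.
    by exists (z ^+ i), 0; rewrite mulr0 addr0; split=> //; [exact: pspanX|exact: pspan0].
  - by move=> x Ex; exists 0, x; rewrite add0r; split=> //; exact: pspan0.
  - move=> _ [u [v [hu hv ->]]]; apply: pspanD => //; first exact: stab hu.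
    by apply: pspanM => //; exact: base_ring_to.
have EH x : E x -> exists u v, [/\ pspan B z L.+1 u, E v & x = u + t y * v].
  suff H' j : H i (z ^+ j).
    move=> [d [Bd ->]]; have : H i (\sum_(j < N) d j * z ^+ j).
      apply: (big_ind (H i)); first exact: sub0 (sHs i).
        by move=> a b; apply: subD.
      by move=> j _; have /base_ringP[a ->] := Bd j; apply: subM => //; apply: H'.
    move=> [u [v [hu hv e]]]; exists u, v; split=> //.
    by apply: pspan_le hu => //; exact: leqW.
  have [ji|ij] := ltnP j i.
    exists (z ^+ j), 0; rewrite mulr0 addr0; split=> //; last exact: pspan0.
    by apply: (pspan_le rB _ (pspanX z rB j)).
  rewrite -(subnK ij); elim: (j - i)%N => // l [u [v [hu hv e]]].
  rewrite addSn exprS e mulrDr.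
  have Ezv : E (z * v) by apply: (stab N.+1); exact: pspan_mul.
  have [e' [Be' ez']] := pspan_mul rB hu.
  rewrite ez' big_ord_recr /= -addrA; apply: (subD (sHs i)).
    by exists (\sum_(i0 < i) e' i0 * z ^+ i0), 0; rewrite mulr0 addr0; split=> //; [exists e'|exact: pspan0].
  apply: (subD (sHs i)).
    by have /base_ringP[a ->] := Be' i; apply: (subM (sHs i)).
  by exists 0, (z * v); rewrite add0r mulrCA; split=> //; exact: pspan0.
(* Iterating [EH] turns the error term into [y ^+ k] times an element of [E], and [y ^+ k] carries
   [E] into [R], which has degree zero. *)
have EHk j x : E x -> exists u v, [/\ pspan B z L.+1 u, E v & x = u + t (y ^+ j) * v].
  elim: j x => [|j IH] x Ex.
    by exists 0, x; rewrite add0r expr0 to_total1 mul1r; split=> //; exact: pspan0.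
  have [u [v [hu /EH[u' [v' [hu' hv' ->]]] ->]]] := IH _ Ex.
  exists (u + t (y ^+ j) * u'), v'; split=> //.
    by apply: pspanD => //; apply: pspanM => //; exact: base_ring_to.
  by rewrite to_total_pow; ring.
have [u [v [hu hv ->]]] := EHk k _ (stab _ _ (pspanX z rB L.+1)).
apply: pspanD => //; have [r ->] := Ek v hv.
apply: (pspan_le rB (ltn0Sn L)); exists (fun=> t r); split; first by move=> j; exact: base_ring_to.
by rewrite big_ord1 expr0 mulr1.
Qed.

Definition ybar N : set R := [set r | exists2 z, integral_closure R z & t r = t (y ^+ N) * z].

Lemma idl_ybar N : idl (ybar N).
Proof.
have rB := subring_integral_closure R.
apply: mk_idl; first by exists 0; [exact: ring0|rewrite mulr0].
- move=> a b [z hz ea] [w hw eb]; exists (z + w); first exact: ringD.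
  by rewrite to_totalD ea eb mulrDr.
- move=> a b [z hz eb]; exists (t a * z); first exact: (ringM rB (base_sub_closure a) hz).
  by rewrite to_totalM eb mulrCA.
Qed.

Lemma ybarS N : ybar N.+1 `<=` ybar N.
Proof.
move=> r [z hz e]; exists (t y * z); last by rewrite e to_total_pow mulrA.
exact: (ringM (subring_integral_closure R) (base_sub_closure _) hz).
Qed.

Lemma ybar_le m n : (m <= n)%N -> ybar n `<=` ybar m.
Proof. by move=> /subnK <-; elim: (n - m)%N => // k IH x /ybarS/IH. Qed.

(** Multiplied by [(y ^+ N) ^+ L.+1], the equation of [z] becomes one for [r = y^N z] whose
    coefficients are divisible by [y ^+ N]. The point is that the exponent [L.+1] does not depend on
    [N]. *)
Lemma ybar_pow N r : ybar N r -> pri (y ^+ N) (r ^+ L.+1).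
Proof.
move=> [z /integral_closureE/integral_degree[c [Bc ez]] e].
have /choice[d Hd] : forall i, exists a, c i = t a by move=> i; apply/base_ringP.
exists (\sum_(i < L.+1) d i * (y ^+ N) ^+ (L - i) * r ^+ i).
apply: to_total_inj; rewrite to_totalX e exprMn ez mulr_sumr mulr_suml to_total_sum.
apply: eq_bigr => i _; rewrite !to_totalM !to_totalX e Hd !to_totalX.
set Y := t y ^+ N.
have -> : Y ^+ L.+1 = Y ^+ (L - i) * Y * Y ^+ i.
  by rewrite -exprSr -exprD; congr (_ ^+ _); have := ltn_ord i; lia.
by rewrite exprMn; ring.
Qed.

Hypothesis ar : analytically_reduced R.

(* Otherwise, elements of [y^N Rbar cap R] outside [y R], chosen coherently,
   define a nonzero element of the completion whose [L.+1]-st power vanishes. *)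
Lemma ybar_in : exists N, ybar N `<=` pri y.
Proof.
apply: contrapT => nN.
have nyb N : exists2 r, ybar N r & ~ pri y r.
  apply: contrapT => H; apply: nN; exists N => r Hr; apply: contrapT => nr; apply: H.
  by exists r.
have /choice[K HK] : forall k, exists n, forall m, (n <= m)%N -> ybar n `<=` adj (ybar m) (y ^+ k).
  move=> k; have [||n Hn] := @descending_stable (fun n => adj (ybar n) (y ^+ k)) _ (regularX (n := k) ry).
  - by move=> n; split; [exact: idl_adj (idl_ybar n)|exact: adj_id (idl_ybar n)].
  - by move=> n; apply: adj_sub; [exact: idl_adj (idl_ybar n)|move=> x /ybarS/sub_adj|exact: adj_id (idl_ybar n)].
  - by exists n => m /Hn sG x /sub_adj/sG.
(* The maximum makes [N] monotone and puts it in the stable range modulo [y ^+ k]; the summand [k]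
   makes the power of [a j] below divisible by [y ^+ j]. *)
pose N k := (\max_(i < k.+1) K i + k)%N.
have NK k : (K k <= N k)%N.
  apply: leq_trans (leq_addr _ _).
  exact: (@leq_bigmax _ (fun i : 'I_k.+1 => K i) ord_max).
have NS k : (N k <= N k.+1)%N.
  rewrite /N [X in (_ <= X + _)%N]big_ord_recr /=.
  set A := (\max_(i < k.+1) K i)%N; have := leq_maxl A (K k.+1); lia.
have next k a : exists b, ybar (N k) a -> ybar (N k.+1) b /\ pri (y ^+ k) (b - a).
  have [ha|nha] := pselect (ybar (N k) a); last by exists 0.
  have [b [c [hb ->]]] := HK k (N k.+1) (leq_trans (NK k) (NS k)) a (ybar_le (NK k) ha).
  exists b => _; split=> //; exists (- c); ring.
have /choice[nx Hnx] : forall p : nat * R, exists b, ybar (N p.1) p.2 ->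
    ybar (N p.1.+1) b /\ pri (y ^+ p.1) (b - p.2) by move=> [k a]; exact: next.
have [a0 ha0 na0] := nyb (N 1%N).
pose a := fix a k := if k is k'.+1 then nx (k'.+1, a k') else a0.
have ha k : ybar (N k.+1) (a k) by elim: k => // k IH; have [] := Hnx (k.+1, a k) IH.
have da k : pri (y ^+ k.+1) (a k.+1 - a k) by have [] := Hnx (k.+1, a k) (ha k).
have Jpow k : pri (y ^+ k) `<=` ideal_power setT (jacobson R) k.
  by apply: pri_sub; [exact: ideal_power_ideal|exact: jacobson_pow].
have coh : coherent (jacobson R) a.
  move=> k; apply: Jpow; have [b ->] := da k; exists (b * y).
  by rewrite exprSr mulrA mulrAC.
pose c := to_quot (cseq_preRing (jacobson R)) (mk_cseq coh).
have powE m : exists2 b : set_type (coherent (jacobson R)),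
    (forall j, term b j = a j ^+ m) & c ^+ m = to_quot (cseq_preRing (jacobson R)) b.
  elim: m => [|m [b Hb e]].
    eexists; last by rewrite expr0 -to_quot1.
    by move=> j; rewrite expr0.
  eexists; last by rewrite exprS e -to_quotM.
  by move=> j; rewrite /= /term /= exprS -(Hb j).
have [b Hb e] := powE L.+1.
have : c = 0.
  apply: (ar (n := L.+1)); rewrite e -to_quot0; apply/to_quot_eq/asboolP => j.
  rewrite Hb /term /= subr0; apply: Jpow.
  have [d ->] := ybar_pow (ha j); exists (d * y ^+ (N j.+1 - j)).
  rewrite -mulrA -exprD subnK // /N; lia.
rewrite -to_quot0 => /to_quot_eq/asboolP/(_ L); rewrite /term /= subr0 => JL.
(* The [L]-th power of the Jacobson radical kills [R / y], while every [a k] is congruent to [a0]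
   modulo [y]. *)
have yaL : pri y (a L) by rewrite -[a L]mulr1; apply: (cs_jacobson cL).
have ip := idl_pri y.
have yd k : pri y (a k - a 0%N).
  elim: k => [|k IH]; first by rewrite subrr; exact: idl0.
  have -> : a k.+1 - a 0%N = (a k.+1 - a k) + (a k - a 0%N) by ring.
  apply: idlD => //; have [d ->] := da k; rewrite exprSr mulrA; by exists (d * y ^+ k).
apply: na0; have -> : a0 = a L - (a L - a 0%N) by rewrite /=; ring.
exact: idlB.
Qed.

(** Some [y ^+ (N + m)] carries [z] into [R]; since [y^N Rbar cap R] lies in [y R], the [m] surplus
    factors are cancelled one at a time, with [N] independent of [z]. *)
Lemma conductor_exists : exists N, forall z, integral_closure R z ->
  exists r, t (y ^+ N) * z = t r.
Proof.
have [N HN] := ybar_in; exists N => z hz.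
have [m] : exists m, exists r, t (y ^+ (N + m)) * z = t r.
  have [k [r e]] := ypow_total z; exists k, (y ^+ N * r).
  by rewrite exprD !to_totalM -e mulrA.
elim: m => [|m IH]; first by rewrite addn0.
rewrite addnS => -[r er]; apply: IH.
have [|r' er'] := HN r.
  apply: (ybar_le (m := N) (leqnn _)); exists (t (y ^+ m.+1) * z).
    exact: (ringM (subring_integral_closure R) (base_sub_closure _) hz).
  by rewrite -er -addnS exprD to_totalM mulrA.
exists r'; apply: (scaleI (regular_total ry)).
rewrite mulrA -to_totalM -exprS er er' -to_totalM; congr to_total; ring.
Qed.

End FiniteLength.

(** * Discrete valuations *)

Section ValuationRing.
Variables (T : comPzRingType) (V : set T).
Hypothesis vN : forall q : T, exists e u v, [/\ e * e = e, q = e * u & u * v = 1].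
Hypotheses (rV : subring V) (mV : forall x y, ~ V x -> ~ V y -> ~ V (x * y)).
Implicit Types (x y z u v e q : T).

Let V0 := ring0 rV.
Let V1 := ring1 rV.

Lemma val_idem e : e * e = e -> V e /\ V (1 - e).
Proof.
move=> ee; have e0 : e * (1 - e) = 0 by rewrite mulrBr mulr1 ee subrr.
have [Ve|nVe] := pselect (V e); first by split=> //; exact: ringB.
have [Ve|nVe'] := pselect (V (1 - e)).
  by split=> //; rewrite -[e](subKr 1); exact: ringB.
by exfalso; apply: (mV nVe nVe'); rewrite e0.
Qed.

Lemma val_inv u v : u * v = 1 -> V u \/ V v.
Proof.
move=> uv; apply: contrapT => /not_orP[nu nv]; apply: (mV nu nv).
by rewrite uv.
Qed.

(** The unit [u] agrees with [q] on the support [e] and is [1] off it; as [V] contains all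
    idempotents, membership of [q] in [V] can be tested on [u]. *)
Lemma unit_part q : exists e u v, [/\ e * e = e, q = e * u, u * v = 1 & u = q + (1 - e)].
Proof.
have [e [u [v [ee -> uv]]]] := vN q.
exists e, (e * u + (1 - e)), (e * v + (1 - e)); split=> //.
  transitivity (e * e * u + e - e * e); last by ring.
  by rewrite ee addrK.
transitivity (e * e * (u * v) + (e - e * e) * (u + v) + (1 - e - e + e * e)); first ring.
by rewrite ee uv; ring.
Qed.

(** Over a field these are the nonunits of [V]. In the presence of zero divisors this form still
    gives a prime ideal at once; [val_idealE] identifies it with [m_V]. *)
Definition vmax : set T := [set x | exists z, ~ V z /\ V (z * x)].

Lemma vmax_sub x : vmax x -> V x.
Proof. by move=> [z [nVz Vzx]]; apply: contrapT => nVx; apply: (mV nVz nVx). Qed.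

Lemma vmax_n1 : ~ vmax 1.
Proof. by move=> [z [nVz]]; rewrite mulr1. Qed.

Lemma vmaxM a x : V a -> vmax x -> vmax (a * x).
Proof.
by move=> Va [z [nVz Vzx]]; exists z; split=> //; rewrite mulrCA; apply: ringM.
Qed.

Lemma vmax_unit x : vmax x -> exists z w, [/\ ~ V z, V (z * x) & z * w = 1].
Proof.
move=> hx; have Vx := vmax_sub hx; have [z [nVz Vzx]] := hx.
have [e [u [v [ee ze uv eu]]]] := unit_part z; exists u, v; split=> //.
  by move=> Vu; apply: nVz; rewrite ze; apply: ringM => //; exact: (val_idem ee).1.
rewrite eu mulrDl; apply: ringD => //; apply: ringM => //; exact: (val_idem ee).2.
Qed.

Lemma vmaxD x y : vmax x -> vmax y -> vmax (x + y).
Proof.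
move=> /vmax_unit[z [z' [nz Vzx zz]]] /vmax_unit[w [w' [nw Vwy ww]]].
have [|h|h] := @val_inv (z * w') (w * z').
- by transitivity ((z * z') * (w * w')); [ring|rewrite zz ww mulr1].
- exists z; split=> //; rewrite mulrDr; apply: ringD => //.
  have -> : z * y = (z * w') * (w * y).
    by transitivity (z * (w * w') * y); [rewrite ww mulr1|ring].
  exact: ringM.
- exists w; split=> //; rewrite mulrDr; apply: ringD => //.
  have -> : w * x = (w * z') * (z * x).
    by transitivity (w * (z * z') * x); [rewrite zz mulr1|ring].
  exact: ringM.
Qed.

Lemma vmax0 : V <> setT -> vmax 0.
Proof.
move=> nVT; apply: contrapT => H; apply: nVT; apply/seteqP; split=> // x _.
by apply: contrapT => nVx; apply: H; exists x; rewrite mulr0.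
Qed.

Lemma vmax_prime x y : vmax (x * y) -> vmax x \/ vmax y.
Proof.
move=> [z [nVz h]]; have [Vzx|nVzx] := pselect (V (z * x)); first by left; exists z.
by right; exists (z * x); rewrite -mulrA.
Qed.

Lemma vmax_inv u v : u * v = 1 -> ~ vmax u -> V v.
Proof.
by move=> uv nu; apply: contrapT => nv; apply: nu; exists v; rewrite mulrC uv.
Qed.

(** If [e * q] were outside [V], it would witness that [1 - e] is in [vmax], since their product is
    zero; then [1] would be in [vmax]. *)
Lemma vmax_idem_mul e q : e * e = e -> vmax e -> V (e * q).
Proof.
move=> ee me; apply: contrapT => nVeq; apply: vmax_n1.
rewrite -(subrK e 1); apply: vmaxD => //; exists (e * q); split=> //.
by have -> : e * q * (1 - e) = (e - e * e) * q; [ring|rewrite ee subrr mul0r].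
Qed.

Lemma vmax_idem e : V <> setT -> e * e = e -> vmax e \/ vmax (1 - e).
Proof.
move=> nT ee; apply: vmax_prime; rewrite mulrBr mulr1 ee subrr; exact: vmax0.
Qed.

Hypothesis nVT : V <> setT.

Variables (p p' : T).
Hypotheses (pp : p * p' = 1) (mp : vmax p).
Hypothesis pgen : forall u v, u * v = 1 -> vmax u -> V (u * p').

Lemma vmaxE x : vmax x <-> V (p' * x).
Proof.
split=> [mx|h]; last first.
  have -> : x = (p' * x) * p by transitivity (p * p' * x); [rewrite pp mul1r|ring].
  exact: vmaxM.
have [e [u [v [ee xe uv eu]]]] := unit_part x.
have [me|me] := vmax_idem nVT ee.
  by rewrite xe mulrCA; apply: vmax_idem_mul.
have mu : vmax u by rewrite eu; apply: vmaxD.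
rewrite xe mulrCA [p' * u]mulrC; apply: ringM => //; last exact: pgen uv mu.
exact: (val_idem ee).1.
Qed.

Definition zp (k : int) : T :=
  match k with Posz n => p ^+ n | Negz n => p' ^+ n.+1 end.

Lemma zp_sub m n : zp (m%:Z - n%:Z) = p ^+ m * p' ^+ n.
Proof.
have ppk k : p ^+ k * p' ^+ k = 1 by rewrite -exprMn pp expr1n.
have [nm|/ltnW mn] := leqP n m.
  rewrite -{2}(subnK nm) exprD -mulrA ppk mulr1.
  by have -> : m%:Z - n%:Z = (m - n)%N%:Z by rewrite -subzn.
rewrite -{2}(subnK mn) exprD mulrCA ppk mulr1.
case e : (n - m)%N => [|k].
  have -> : m = n by lia.
  by rewrite subrr.
have -> : m%:Z - n%:Z = Negz k by lia.
by [].
Qed.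

Lemma zpD j k : zp (j + k) = zp j * zp k.
Proof.
have sp (i : int) : exists m n : nat, i = m%:Z - n%:Z.
  by case: i => n; [exists n, 0%N; rewrite subr0|exists 0%N, n.+1; rewrite sub0r NegzE].
have [m [n ->]] := sp j; have [m' [n' ->]] := sp k.
have -> : m%:Z - n%:Z + (m'%:Z - n'%:Z) = (m + m')%N%:Z - (n + n')%N%:Z by lia.
by rewrite !zp_sub !exprD; ring.
Qed.

Lemma zp0 : zp 0 = 1. Proof. by []. Qed.
Lemma zp1 : zp 1 = p. Proof. by []. Qed.

(** The set [zp k V], identified with [val_power V k] in [val_powerE]. *)
Definition vge (k : int) : set T := [set q | V (zp (- k) * q)].

Lemma vge0 q : vge 0 q <-> V q.
Proof. by rewrite /vge /mkset oppr0 zp0 mul1r. Qed.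

Lemma vge1 q : vge 1 q <-> vmax q.
Proof. by rewrite vmaxE. Qed.

Lemma vgeM j k x y : vge j x -> vge k y -> vge (j + k) (x * y).
Proof.
rewrite /vge /= => h h'; rewrite opprD zpD.
have -> : zp (- j) * zp (- k) * (x * y) = (zp (- j) * x) * (zp (- k) * y) by ring.
exact: ringM.
Qed.

Lemma vge_zp k : vge k (zp k).
Proof. by rewrite /vge /= -zpD addNr. Qed.

Lemma vgeD k x y : vge k x -> vge k y -> vge k (x + y).
Proof. by rewrite /vge /= mulrDr; apply: ringD. Qed.

Lemma vgeN k x : vge k x -> vge k (- x).
Proof. by rewrite /vge /= mulrN; apply: ringN. Qed.

Lemma vge_ring x k : V x -> (0 <= k)%R -> V (zp k * x).
Proof.
case: k => // n Vx _; apply: ringM => //; apply: ringX => //; exact: vmax_sub.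
Qed.

Lemma vge_le j k x : (j <= k)%R -> vge k x -> vge j x.
Proof.
move=> jk; rewrite /vge /= => h.
have -> : zp (- j) * x = zp (k - j) * (zp (- k) * x).
  by rewrite mulrA -zpD; congr (zp _ * _); lia.
by apply: vge_ring => //; lia.
Qed.

Lemma vge_shift k j x : vge k (zp j * x) <-> vge (k - j) x.
Proof.
by rewrite /vge /= mulrA -zpD; have -> : - (k - j) = - k + j by lia.
Qed.

Lemma veq_vmax k x : ~ vge (k + 1) x <-> ~ vmax (zp (- k) * x).
Proof. by rewrite -vge1 vge_shift; have -> : 1 - - k = k + 1 by lia. Qed.

Lemma vge_veqM j k x y : vge j x -> ~ vge (j + 1) x -> vge k y -> ~ vge (k + 1) y ->
  ~ vge (j + k + 1) (x * y).
Proof.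
move=> hx /veq_vmax nx hy /veq_vmax ny; apply/veq_vmax; rewrite opprD zpD.
have -> : zp (- j) * zp (- k) * (x * y) = (zp (- j) * x) * (zp (- k) * y) by ring.
by move=> /vmax_prime[].
Qed.

End ValuationRing.

(** * Uniformizers and finiteness of values *)

Section Uniformizer.
Variables (R : comPzRingType) (y : R) (L : nat).
Hypotheses (nR : noetherian R) (nch : ~ prime_chain R 2) (rR : reduced R).
Hypotheses (Jy : jacobson R y) (ry : regular y) (cL : cs L (pri y) setT).
Local Notation Q := (total_ring R).
Local Notation t := (@to_total R).

Variable V : set Q.
Hypothesis vV : valuation_rings R V.

Let vN := total_vonNeumann nR rR.
Let rV : subring V. Proof. by case: vV. Qed.
Let mV : forall a b, ~ V a -> ~ V b -> ~ V (a * b). Proof. by case: vV. Qed.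
Let nVT : V <> setT. Proof. by case: vV. Qed.
Let Vt r : V (t r). Proof. by case: vV => _ sV _ _; apply: sV; exact: base_ring_to. Qed.

(** The denominator of an element outside [V] is a regular element of this prime ideal, which is
    therefore maximal in dimension one. *)
Lemma vmax_contract : max_ideal R [set r | vmax V (t r)].
Proof.
have [q nVq] : exists q, ~ V q.
  apply: contrapT => H; apply: nVT; apply/seteqP; split=> // q _.
  by apply: contrapT => nVq; apply: H; exists q.
have [r [s [rs eq]]] := totalE q.
have ms : vmax V (t s).
  exists (tinv s); split; last by rewrite mulrC tinvP //; exact: ring1.
  by move=> h; apply: nVq; rewrite eq; apply: ringM.
apply: (prime_regular_max nR nch _ ms rs); split.
- apply: mk_idl => /=; first exact: vmax0.
    by move=> a b; rewrite to_totalD; exact: vmaxD.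
  by move=> a b; rewrite to_totalM; exact: vmaxM.
- move=> e; apply: (@vmax_n1 _ V); have : [set r | vmax V (t r)] 1 by rewrite e.
  by [].
- by move=> a b _ _; rewrite /= to_totalM; exact: vmax_prime.
Qed.

Let my : vmax V (t y). Proof. exact: Jy vmax_contract. Qed.

(* [u 0 V < u 1 V < ...] gives a chain between [y E] and [E], where [E] is
   generated by the [u i]. *)
Lemma unit_chain (u w : nat -> Q) m : (forall i, (i <= m)%N -> u i * w i = 1) ->
  (forall i, (i <= m)%N -> V (u i)) -> V (t y * w 0%N) ->
  (forall i, (i < m)%N -> V (u i * w i.+1) /\ ~ V (u i.+1 * w i)) -> (m <= L)%N.
Proof.
move=> uw Vu Vy st.
pose E := rspan u m.+1.
have sE : submodule (base_ring R) E := submodule_rspan u m.+1.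
have Eu i : (i <= m)%N -> E (u i) by move=> im; apply: rspan_mem.
have EV x : E x -> V x.
  apply: rspan_in; last by move=> i; exact: Vu.
  apply: mk_sub; [exact: ring0|by move=> a b; exact: ringD|].
  by move=> a b; apply: ringM.
have [k dE] := rspan_den nR nch Jy u m.+1.
have [r [s [rs es]]] := total_frac (u 0%N).
have rr : regular r.
  apply: regular_to_total; rewrite -es; apply: regularM; first exact: regular_total.
  exact: unit_regular (uw 0%N (leq0n _)).
have Er : E (t r) by rewrite -es; apply: subM => //; exact: Eu.
have wu i : (i <= m)%N -> w i * u i = 1 by move=> im; rewrite mulrC uw.
pose H i := [set x | E x /\ V (x * w i)].
apply: (@submodule_chain _ y L nR nch ry cL E H m (y ^+ k) r) => //.
- exact: (regularX (n := k) ry).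
- move=> i im; apply: mk_sub; first by split; [exact: sub0|rewrite mul0r; exact: ring0].
    move=> a b [Ea Va] [Eb Vb]; split; first exact: subD.
    by rewrite mulrDl; apply: ringD.
  move=> a b [Eb Vb]; split; first exact: subM.
  by rewrite -mulrA; apply: ringM.
- move=> i im; have [V1 nV2] := st i im; split.
    move=> x [Ex Vx]; split=> //.
    have -> : x * w i.+1 = (x * w i) * (u i * w i.+1).
      by rewrite mulrA -[x * w i * u i]mulrA wu ?mulr1 // ltnW.
    exact: ringM.
  exists (u i.+1); last by case.
  by split; [exact: Eu|rewrite uw //; exact: ring1].
- move=> x Ex; split; first exact: subM.
  by rewrite mulrAC; apply: ringM => //; exact: EV.
- by move=> x [].
Qed.

(** Otherwise every unit [p] of [Q] in [vmax V] has another such unit [u] with [u V] not inside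
    [p V], so [u V] strictly contains [p V]. Starting from [y], this gives a chain that is too long
    for [unit_chain]. *)
Lemma uniformizer_exists : exists p p', [/\ p * p' = 1, vmax V p &
  forall u v, u * v = 1 -> vmax V u -> V (u * p')].
Proof.
apply: contrapT => nP.
pose P (s : Q * Q) := s.1 * s.2 = 1 /\ vmax V s.1.
have /choice[nx Hnx] : forall s : Q * Q, exists s', P s -> P s' /\ ~ V (s'.1 * s.2).
  move=> [p p']; have [[pp mp]|] := pselect (P (p, p')); last by exists (p, p').
  apply: contrapT => H; apply: nP; exists p, p'; split=> // u v uv mu.
  by apply: contrapT => nV; apply: H; exists (u, v).
pose s k := iter k nx (t y, tinv y).
have Ps k : P (s k).
  elim: k => [|k IH]; first by split=> //=; exact: tinvP.
  exact: (Hnx _ IH).1.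
have nVs k : ~ V ((s k.+1).1 * (s k).2) by exact: (Hnx _ (Ps k)).2.
have : (L.+1 <= L)%N; last by rewrite ltnn.
apply: (@unit_chain (fun i => (s i).1) (fun i => (s i).2)).
- by move=> i _; exact: (Ps i).1.
- by move=> i _; apply: vmax_sub => //; exact: (Ps i).2.
- by rewrite /= tinvP //; exact: ring1.
- move=> i _; split=> //.
  have [|//|/nVs //] := @val_inv _ V rV mV ((s i).1 * (s i.+1).2) ((s i.+1).1 * (s i).2).
  transitivity (((s i).1 * (s i).2) * ((s i.+1).1 * (s i.+1).2)); first ring.
  by rewrite (Ps i).1 (Ps i.+1).1 mulr1.
Qed.

Section WithUniformizer.
Variables (p p' : Q).
Hypotheses (pp : p * p' = 1) (mp : vmax V p).
Hypothesis pgen : forall u v, u * v = 1 -> vmax V u -> V (u * p').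

Local Notation zp := (zp p p').
Local Notation vge := (vge V p p').
Let vgeM' := vgeM rV pp.
Let vge1' := vge1 vN rV mV nVT pp mp pgen.
Let vge_le' := vge_le rV mV pp mp.
Let veqM' := vge_veqM vN rV mV nVT pp mp pgen.

Lemma vge_1 k : vge k 1 -> (k <= 0)%R.
Proof.
move=> h; rewrite leNgt; apply/negP => k0; apply: (@vmax_n1 _ V); apply/vge1'.
by apply: vge_le' h; lia.
Qed.

Lemma max_order (P : int -> Prop) k : P k -> (exists b, forall j, P j -> (j <= b)%R) ->
  exists2 m, P m & forall j, P j -> (j <= m)%R.
Proof.
move=> Pk [b Hb].
have e j : P j -> P (b - `|b - j|%N%:Z).
  by move=> Pj; have jb := Hb _ Pj; have -> : b - `|b - j|%N%:Z = j by lia.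
have : exists n : nat, `[< P (b - n%:Z) >] by exists `|b - k|%N; apply/asboolP/e.
move=> /ex_minnP[n /asboolP Pn nmin]; exists (b - n%:Z) => // j Pj.
have := nmin `|b - j|%N (introT (asboolP _) (e _ Pj)); have := Hb _ Pj; lia.
Qed.

Lemma vge_y_bound n : vge n%:Z (t y) -> (n <= L)%N.
Proof.
move=> h; have ppk k : p ^+ k * p' ^+ k = 1 by rewrite -exprMn pp expr1n.
apply: (@unit_chain (fun i => p ^+ (n - i)) (fun i => p' ^+ (n - i))) => //.
- by move=> i _; apply: ringX => //; exact: vmax_sub.
- rewrite subn0 mulrC; move: h; rewrite /vge /mkset.
  by have := zp_sub pp 0 n; rewrite sub0r mul1r => ->.
- move=> i im; have -> : (n - i)%N = (n - i.+1).+1 by lia.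
  set k := (n - i.+1)%N; split.
    by rewrite exprS -mulrA ppk mulr1; exact: vmax_sub.
  rewrite exprSr mulrA ppk mul1r => h'; apply: (@vmax_n1 _ V).
  by rewrite -pp mulrC; apply: vmaxM.
Qed.

(** Some [y ^+ n] carries [q] into [R], and [y] has a finite value [a] by [vge_y_bound]; so [q] has
    value at least [- n a]. *)
Lemma vge_exists q : exists k, vge k q.
Proof.
have [a Va nVa] : exists2 a, vge a (t y) & ~ vge (a + 1) (t y).
  have [|m Vm Hm] := @max_order (fun k => vge k (t y)) 0 ((vge0 V p p' (t y)).2 (Vt y)).
    exists L%:Z => -[n /vge_y_bound|n _]; lia.
  by exists m => // /Hm; lia.
have yn n : vge (n%:Z * a) (t (y ^+ n)) /\ ~ vge (n%:Z * a + 1) (t (y ^+ n)).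
  elim: n => [|n [IH1 IH2]].
    rewrite expr0 mul0r add0r to_total1; split; first by apply/vge0; exact: ring1.
    by move=> /vge_1.
  rewrite exprSr to_totalM; have -> : n.+1%:Z * a = n%:Z * a + a by lia.
  by split; [exact: vgeM'|exact: veqM'].
have [n [r e]] := ypow_total nR nch Jy q; have [h1 h2] := yn n.
set b := n%:Z * a in h1 h2; exists (- b).
rewrite /vge /mkset opprK.
have yu := tinvP (regularX (n := n) ry).
have Vi : V (zp b * tinv (y ^+ n)).
  apply: (vmax_inv rV (u := zp (- b) * t (y ^+ n))).
    transitivity (zp (- b) * zp b * (t (y ^+ n) * tinv (y ^+ n))); first ring.
    by rewrite yu mulr1 -(zpD pp) addNr.
  by move/(veq_vmax vN rV mV nVT pp mp pgen): h2.
have -> : zp b * q = zp b * tinv (y ^+ n) * t r.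
  rewrite -e; transitivity (zp b * q * (t (y ^+ n) * tinv (y ^+ n))); last ring.
  by rewrite yu mulr1.
exact: ringM.
Qed.

(** If an ideal contains some [x] outside [vmax V] together with the idempotent [1 - e] off the
    support of [x], it contains a unit of [V]. The idempotent lies in [vmax V]; a regular ideal
    contains it too, because [V] contains [(1 - e) Q]. *)
Lemma val_idealE : val_ideal V = vmax V.
Proof.
have subm m : ideal V m -> forall a b, m a -> m b -> m (a + b).
  by move=> [[_ H _] _].
have subM' m : ideal V m -> forall a b, V a -> m b -> m (a * b).
  by move=> [[_ _ H] _].
have iv : ideal V (vmax V).
  split; last by move=> x; exact: vmax_sub.
  split; [exact: vmax0|by move=> a b; exact: vmaxD|by move=> a b; exact: vmaxM].
have id1 m : ideal V m -> m 1 -> m = V.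
  move=> im m1; apply/seteqP; split; first by case: im.
  by move=> x Vx; rewrite -[x]mulr1; apply: subM'.
have mmax : maximal_ideal V (vmax V) /\ reg_part (vmax V) !=set0.
  split; last by exists p; split=> //; exact: unit_regular pp.
  split=> //.
    by move=> e; apply: (@vmax_n1 _ V); rewrite e; exact: ring1.
  move=> I iI sI; have [IV|nIV] := pselect (I `<=` vmax V).
    by left; apply/seteqP.
  have [x Ix nx] : exists2 x, I x & ~ vmax V x.
    apply: contrapT => H; apply: nIV => x Ix; apply: contrapT => nx; apply: H.
    by exists x.
  right; apply: id1 => //.
  have [e [u [v [ee xe uv eu]]]] := unit_part vN x.
  have [me|me] := vmax_idem rV nVT ee.
    have xx : x = x * e by rewrite {2}xe mulrAC ee -xe.
    exfalso; apply: nx; rewrite xx; apply: vmaxM => //; case: iI => _; exact.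
  have nu : ~ vmax V u.
    move=> mu; apply: nx; rewrite xe; apply: vmaxM => //; exact: (val_idem rV mV ee).1.
  have Vv := vmax_inv rV uv nu.
  rewrite -uv mulrC; apply: (subM') => //; rewrite eu; apply: (subm) => //; exact: sI.
rewrite /val_ideal; apply: xget_unique => // m [[im nm maxm] [s [ms rs]]].
have [s' ss] := regular_unit rs.
suff sm : m `<=` vmax V.
  case: (maxm _ iv sm) => [->//|e].
  by exfalso; apply: (@vmax_n1 _ V); rewrite e; exact: ring1.
move=> x mx; apply: contrapT => nx; apply: nm; apply: id1 => //.
have [e [u [v [ee xe uv eu]]]] := unit_part vN x.
have [me|me] := vmax_idem rV nVT ee.
  have xx : x = x * e by rewrite {2}xe mulrAC ee -xe.
  exfalso; apply: nx; rewrite xx; apply: vmaxM => //; case: im => _; exact.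
have nu : ~ vmax V u.
  move=> mu; apply: nx; rewrite xe; apply: vmaxM => //; exact: (val_idem rV mV ee).1.
have Vv := vmax_inv rV uv nu.
rewrite -uv mulrC; apply: (subM') => //; rewrite eu; apply: (subm) => //.
have -> : 1 - e = (1 - e) * s' * s.
  by rewrite -mulrA [s' * s]mulrC ss mulr1.
apply: (subM') => //; apply: (vmax_idem_mul vN rV mV) => //.
by transitivity (1 - e - e + e * e); [ring|rewrite ee; ring].
Qed.

Lemma val_powerE k : val_power V k = vge k.
Proof.
have pos n : ideal_power V (val_ideal V) n = vge n%:Z.
  elim: n => [|n IH]; first by apply/seteqP; split=> x /(vge0 V p p').
  rewrite -[LHS]/(span_mul (ideal_power V (val_ideal V) n) (val_ideal V)) IH val_idealE.
  apply/seteqP; split=> [_ [s Hs ->]|x].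
    rewrite big_seq; apply: (big_ind (vge n.+1%:Z)).
    - by rewrite /vge /mkset mulr0; exact: ring0.
    - by move=> a b; apply: vgeD.
    - move=> a /Hs[h1 h2].
      have -> : n.+1%:Z = n%:Z + 1 by lia.
      by apply: vgeM' => //; apply/vge1'.
  move=> hx; exists [:: (p' * x, p)]; last first.
    by rewrite big_seq1 /= mulrAC [p' * p]mulrC pp mul1r.
  move=> a; rewrite inE => /eqP-> /=; split=> //.
  have -> : p' * x = zp (- 1) * x by [].
  by apply/(vge_shift V pp); have -> : n%:Z - -1 = n.+1%:Z by lia.
have colE : colon V (val_ideal V) = vge (- 1).
  apply/seteqP; split=> x; rewrite /colon val_idealE /vge /mkset opprK (zp1 p p').
    by rewrite mulrC; apply.
  move=> h z /vge1' mz; have -> : x * z = p * x * (p' * z).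
    by transitivity (p * p' * (x * z)); [rewrite pp mul1r|ring].
  apply: ringM => //; exact: mz.
case: k => // n.
have neg m : ideal_power V (colon V (val_ideal V)) m = vge (- m%:Z).
  elim: m => [|m IH]; first by apply/seteqP; split=> x /(vge0 V p p').
  rewrite -[LHS]/(span_mul (ideal_power V (colon V (val_ideal V)) m) (colon V (val_ideal V))) IH colE.
  apply/seteqP; split=> [_ [s Hs ->]|x].
    rewrite big_seq; apply: (big_ind (vge (- m.+1%:Z))).
    - by rewrite /vge /mkset mulr0; exact: ring0.
    - by move=> a b; apply: vgeD.
    - move=> a /Hs[h1 h2].
      have -> : - m.+1%:Z = - m%:Z + - 1 :> int by lia.
      exact: vgeM'.
  move=> hx; exists [:: (p * x, p')]; last first.
    by rewrite big_seq1 /= mulrAC pp mul1r.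
  move=> a; rewrite inE => /eqP-> /=; split.
    have -> : p * x = zp 1 * x by [].
    by apply/(vge_shift V pp); have -> : - m%:Z - 1 = - m.+1%:Z :> int by lia.
  by rewrite /vge /mkset opprK (zp1 p p') pp; exact: ring1.
by rewrite -[LHS]/(ideal_power V (colon V (val_ideal V)) n.+1) neg NegzE.
Qed.

End WithUniformizer.
End Uniformizer.

(** Value exactly [k], stated without the choice made in [valuation]; [valuation_veq] relates the
    two. *)
Definition veq (R : comPzRingType) (V : set (total_ring R)) (k : int) (q : total_ring R) :=
  val_power V k q /\ ~ val_power V (k + 1) q.

Section ValuationInterface.
Variables (R : comPzRingType) (y : R) (L : nat).
Hypotheses (nR : noetherian R) (nch : ~ prime_chain R 2) (rR : reduced R).
Hypotheses (Jy : jacobson R y) (ry : regular y) (cL : cs L (pri y) setT).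
Local Notation Q := (total_ring R).
Local Notation t := (@to_total R).

Let vN := total_vonNeumann nR rR.

Section OneValuation.
Variable V : set Q.
Hypothesis vV : valuation_rings R V.
Local Notation vp := (val_power V).

Let rV : subring V. Proof. by case: vV. Qed.
Let mV : forall a b, ~ V a -> ~ V b -> ~ V (a * b). Proof. by case: vV. Qed.
Let nVT : V <> setT. Proof. by case: vV. Qed.
Let unif := uniformizer_exists nR nch rR Jy ry cL vV.
Let vpE p p' (pp : p * p' = 1) (mp : vmax V p)
  (pg : forall u v, u * v = 1 -> vmax V u -> V (u * p')) : val_power V = vge V p p'.
Proof. by apply/funext => k; exact: (val_powerE nR rR vV pp mp pg). Qed.

Lemma vp0 q : vp 0 q <-> V q.
Proof. by have [p [p' [pp mp pg]]] := unif; rewrite (vpE pp mp pg) vge0. Qed.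

Lemma vp1 q : vp 1 q <-> vmax V q.
Proof.
have [p [p' [pp mp pg]]] := unif; rewrite (vpE pp mp pg).
exact: (vge1 vN rV mV nVT pp mp pg).
Qed.

Lemma vpM j k a b : vp j a -> vp k b -> vp (j + k) (a * b).
Proof.
have [p [p' [pp mp pg]]] := unif; rewrite (vpE pp mp pg).
exact: (vgeM rV pp).
Qed.

Lemma vpD k a b : vp k a -> vp k b -> vp k (a + b).
Proof.
by have [p [p' [pp mp pg]]] := unif; rewrite (vpE pp mp pg); apply: vgeD.
Qed.

Lemma vpN k a : vp k a -> vp k (- a).
Proof.
by have [p [p' [pp mp pg]]] := unif; rewrite (vpE pp mp pg); apply: vgeN.
Qed.

Lemma vpB k a b : vp k a -> vp k b -> vp k (a - b).
Proof. by move=> ha hb; apply: vpD => //; apply: vpN. Qed.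

Lemma vp_zero k : vp k 0.
Proof.
have [p [p' [pp mp pg]]] := unif; rewrite (vpE pp mp pg) /vge /mkset mulr0.
exact: ring0.
Qed.

Lemma vp_le j k a : (j <= k)%R -> vp k a -> vp j a.
Proof.
have [p [p' [pp mp pg]]] := unif; rewrite (vpE pp mp pg).
exact: (vge_le rV mV pp mp).
Qed.

Lemma vp_base r : vp 0 (t r).
Proof. by apply/vp0; case: vV => _ sV _ _; apply: sV; exact: base_ring_to. Qed.

Lemma vpMr k r a : vp k a -> vp k (t r * a).
Proof. by move=> h; rewrite -[k]add0r; apply: vpM h; exact: vp_base. Qed.

Lemma veqM j k a b : veq V j a -> veq V k b -> veq V (j + k) (a * b).
Proof.
move=> [ha na] [hb nb]; split; first exact: vpM.
move: ha na hb nb; have [p [p' [pp mp pg]]] := unif; rewrite (vpE pp mp pg).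
exact: (vge_veqM vN rV mV nVT pp mp pg).
Qed.

Lemma veq_uniq j k a : veq V j a -> veq V k a -> j = k.
Proof.
move=> [hj nj] [hk nk]; apply/eqP; rewrite eq_le; apply/andP; split.
  rewrite leNgt; apply/negP => h; apply: nk; apply: vp_le hj; lia.
by rewrite leNgt; apply/negP => h; apply: nj; apply: vp_le hk; lia.
Qed.

Lemma veq_le j k a : veq V j a -> vp k a -> (k <= j)%R.
Proof. by move=> [hj nj] hk; rewrite leNgt; apply/negP => h; apply: nj; apply: vp_le hk; lia. Qed.

Lemma veq1 : veq V 0 1.
Proof.
split; first by apply/vp0; exact: ring1.
by rewrite add0r => /vp1; exact: vmax_n1.
Qed.

Lemma vp_exists q : exists k, vp k q.
Proof.
have [p [p' [pp mp pg]]] := unif; rewrite (vpE pp mp pg).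
exact: (vge_exists nR nch rR Jy ry cL vV pp mp pg).
Qed.

Lemma vp_cases q : (exists k, veq V k q) \/ forall k, vp k q.
Proof.
have [|/asboolPn nall] := pselect (forall k, vp k q); first by right.
have [b nb] : exists b, ~ vp b q.
  by apply: contrapT => H; move/asboolP: nall; apply => k; apply: contrapT => nk; apply: H; exists k.
have [k hk] := vp_exists q; left.
have [|m hm maxm] := @max_order (fun k => vp k q) k hk.
  exists b => j hj; rewrite leNgt; apply/negP => bj; apply: nb; apply: vp_le hj; lia.
by exists m; split=> // /maxm; lia.
Qed.

Lemma veq_unit u v : u * v = 1 -> exists k, veq V k u.
Proof.
move=> uv; have [//|all] := vp_cases u.
have [l hl] := vp_exists v; exfalso; apply: veq1.2.
have := vpM (all (1 - l)) hl; rewrite uv; have -> : 1 - l + l = 0 + 1 :> int by lia.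
by [].
Qed.

Lemma uniformizer_pow k : exists u v, u * v = 1 /\ veq V k u.
Proof.
have [p [p' [pp mp pg]]] := unif; exists (zp p p' k), (zp p p' (- k)); split.
  by rewrite -(zpD pp) subrr.
rewrite /veq (vpE pp mp pg); split; first exact: (vge_zp rV pp).
move=> h; have := (vge_shift V pp (k + 1) k 1).1; rewrite mulr1 => /(_ h).
have -> : k + 1 - k = 1 :> int by lia.
by move/(vge1 vN rV mV nVT pp mp pg); exact: vmax_n1.
Qed.

Lemma vp_idem e : e * e = e -> (forall k, vp k e) \/ veq V 0 e.
Proof.
move=> ee; have Ve := (val_idem rV mV ee).1.
have [me|nme] := pselect (vmax V e).
  left => k; have [p [p' [pp mp pg]]] := unif; rewrite (vpE pp mp pg) /vge /mkset mulrC.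
  exact: (vmax_idem_mul vN rV mV).
by right; split; [apply/vp0|rewrite add0r => /vp1].
Qed.

Lemma valuation_veq q (k : int) : valuation V q = (k%:E)%E <-> veq V k q.
Proof.
rewrite /valuation; case: asboolP => [all|nall].
  by split=> // -[_ n]; exfalso; apply: n.
have xE m : veq V m q -> xget 0 [set k : int | vp k q /\ forall j, vp j q -> (j <= k)%R] = m.
  move=> vm; apply: xget_unique; first by split; [case: vm|move=> j; exact: veq_le].
  move=> j [hj maxj]; apply/eqP; rewrite eq_le (veq_le vm hj) maxj //; by case: vm.
split=> [|vk]; last by rewrite (xE _ vk).
by have [[m vm]|//] := vp_cases q; rewrite (xE _ vm) => -[<-].
Qed.

End OneValuation.

(* The inverse of [x] on its support. *)
Lemma quasi_inverse x : exists x', forall V k, valuation_rings R V -> veq V k x ->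
  veq V (- k) x' /\ forall j, val_power V j (1 - x * x').
Proof.
have [e [u [v [ee xe uv]]]] := vN x; exists (e * v) => V k vV vk.
have xx : x * (e * v) = e.
  rewrite xe; transitivity (e * e * (u * v)); first ring.
  by rewrite ee uv mulr1.
have xe' : x = e * x by rewrite {2}xe mulrA ee.
have ve : veq V 0 e.
  have [all|//] := vp_idem vV ee; exfalso; apply: vk.2.
  have [l hl] := vp_exists vV x; rewrite xe'; have := vpM vV (all (k + 1 - l)) hl.
  by have -> : k + 1 - l + l = k + 1 :> int by lia.
split.
  have [[j vj]|all] := vp_cases vV (e * v).
    have := veqM vV vk vj; rewrite xx => /(veq_uniq vV ve) h.
    by have -> : - k = j by lia.
  exfalso; apply: ve.2; rewrite -xx.
  have := vpM vV vk.1 (all (1 - k)); by have -> : k + (1 - k) = 0 + 1 :> int by lia.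
rewrite xx => j; have [|all|all] := vp_idem vV (e := 1 - e).
- by transitivity (1 - e - e + e * e); [ring|rewrite ee; ring].
- exact: all.
- have := veqM vV ve all; rewrite mulrBr mulr1 ee [e - e]subrr => -[_ h].
  by case: h; apply: vp_zero.
Qed.

End ValuationInterface.

(** * Approximation and finiteness *)

Section SeveralValuations.
Variables (R : comPzRingType) (y : R) (L : nat).
Hypotheses (nR : noetherian R) (nch : ~ prime_chain R 2) (rR : reduced R).
Hypotheses (Jy : jacobson R y) (ry : regular y) (cL : cs L (pri y) setT).
Local Notation Q := (total_ring R).
Local Notation t := (@to_total R).
Local Notation vp := val_power.

Let vN := total_vonNeumann nR rR.
Let vp1 := vp1 nR nch rR Jy ry cL.
Let vpM := vpM nR nch rR Jy ry cL.
Let vpD := vpD nR nch rR Jy ry cL.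
Let vpB := vpB nR nch rR Jy ry cL.
Let vp_zero := vp_zero nR nch rR Jy ry cL.
Let vp_le := vp_le nR nch rR Jy ry cL.
Let vpMr := vpMr nR nch rR Jy ry cL.
Let veqM := veqM nR nch rR Jy ry cL.
Let veq1 := veq1 nR nch rR Jy ry cL.
Let veq_uniq := veq_uniq nR nch rR Jy ry cL.
Let veq_le := veq_le nR nch rR Jy ry cL.
Let vp_exists := vp_exists nR nch rR Jy ry cL.
Let vp_cases := vp_cases nR nch rR Jy ry cL.
Let veq_unit := veq_unit nR nch rR Jy ry cL.
Let unif_pow := uniformizer_pow nR nch rR Jy ry cL.
Let qinv := quasi_inverse nR nch rR Jy ry cL.
Local Notation vals := (valuation_rings R).

Lemma vpX V n x (k : int) : vals V -> vp V k x -> vp V (n%:Z * k) (x ^+ n).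
Proof.
move=> vV hx; elim: n => [|n IH].
  by rewrite expr0 mul0r; exact: (veq1 vV).1.
rewrite exprS; have -> : n.+1%:Z * k = k + n%:Z * k by lia.
exact: vpM.
Qed.

Lemma veqX V n x (k : int) : vals V -> veq V k x -> veq V (n%:Z * k) (x ^+ n).
Proof.
move=> vV hx; elim: n => [|n IH].
  by rewrite expr0 mul0r; exact: veq1.
rewrite exprS; have -> : n.+1%:Z * k = k + n%:Z * k by lia.
exact: veqM.
Qed.

Lemma veqD V k x z : vals V -> veq V k x -> vp V (k + 1) z -> veq V k (x + z).
Proof.
move=> vV [hx nx] hz; split; first by apply: vpD => //; apply: vp_le hz => //; lia.
by move=> h; apply: nx; rewrite -(addrK z x); apply: vpB.
Qed.

(** A unit of [Q] in [V'] outside [V] has negative value at [V], so the powers of its inverse carry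
    any element of [Q] into [V], and [V'] would be all of [Q]. *)
Lemma vals_incomparable V V' : vals V -> vals V' -> V `<=` V' -> V = V'.
Proof.
move=> vV vV' sV; apply: contrapT => neq.
have [rV _ _ mV] := vV; have [rV' _ nT' _] := vV'.
have [x V'x nVx] : exists2 x, V' x & ~ V x.
  apply: contrapT => H; apply: neq; apply/seteqP; split=> // x V'x.
  by apply: contrapT => nVx; apply: H; exists x.
have [e [u [w [ee xe uw eu]]]] := unit_part vN x.
have Ve := val_idem rV mV ee.
have V'u : V' u by rewrite eu; apply: ringD => //; apply: sV; exact: Ve.2.
have nVu : ~ V u by move=> Vu; apply: nVx; rewrite xe; apply: ringM => //; exact: Ve.1.
have [j vj] := veq_unit vV uw.
have j0 : (j < 0)%R.
  rewrite ltNge; apply/negP => h; apply: nVu; exact: (vp_le vV h vj.1).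
have wu : w * u = 1 by rewrite mulrC.
have [i vi] := veq_unit vV wu.
have ij : i = - j.
  by have := veqM vV vi vj; rewrite wu => /(veq_uniq vV (veq1 vV)); lia.
apply: nT'; apply/seteqP; split=> // q _; have [k hk] := vp_exists vV q.
have -> : q = (q * w ^+ `|k|%N) * u ^+ `|k|%N by rewrite -mulrA -exprMn wu expr1n mulr1.
apply: ringM => //; last exact: ringX.
suff h : vp V 0 (q * w ^+ `|k|%N) by exact: sV _ h.
by apply: (vp_le vV _ (vpM vV hk (vpX `|k|%N vV vi.1))); nia.
Qed.

(** Incomparability gives units [u] and [u'] for the two orders of [V] and [V']; their quotient
    [u' / u] has the required signs. *)
Lemma vals_separate V V' : vals V -> vals V' -> V' <> V -> exists z j k,
  [/\ veq V j z, veq V' k z, (j < 0)%R & (0 < k)%R].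
Proof.
have sep W W' : vals W -> vals W' -> W' <> W -> exists u w j k,
    [/\ u * w = 1, veq W j u, veq W' k u, (0 <= j)%R & (k < 0)%R].
  move=> vW vW' neq; have [rW _ _ mW] := vW; have [rW' _ _ mW'] := vW'.
  have [x Wx nW'x] : exists2 x, W x & ~ W' x.
    apply: contrapT => H; apply: neq; symmetry; apply: vals_incomparable => // x Wx.
    by apply: contrapT => nx; apply: H; exists x.
  have [e [u [w [ee xe uw eu]]]] := unit_part vN x.
  have [j vj] := veq_unit vW uw; have [k vk] := veq_unit vW' uw.
  exists u, w, j, k; split=> //.
    apply: (veq_le vW vj); rewrite eu; apply: (ringD rW) => //.
    exact: (val_idem rW mW ee).2.
  rewrite ltNge; apply/negP => h; apply: nW'x; rewrite xe; apply: ringM => //.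
    exact: (val_idem rW' mW' ee).1.
  exact: (vp_le vW' h vk.1).
move=> vV vV' neq.
have [u [w [j [k [uw vj vk j0 k0]]]]] := sep V V' vV vV' neq.
have [u' [w' [j' [k' [uw' vj' vk' j0' k0']]]]] := sep V' V vV' vV (nesym neq).
have wu : w * u = 1 by rewrite mulrC.
have inv W (l : int) : vals W -> veq W l u -> veq W (- l) w.
  move=> vW vl; have [i vi] := veq_unit vW wu.
  have := veqM vW vi vl; rewrite wu => /(veq_uniq vW (veq1 vW)) h.
  by have -> : - l = i by lia.
exists (u' * w), (k' - j), (j' - k); split; [| |lia|lia].
  by apply: veqM => //; exact: inv.
by apply: veqM => //; exact: inv.
Qed.

Lemma vp_uniform (s : seq (set Q)) q : (forall V, V \in s -> vals V) ->
  exists n : nat, forall V, V \in s -> vp V (- n%:Z) q.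
Proof.
elim: s => [|V s IH] Hs; first by exists 0%N.
have [n Hn] := IH (fun W Ws => Hs W (mem_behead (s := V :: s) Ws)).
have vV := Hs V (mem_head _ _); have [k hk] := vp_exists vV q.
exists (n + `|k|)%N => W; rewrite inE => /orP[/eqP->|Ws].
  by apply: (vp_le vV _ hk); lia.
by apply: (vp_le _ _ (Hn W Ws)); [apply: Hs; rewrite inE Ws orbT|lia].
Qed.

(** As in the Artin-Whaples theorem, with [x] separating [V] from the new [V']: for large [n],
    [z^n x] works if [z] has no pole at [V'], and otherwise [x z^n / (1 + z^n)], whose last factor
    has value zero at the poles of [z]. The exponent exceeds the pole orders of [x] on [s]. *)
Lemma weak_approx_neg V (s : seq (set Q)) : vals V ->
  (forall V', V' \in s -> vals V' /\ V' <> V) ->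
  exists z, (exists2 j, veq V j z & (j < 0)%R) /\ forall V', V' \in s -> vp V' 1 z.
Proof.
move=> vV; elim: s => [|V' s IH] Hs.
  by have [u [v [_ vu]]] := unif_pow vV (- 1); exists u; split=> //; exists (- 1).
have [z [[jz vz jz0] Hz]] := IH (fun W Ws => Hs W (mem_behead (s := V' :: s) Ws)).
have [vV' neq] := Hs V' (mem_head _ _).
have Hs' W : W \in s -> vals W by move=> Ws; apply: (Hs W _).1; rewrite inE Ws orbT.
have [x [j [k [vj vk j0 k0]]]] := vals_separate vV vV' neq.
have [n Hn] := vp_uniform x Hs'.
have [h0|nh0] := pselect (vp V' 0 z).
  exists (z ^+ n.+1 * x); split.
    exists (n.+1%:Z * jz + j); last by nia.
    by apply: veqM => //; exact: veqX.
  move=> W; rewrite inE => /orP[/eqP->|Ws].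
    have := vpM vV' (vpX n.+1 vV' h0) vk.1; apply: vp_le => //; lia.
  have vW := Hs' W Ws.
  have := vpM vW (vpX n.+1 vW (Hz W Ws)) (Hn W Ws); apply: vp_le => //; lia.
have [[l vl]|all] := vp_cases vV' z; last by exfalso; exact: nh0.
have l0 : (l < 0)%R by rewrite ltNge; apply/negP => h; apply: nh0; exact: vp_le h vl.1.
have [x' Hx'] := qinv (1 + z ^+ n.+1).
exists (x * z ^+ n.+1 * x'); split.
  have v1z : veq V (n.+1%:Z * jz) (1 + z ^+ n.+1).
    rewrite addrC; apply: veqD => //; first exact: veqX.
    apply: vp_le (veq1 vV).1 => //; nia.
  exists j => //.
  have := veqM vV (veqM vV vj (veqX n.+1 vV vz)) (Hx' V _ vV v1z).1.
  by rewrite addrK.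
move=> W; rewrite inE => /orP[/eqP->|Ws].
  have v1z : veq V' (n.+1%:Z * l) (1 + z ^+ n.+1).
    rewrite addrC; apply: veqD => //; first exact: veqX.
    apply: vp_le (veq1 vV').1 => //; nia.
  have := veqM vV' (veqM vV' vk (veqX n.+1 vV' vl)) (Hx' V' _ vV' v1z).1.
  rewrite addrK => -[h _]; apply: vp_le h => //; lia.
have vW := Hs' W Ws.
have v1z : veq W 0 (1 + z ^+ n.+1).
  apply: veqD => //; first exact: veq1.
  have := vpX n.+1 vW (Hz W Ws); apply: vp_le => //; lia.
have := vpM vW (vpM vW (Hn W Ws) (vpX n.+1 vW (Hz W Ws))) (Hx' W _ vW v1z).1.1.
apply: vp_le => //; lia.
Qed.

(** [z / (1 + z)] is close to [1] at a pole of [z] and small where [z] is small. *)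
Lemma weak_approx V (s : seq (set Q)) : vals V ->
  (forall V', V' \in s -> vals V' /\ V' <> V) ->
  exists w, vp V 1 (1 - w) /\ forall V', V' \in s -> vp V' 1 w.
Proof.
move=> vV Hs; have [z [[j vj j0] Hz]] := weak_approx_neg vV Hs.
have [x' Hx'] := qinv (1 + z); exists (z * x').
have v1z : veq V j (1 + z).
  by rewrite addrC; apply: veqD => //; apply: vp_le (veq1 vV).1 => //; lia.
have [vx' allx] := Hx' V j vV v1z; split.
  have -> : 1 - z * x' = (1 - (1 + z) * x') + x' by ring.
  by apply: vpD => //; apply: vp_le vx'.1 => //; lia.
move=> W Ws; have vW := (Hs W Ws).1.
have v1 : veq W 0 (1 + z) by apply: veqD; [|exact: veq1|exact: Hz].
by have := vpM vW (Hz W Ws) (Hx' W 0 vW v1).1.1; apply: vp_le => //; lia.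
Qed.

Local Notation I := (value_index R).

Lemma valsI (i : I) : vals (\val i).
Proof. by case: i => V /= /set_mem. Qed.

Lemma approx_family (s : seq I) : uniq s -> exists w : I -> Q, forall i, i \in s ->
  vp (\val i) 1 (1 - w i) /\ forall j, j \in s -> j != i -> vp (\val j) 1 (w i).
Proof.
move=> us; suff /choice[w Hw] : forall i : I, exists w : Q, i \in s ->
    vp (\val i) 1 (1 - w) /\ forall j, j \in s -> j != i -> vp (\val j) 1 w.
  by exists w => i; exact: Hw.
move=> i.
have [|w [h1 h2]] := @weak_approx (\val i) [seq \val j | j <- s & j != i] (valsI i).
  move=> V' /mapP[j]; rewrite mem_filter => /andP[ji _] ->; split; first exact: valsI.
  by move=> /val_inj e; rewrite e eqxx in ji.
exists w => _; split=> // j js ji; apply: h2; apply: map_f.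
by rewrite mem_filter ji.
Qed.

(* The elements [w i] of [approx_family] and [1] generate a module [E] filtered
   by the conditions of having positive value. *)
Lemma index_bound (s : seq I) : uniq s -> (size s <= L)%N.
Proof.
move=> us; have [w Hw] := approx_family us.
have [e|[i0 _]] : s = [::] \/ exists i, i \in s.
- by case: (s) => [|i s']; [left|right; exists i; rewrite mem_head].
- by rewrite e.
pose m := size s; pose u k := if (k < m)%N then w (nth i0 s k) else 1.
have nths k : (k < m)%N -> nth i0 s k \in s by exact: mem_nth.
have vals0 i k : i \in s -> vp (\val i) 0 (u k).
  rewrite /u => si; case: ifP => km; last exact: (veq1 (valsI i)).1.
  have [h1 h2] := Hw _ (nths k km); have [->|ne] := eqVneq i (nth i0 s k).
    have -> : w (nth i0 s k) = 1 - (1 - w (nth i0 s k)) by ring.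
    apply: vpB; [exact: valsI|exact: (veq1 (valsI _)).1|].
    by apply: vp_le h1; [exact: valsI|].
  by apply: vp_le (h2 i si ne); [exact: valsI|].
pose E := rspan u m.+1.
have sE := submodule_rspan u m.+1.
have [k dE] := rspan_den nR nch Jy u m.+1.
have E0 i x : i \in s -> E x -> vp (\val i) 0 x.
  move=> si; apply: rspan_in; last by move=> j _; exact: vals0.
  apply: mk_sub; first exact: vp_zero (valsI i) _.
    by move=> a b; apply: vpD; exact: valsI.
  by move=> a b; apply: vpMr; exact: valsI.
have y1 V : vals V -> vp V 1 (t y).
  by move=> vV; apply/vp1 => //; have := Jy (vmax_contract nR nch rR vV).
pose H k := [set x | E x /\ forall l, (k <= l < m)%N -> vp (\val (nth i0 s l)) 1 x].
apply: (@submodule_chain R y L nR nch ry cL E H m (y ^+ k) 1) => //.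
- exact: (regularX (n := k) ry).
- by move=> x; rewrite mul1r.
- by rewrite to_total1; have := rspan_mem u (ltnSn m); rewrite /u ltnn.
- move=> j _; apply: mk_sub.
  + by split; [exact: sub0|move=> l _; exact: vp_zero (valsI _) _].
  + move=> a b [Ea ha] [Eb hb]; split; first exact: subD.
    by move=> l lj; apply: vpD; [exact: valsI|exact: ha|exact: hb].
  + move=> a b [Eb hb]; split; first exact: subM.
    by move=> l lj; apply: vpMr; [exact: valsI|exact: hb].
- move=> j jm; split.
    move=> x [Ex hx]; split=> // l /andP[jl lm]; apply: hx; rewrite lm andbT; lia.
  have [h1 h2] := Hw _ (nths j jm).
  have uj : u j = w (nth i0 s j) by rewrite /u jm.
  exists (u j).
    split; first by apply: rspan_mem; lia.
    move=> l /andP[jl lm]; rewrite uj; apply: h2; first exact: nths.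
    by rewrite nth_uniq //; lia.
  move=> [_ /(_ j)]; rewrite leqnn jm => /(_ isT); rewrite uj => h.
  apply: (veq1 (valsI (nth i0 s j))).2; rewrite add0r.
  have -> : 1 = (1 - w (nth i0 s j)) + w (nth i0 s j) by ring.
  by apply: vpD; first exact: valsI.
- move=> x Ex; split; first exact: subM.
  move=> l /andP[_ lm]; have vl := valsI (nth i0 s l).
  have := vpM vl (y1 _ vl) (E0 _ x (nths l lm) Ex); by rewrite addr0.
- by move=> x [].
Qed.

Lemma index_finite : exists s : seq I, uniq s /\ forall i, i \in s.
Proof.
pose P n := `[< exists2 s : seq I, uniq s & size s = n >].
have [|n|n /asboolP[s us sn] nmax] := @ex_maxnP P L.
- by exists 0%N; apply/asboolP; exists [::].
- by move=> /asboolP[s us <-]; exact: index_bound.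
exists s; split=> // i; apply/negPn/negP => ni.
have := nmax n.+1 (introT (asboolP _) (ex_intro2 _ _ (i :: s) _ _)).
rewrite ltnn => H; have : false; last by [].
by apply: H; rewrite /= ?ni ?sn.
Qed.

End SeveralValuations.

(** * Values of fractional ideals *)

Section ValueFiltration.
Variables (R : comPzRingType) (y : R) (L : nat).
Hypotheses (nR : noetherian R) (nch : ~ prime_chain R 2) (rR : reduced R).
Hypotheses (Jy : jacobson R y) (ry : regular y) (cL : cs L (pri y) setT).
Local Notation Q := (total_ring R).
Local Notation t := (@to_total R).
Local Notation vp := val_power.
Local Notation I := (value_index R).
Local Notation B := (base_ring R).

Let vN := total_vonNeumann nR rR.
Let vpM := vpM nR nch rR Jy ry cL.
Let vpD := vpD nR nch rR Jy ry cL.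
Let vpN := vpN nR nch rR Jy ry cL.
Let vpB := vpB nR nch rR Jy ry cL.
Let vp_zero := vp_zero nR nch rR Jy ry cL.
Let vp_le := vp_le nR nch rR Jy ry cL.
Let vp_base := vp_base nR nch rR Jy ry cL.
Let vpMr := vpMr nR nch rR Jy ry cL.
Let veqM := veqM nR nch rR Jy ry cL.
Let veq1 := veq1 nR nch rR Jy ry cL.
Let veq_le := veq_le nR nch rR Jy ry cL.
Let vp_exists := vp_exists nR nch rR Jy ry cL.
Let veq_unit := veq_unit nR nch rR Jy ry cL.
Let veqD := veqD nR nch rR Jy ry cL.
Let vpX := vpX nR nch rR Jy ry cL.
Let vI (i : I) : valuation_rings R (\val i) := valsI i.

Hypothesis ar : analytically_reduced R.

Lemma closure_vp x : integral_closure R x <-> forall i : I, vp (\val i) 0 x.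
Proof.
rewrite integral_closure_vals; split=> [H i|H V vV]; first by apply: H; exact: vI.
exact: H (SigSub (mem_set vV) : I).
Qed.

(** Each [f / y^k] is integral, so a fixed [y ^+ N] carries it into [R]; thus [y^N f] is divisible
    by all powers of [y] and vanishes by [separated]. *)
Lemma idem_vanish f : f * f = f -> (forall i : I, forall k, vp (\val i) k f) -> f = 0.
Proof.
move=> ff Hf; have [N HN] := conductor_exists nR nch Jy ry cL ar.
have yi k := tinvP (regularX (n := k) ry).
have fk k : exists r, t (y ^+ N) * (tinv (y ^+ k) * f) = t r.
  apply: HN; apply/closure_vp => i.
  have [l hl] := vp_exists (vI i) (tinv (y ^+ k)).
  by have := vpM (vI i) hl (Hf i (- l)); rewrite subrr.
have [r0 e0] := fk 0%N.
have e0' : t (y ^+ N) * f = t r0.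
  rewrite -e0; congr (_ * _); rewrite -[LHS]mul1r -(yi 0%N) expr0 to_total1 mul1r.
  by [].
have r00 : r0 = 0.
  apply: (separated nR ry Jy) => k; have [r er] := fk k; exists r.
  apply: to_total_inj; rewrite to_totalM -er -e0'.
  transitivity (t (y ^+ N) * f * (t (y ^+ k) * tinv (y ^+ k))); last ring.
  by rewrite yi mulr1.
apply: (regular_total (regularX (n := N) ry)).
by rewrite e0' r00 to_total0.
Qed.

(** The idempotent [1 - e] kills [x], which has finite values, so it has infinite value everywhere
    and vanishes. *)
Lemma veq_regular x : (forall i : I, exists k, veq (\val i) k x) -> regular x.
Proof.
move=> Hx; have [e [u [v [ee xe uv]]]] := vN x.
have f0 : 1 - e = 0.
  apply: idem_vanish => [|i k].
    by transitivity (1 - e - e + e * e); [ring|rewrite ee; ring].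
  have [l vl] := Hx i.
  have := vp_idem nR nch rR Jy ry cL (vI i) (e := 1 - e).
  case=> [|//|vf].
    by transitivity (1 - e - e + e * e); [ring|rewrite ee; ring].
  have := veqM (vI i) vf vl; rewrite xe mulrA mulrBl mul1r ee subrr mul0r => -[_ h].
  by case: h; exact: vp_zero (vI i) _.
have e1 : e = 1 by rewrite -[e](subKr 1) f0 subr0.
by rewrite xe e1 mul1r; apply: unit_regular uv.
Qed.

Lemma value_setP E (a : I -> int) :
  value_set E a <-> exists2 x, E x & forall i : I, veq (\val i) (a i) x.
Proof.
have vE := valuation_veq nR nch rR Jy ry cL.
split=> [[x [Ex rx] Hx]|[x Ex Hx]].
  by exists x => // i; apply/vE; [exact: vI|exact: Hx].
exists x; last by move=> i; apply/vE; [exact: vI|exact: Hx].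
by split=> //; apply: veq_regular => i; exists (a i).
Qed.

Definition Wf (a : I -> int) : set Q := [set x | forall i : I, vp (\val i) (a i) x].

Lemma submodule_Wf a : submodule B (Wf a).
Proof.
apply: mk_sub; first by move=> i; exact: vp_zero (vI i) _.
- by move=> x z hx hz i; apply: vpD; [exact: vI|exact: hx|exact: hz].
- by move=> r x hx i; apply: vpMr; [exact: vI|exact: hx].
Qed.

Lemma Wf_le a b : (forall i, (a i <= b i)%R) -> Wf b `<=` Wf a.
Proof. by move=> ab x hx i; apply: vp_le (hx i); [exact: vI|exact: ab]. Qed.

Lemma WfM a b x z : Wf a x -> Wf b z -> Wf (fun i => a i + b i) (x * z).
Proof. by move=> hx hz i; apply: vpM; [exact: vI|exact: hx|exact: hz]. Qed.

Definition fin_index := index_finite nR nch rR Jy ry cL.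

Lemma uniform_I q : exists n : nat, forall i : I, vp (\val i) (- n%:Z) q.
Proof.
have [s [us sI]] := fin_index.
have [|n Hn] := vp_uniform nR nch rR Jy ry cL (s := [seq \val i | i <- s]) q.
  by move=> V /mapP[i _ ->]; exact: vI.
by exists n => i; apply: Hn; apply: map_f.
Qed.

Lemma approx_I : exists w : I -> Q, forall i : I,
  vp (\val i) 1 (1 - w i) /\ forall j : I, j != i -> vp (\val j) 1 (w i).
Proof.
have [s [us sI]] := fin_index.
have [w Hw] := approx_family nR nch rR Jy ry cL us.
exists w => i; have [h1 h2] := Hw i (sI i); split=> // j; exact: h2.
Qed.

Lemma vp_pow1 V n w : valuation_rings R V -> vp V 1 (1 - w) -> vp V 1 (1 - w ^+ n).
Proof.
move=> vV h; elim: n => [|n IH]; first by rewrite expr0 subrr; exact: vp_zero.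
have -> : 1 - w ^+ n.+1 = (1 - w) + w * (1 - w ^+ n) by rewrite exprS; ring.
apply: vpD => //; have := vpM vV (_ : vp V 0 w) IH; rewrite add0r; apply.
have -> : w = 1 - (1 - w) by ring.
by apply: vpB => //; [exact: (veq1 vV).1|apply: vp_le h].
Qed.

(** Add up [w i ^+ n * u i], where [u i] has value [a i] at [i]. For large [n] this summand keeps
    that value at [i] and has value greater than [a j] at every other [j]. *)
Lemma exact_value (a : I -> int) : exists x, forall i : I, veq (\val i) (a i) x.
Proof.
have [s [us sI]] := fin_index; have [w Hw] := approx_I.
have /choice[u Hu] : forall i : I, exists u, veq (\val i) (a i) u.
  by move=> i; have [u [v [_ h]]] := uniformizer_pow nR nch rR Jy ry cL (vI i) (a i); exists u.
(* The sum dominates the terms at [i] and [j] together: it has to exceed a pole order of [u i] plus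
   the target [a j]. *)
have [n Hn] : exists n : nat, forall i j : I, (a j + 1 - n%:Z <= 0)%R /\ vp (\val j) (a j + 1 - n%:Z) (u i).
  have /choice[n Hn] : forall i : I, exists n : nat, forall j : I, vp (\val j) (- n%:Z) (u i).
    by move=> i; exact: uniform_I.
  exists (\sum_(i <- s) (n i + `|a i| + 1))%N => i j.
  have b k : ((n k + `|a k| + 1)%N <= (\sum_(i <- s) (n i + `|a i| + 1))%N)%N.
    by rewrite (bigD1_seq k) //= leq_addr.
  have bi := b i; have bj := b j; have [->|ne] := eqVneq i j.
    split; first by lia.
    by apply: vp_le (Hn j j); [exact: vI|lia].
  have b2 : ((n i + `|a i| + 1) + (n j + `|a j| + 1) <= (\sum_(i <- s) (n i + `|a i| + 1))%N)%N.
    by rewrite (bigD1_seq i) //= leq_add2l (big_rem j) //= eq_sym ne leq_addr.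
  split; first by lia.
  by apply: vp_le (Hn i j); [exact: vI|lia].
exists (\sum_(i <- s) w i ^+ n * u i) => i.
rewrite (bigD1_seq i) //=; apply: veqD (vI i) _ _.
  have [h1 _] := Hw i; have -> : w i ^+ n * u i = u i + - ((1 - w i ^+ n) * u i) by ring.
  apply: veqD (vI i) (Hu i) _; apply: vpN; first exact: vI.
  by have := vpM (vI i) (vp_pow1 n (vI i) h1) (Hu i).1; rewrite [1 + a i]addrC.
apply: (big_ind (vp (\val i) (a i + 1))).
- exact: vp_zero (vI i) _.
- by move=> x z; apply: vpD; exact: vI.
- move=> j ji; have [_ h2] := Hw j; have [_ hu] := Hn j i.
  have := vpM (vI i) (vpX n (vI i) (h2 i _)) hu; rewrite eq_sym => /(_ ji).
  by apply: vp_le; [exact: vI|lia].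
Qed.

(** Multiplying [x] by a high power of [w i] removes its poles at the other indices and does not
    change its residue at [i]. *)
Lemma closure_approx (i : I) x : vp (\val i) 0 x ->
  exists2 b, integral_closure R b & vp (\val i) 1 (b - x).
Proof.
move=> hx; have [w Hw] := approx_I; have [h1 h2] := Hw i.
have [n Hn] := uniform_I x; exists (w i ^+ n * x).
  apply/closure_vp => j; have [->|ji] := eqVneq j i; last first.
    have := vpM (vI j) (vpX n (vI j) (h2 j ji)) (Hn j); apply: vp_le; [exact: vI|lia].
  have -> : w i ^+ n * x = x - (1 - w i ^+ n) * x by ring.
  apply: vpB => //; have := vpM (vI i) (vp_pow1 n (vI i) h1) hx.
  by apply: vp_le; [exact: vI|].
have -> : w i ^+ n * x - x = - ((1 - w i ^+ n) * x) by ring.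
apply: vpN; first exact: vI.
by have := vpM (vI i) (vp_pow1 n (vI i) h1) hx.
Qed.

Hypothesis rat : residually_rational R.

(** Residual rationality speaks of maximal ideals of the integral closure. The center [n] of the
    valuation is one: an element outside [n] is inverted modulo [n] by approximating its inverse in
    the closure. The same approximation replaces [x] by an integral element. *)
Lemma residue_unit (i : I) x : vp (\val i) 0 x -> exists r, vp (\val i) 1 (x - t r).
Proof.
move=> hx; pose n := integral_closure R `&` [set x | vp (\val i) 1 x].
have rC := subring_integral_closure R.
have cl0 b : integral_closure R b -> vp (\val i) 0 b by move=> /closure_vp.
have mx : maximal_ideal (integral_closure R) n.
  split.
  - split; last by move=> b [].
    split; first by split; [exact: ring0|exact: vp_zero (vI i) _].
      by move=> a b [ca va] [cb vb]; split; [exact: ringD|apply: vpD => //; exact: vI].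
    move=> a b ca [cb vb]; split; first exact: ringM.
    by have := vpM (vI i) (cl0 _ ca) vb; rewrite add0r.
  - move=> e; have : n 1 by rewrite e; exact: ring1.
    by move=> [_ h]; apply: (veq1 (vI i)).2; rewrite add0r.
  - move=> J [[J0 JD JM] JC] nJ; have [Jn|nJn] := pselect (J `<=` n).
      by left; apply/seteqP.
    have [c Jc nc] : exists2 c, J c & ~ n c.
      apply: contrapT => H; apply: nJn => c Jc; apply: contrapT => nc; apply: H.
      by exists c.
    have vc : veq (\val i) 0 c.
      split; first exact/cl0/JC.
      by rewrite add0r => h; apply: nc; split=> //; exact: JC.
    have [c' Hc'] := quasi_inverse nR nch rR Jy ry cL c.
    have [vc' allc] := Hc' _ _ (vI i) vc; rewrite oppr0 in vc'.
    have [d Cd vd] := closure_approx vc'.1.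
    have J1 : J 1.
      have -> : 1 = (1 - c * d) + d * c by ring.
      apply: JD; last exact: JM.
      apply: nJ; split.
        exact: (ringB rC (ring1 rC) (ringM rC (JC _ Jc) Cd)).
      have -> : 1 - c * d = (1 - c * c') - c * (d - c') by ring.
      apply: vpB; [exact: vI|exact: allc|].
      by have := vpM (vI i) vc.1 vd; rewrite add0r.
    right; apply/seteqP; split=> // b Cb; rewrite -[b]mulr1; exact: JM.
have [b Cb vb] := closure_approx hx.
have [r [_ hr]] := rat mx Cb; exists r.
have -> : x - t r = (b - t r) - (b - x) by ring.
by apply: vpB; first exact: vI.
Qed.

Lemma residue_mul (i : I) k x z : vp (\val i) k x -> veq (\val i) k z ->
  exists r, vp (\val i) (k + 1) (x - t r * z).
Proof.
move=> hx hz; have [z' Hz'] := quasi_inverse nR nch rR Jy ry cL z.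
have [vz' allz] := Hz' _ _ (vI i) hz.
have xz : vp (\val i) 0 (x * z') by have := vpM (vI i) hx vz'.1; rewrite subrr.
have [r hr] := residue_unit xz; exists r.
have -> : x - t r * z = (x * z' - t r) * z + x * (1 - z * z') by ring.
apply: vpD; first exact: vI.
  by have := vpM (vI i) hr hz.1; rewrite [1 + k]addrC.
exact: (vpM (vI i) hx (allz 1)).
Qed.

(* By [generic_value], the values of [E] are the vectors at which it jumps in
   every direction. *)
Definition jump (E : set Q) (b : I -> int) (i : I) :=
  exists x, [/\ E x, Wf b x & veq (\val i) (b i) x].

(* Descent along the finitely many coordinates in which [b] is below [d]. *)
Lemma Wf_descent (E F : set Q) (b0 d : I -> int) : submodule B E -> submodule B F ->
  E `<=` F -> F `&` Wf d `<=` E ->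
  (forall b, (forall i, (b0 i <= b i)%R) -> forall i, jump F b i -> jump E b i) ->
  F `&` Wf b0 `<=` E.
Proof.
move=> sE sF EF dE H; have [s [us sI]] := fin_index.
have main m : forall b, (forall i, (b0 i <= b i)%R) ->
    (\sum_(i <- s) absz (Num.max 0%R (d i - b i)%R) <= m)%N -> F `&` Wf b `<=` E.
  elim: m => [|m IH] b b0b hm.
    apply: subset_trans dE; apply: setIS; apply: Wf_le => i.
    move: hm; rewrite (bigD1_seq i) //= leqn0 addn_eq0 => /andP[]; lia.
  have [db|/existsNP[i /negP]] := pselect (forall i, (d i <= b i)%R).
    by apply: subset_trans dE; apply: setIS; exact: Wf_le.
  rewrite -ltNge => bd x [Fx hx]; pose b' j := if j == i then b i + 1 else b j.
  have step x' : F x' -> Wf b x' -> vp (\val i) (b i + 1) x' -> E x'.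
    move=> Fx' hx' hi; apply: (IH b').
    - by move=> j; rewrite /b'; case: eqP => [->|_]; have := b0b j; have := b0b i; lia.
    - move: hm; rewrite !(bigD1_seq i) //= {1}/b' eqxx.
      have -> : (\sum_(j <- s | j != i) absz (Num.max 0%R (d j - b' j)%R) =
                \sum_(j <- s | j != i) absz (Num.max 0%R (d j - b j)%R))%N.
        by apply: eq_bigr => j ji; rewrite /b' (negbTE ji).
      move: (\sum_(j <- s | j != i) _)%N => S; lia.
    - by split=> // j; rewrite /b'; case: eqP => [->//|_]; exact: hx'.
  have [hi|nhi] := pselect (vp (\val i) (b i + 1) x); first exact: step.
  have [|z [Ez Wz vz]] := H b b0b i; first by exists x; split=> //; split=> //; exact: hx.
  have [r hr] := residue_mul (hx i) vz.
  rewrite -[x](subrK (t r * z)); apply: (subD sE); last exact: subM.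
  apply: step => //; first by apply: (subB sF) => //; apply: (subM sF); exact: EF.
  by apply: (subB (submodule_Wf b)) => //; exact: (subM (submodule_Wf b)).
by apply: (main _ b0 _ (leqnn _)).
Qed.

Lemma Wf_fill (E : set Q) (b0 d : I -> int) : submodule B E -> Wf d `<=` E ->
  (forall b, (forall i, (b0 i <= b i)%R) -> forall i, jump E b i) -> Wf b0 `<=` E.
Proof.
move=> sE dE H x Wx.
apply: (@Wf_descent E setT b0 d sE (mk_sub _ _ _) (@subsetT _ E) _ _ x (conj Logic.I Wx)) => //.
- by move=> z [_ h]; exact: dE.
- by move=> b b0b i _; exact: H.
Qed.

Lemma Wf_base : exists d, Wf d `<=` B.
Proof.
have [N HN] := conductor_exists nR nch Jy ry cL ar.
have yN := tinvP (regularX (n := N) ry).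
have /choice[d Hd] : forall i : I, exists k, veq (\val i) k (tinv (y ^+ N)).
  by move=> i; apply: (veq_unit (vI i) (v := t (y ^+ N))); rewrite mulrC.
exists (fun i => - d i) => x hx.
have [|r er] := HN (tinv (y ^+ N) * x).
  apply/closure_vp => i; have := vpM (vI i) (Hd i).1 (hx i); by rewrite subrr.
by exists r => //; rewrite -er mulrA yN mul1r.
Qed.

Local Notation G := (value_set B).

(** If all vectors above [a] are values of [R], then [R] jumps at each of them in every direction,
    and [Wf_fill] recovers the elements. *)
Lemma conductor_setE a : conductor_set G a <-> Wf a `<=` B.
Proof.
split=> [H|H n].
  have [d dB] := Wf_base; apply: (Wf_fill _ dB).
    by apply: mk_sub; [exists 0|move=> _ _ [u _ <-] [v _ <-]; exists (u + v) => //; exact: to_totalD|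
      move=> r _ [u _ <-]; exists (r * u) => //; exact: to_totalM].
  move=> b ab i; have /value_setP[z Bz vz] := H (fun i => `|b i - a i|%N).
  have vz' j : veq (\val j) (b j) z.
    by have := vz j; have -> : a j + `|b j - a j|%N%:Z = b j by have := ab j; lia.
  by exists z; split=> // j; exact: (vz' j).1.
have [x vx] := exact_value (fun i => a i + (n i)%:Z).
apply/value_setP; exists x => //; apply: H => i.
by apply: vp_le (vx i).1; [exact: vI|lia].
Qed.

Lemma submodule_base : submodule B B.
Proof.
by apply: mk_sub; [exists 0|move=> _ _ [u _ <-] [v _ <-]; exists (u + v) => //; exact: to_totalD|
  move=> r _ [u _ <-]; exists (r * u) => //; exact: to_totalM].
Qed.

(** A jump prescribes the value in one direction only. If [a i <= c i], an element with exact values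
    the maximum of [a] and [c] lies in [Wf a] and realizes the jump at [c] in the direction [i];
    likewise for [b]. *)
Lemma conductor_min a b : Wf a `<=` B -> Wf b `<=` B ->
  Wf (fun i => Num.min (a i) (b i)) `<=` B.
Proof.
move=> aB bB; apply: (Wf_fill submodule_base aB) => c hc i.
have pick (a' : I -> int) : Wf a' `<=` B -> (a' i <= c i)%R ->
    exists z, [/\ B z, Wf c z & veq (\val i) (c i) z].
  move=> aB' ac; have [z vz] := exact_value (fun j => Num.max (a' j) (c j)).
  exists z; split.
  - by apply: aB' => j; apply: vp_le (vz j).1; [exact: vI|lia].
  - by move=> j; apply: vp_le (vz j).1; [exact: vI|lia].
  - by have := vz i; have -> : Num.max (a' i) (c i) = c i by lia.
have [ac|ca] := leP (a i) (c i); first exact: (pick a).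
by apply: (pick b) => //; have := hc i; lia.
Qed.

(** Values of [R] are nonnegative, so each coordinate has a least possible entry; [conductor_min]
    merges the finitely many minimizing vectors into one. Hence the default value in [conductor] is
    not reached. *)
Lemma conductorP : let g := conductor G in
  Wf g `<=` B /\ forall a, Wf a `<=` B -> forall i, (g i <= a i)%R.
Proof.
suff : exists g, conductor_set G g /\ forall a, conductor_set G a -> forall i, (g i <= a i)%R.
  move=> /(xgetPex (fun=> 0)); rewrite -/(conductor G) => -[h1 h2] /=.
  by split; [exact/conductor_setE|move=> a /conductor_setE; exact: h2].
have [s [us sI]] := fin_index; have [d dB] := Wf_base.
have nneg a : Wf a `<=` B -> forall i, (0 <= a i)%R.
  move=> aB i; have [x vx] := exact_value a.
  apply: (veq_le (vI i) (vx i)); have [r _ <-] : B x by apply: aB => j; exact: (vx j).1.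
  exact: vp_base (vI i) _.
have minP i : exists2 a, Wf a `<=` B & forall a', Wf a' `<=` B -> (a i <= a' i)%R.
  have : exists n : nat, `[< exists2 a, Wf a `<=` B & a i = n%:Z >].
    by exists `|d i|%N; apply/asboolP; exists d => //; have := nneg _ dB i; lia.
  move=> /ex_minnP[n /asboolP[a aB an] nmin]; exists a => // a' aB'.
  have := nmin `|a' i|%N (introT (asboolP _) (ex_intro2 _ _ a' aB' _)).
  have := nneg _ aB' i; rewrite an => h0 H; have := H _; lia.
have lst (l : seq I) : exists2 b, Wf b `<=` B &
    forall i, i \in l -> forall a', Wf a' `<=` B -> (b i <= a' i)%R.
  elim: l => [|i l [b bB Hb]]; first by exists d.
  have [a aB Ha] := minP i; exists (fun j => Num.min (a j) (b j)); first exact: conductor_min.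
  move=> j; rewrite inE => /orP[/eqP->|jl] a' aB'.
    by have := Ha a' aB'; lia.
  by have := Hb j jl a' aB'; lia.
have [g gB Hg] := lst s; exists g; split; first exact/conductor_setE.
by move=> a /conductor_setE aB i; apply: Hg.
Qed.

End ValueFiltration.

(** * Large residue fields *)

Lemma inv_mul (T : comPzRingType) (a b c d x : T) :
  a * b = 1 -> c * d = 1 -> (a * c) * x = 1 -> x = b * d.
Proof.
move=> ab cd acx; transitivity ((a * b) * (c * d) * x); first by rewrite ab cd !mul1r.
transitivity (b * d * ((a * c) * x)); first ring.
by rewrite acx mulr1.
Qed.

Section ValuationLocalization.
Variables (R : comPzRingType) (M : set R) (maxM : max_ideal R M).
Hypotheses (nR : noetherian R) (rR : reduced R).
Local Notation Q := (total_ring R).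
Local Notation A := (loc_at maxM).
Local Notation S := (max_mulset maxM).
Local Notation l := (@to_loc R S).
Local Notation t := (@to_total R).
Local Notation tA := (@to_total A).

Lemma loc_unit_regular s : ~ M s -> regular (l s).
Proof. by move=> nMs; apply: unit_regular (linvP (S := S) nMs). Qed.

(** Regular elements of the localization lift to regular elements of [R] up to units, so the whole
    fraction can be written over [R], where [V] tests it. *)
Lemma total_loc_frac (q : total_ring A) :
  exists r s, regular s /\ q = tA (l r) * tinv (l s).
Proof.
have [a [b [rb ->]]] := totalE q.
have [x [s1 [rx Ms1 eb]]] := loc_regular_num nR rR rb.
have [r [s2 [Ms2 ea]]] := loc_fracE a.
have [x2 rx2 e2] := loc_regular_lift nR rR (loc_unit_regular Ms2).
have rX := loc_regular (maxM := maxM) rx; have rX2 := loc_regular (maxM := maxM) rx2.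
have rXX : regular (l (x2 * x)) by rewrite to_locM; exact: regularM.
exists (r * s1), (x2 * x); split; first exact: regularM.
apply: (scaleI (regular_total rXX)); apply: (scaleI (regular_total rb)).
transitivity (tA (l (x2 * x)) * tA a * (tA b * tinv b)); first ring.
rewrite tinvP // mulr1.
transitivity (tA b * tA (l (r * s1)) * (tA (l (x2 * x)) * tinv (l (x2 * x)))); last ring.
rewrite (tinvP rXX) mulr1 -[LHS]to_totalM -[RHS]to_totalM; congr to_total.
rewrite ea eb !to_locM e2.
transitivity (l x * l r * (l s2 * linv S s2)); first ring.
rewrite linvP // mulr1.
transitivity (l x * l r * (l s1 * linv S s1)); last ring.
by rewrite linvP // mulr1.
Qed.

(** [large_residue_fields] counts valuation rings over the localization at [M]; this map sends the
    valuation rings of [Q] with center [M] injectively to them. *)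
Definition vimg (V : set Q) : set (total_ring A) := [set q | exists r s,
  [/\ regular s, V (t r * tinv s) & q = tA (l r) * tinv (l s)]].

Section Image.
Variable V : set Q.
Hypothesis vV : valuation_rings R V.
Hypothesis VM : [set r | vmax V (t r)] = M.

Let rV : subring V. Proof. by case: vV. Qed.
Let mV : forall a b, ~ V a -> ~ V b -> ~ V (a * b). Proof. by case: vV. Qed.

(** Some [s] outside [M] kills [r]. If [t r * q] were outside [V], it would witness that [s] is in
    the center of [V], which is [M]. *)
Lemma vimg_kernel r q : l r = 0 -> V (t r * q).
Proof.
move=> /loc_at_eq0[s nMs sr]; apply: contrapT => nV; apply: nMs.
rewrite -VM /=; exists (t r * q); split=> //.
have -> : t r * q * t s = t (s * r) * q by rewrite to_totalM; ring.
by rewrite sr to_total0 mul0r; exact: ring0.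
Qed.

Lemma vimg_all r s : regular s -> vimg V (tA (l r) * tinv (l s)) -> V (t r * tinv s).
Proof.
move=> rs [r' [s' [rs' Vr' e]]].
have rl := loc_regular (maxM := maxM) rs; have rl' := loc_regular (maxM := maxM) rs'.
have l0 : l (r * s' - r' * s) = 0.
  apply: to_total_inj; rewrite to_locB !to_locM to_totalB !to_totalM to_total0.
  have -> : tA (l r) = tA (l r) * tinv (l s) * tA (l s).
    by rewrite -mulrA [tinv (l s) * _]mulrC (tinvP rl) mulr1.
  rewrite e.
  transitivity (tA (l r') * tA (l s) * (tA (l s') * tinv (l s')) - tA (l r') * tA (l s)); first ring.
  by rewrite (tinvP rl') mulr1 subrr.
have -> : t r * tinv s = t (r * s' - r' * s) * (tinv s * tinv s') + t r' * tinv s'.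
  rewrite to_totalB !to_totalM.
  transitivity (t r * tinv s * (t s' * tinv s') - t r' * tinv s' * (t s * tinv s) + t r' * tinv s'); last ring.
  by rewrite (tinvP rs) (tinvP rs') !mulr1 subrK.
exact: (ringD rV (vimg_kernel _ l0) Vr').
Qed.

Lemma vimg_valuation : valuation_rings A (vimg V).
Proof.
have rl s : regular s -> regular (l s) by exact: loc_regular.
have tl1 : tA (l 1) * tinv (l 1) = 1.
  by apply: tinvP; apply: rl => z; rewrite mul1r.
have r1 : regular (1 : R) by move=> z; rewrite mul1r.
have t1 : tinv 1 = 1 :> Q by rewrite -[LHS]mul1r -to_total1 tinvP.
have tlM s s' : regular s -> regular s' -> tinv (l (s * s')) = tinv (l s) * tinv (l s').
  move=> rs rs'; apply: inv_mul (tinvP (rl _ rs)) (tinvP (rl _ rs')) _.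
  by rewrite -to_totalM -to_locM; apply: tinvP; apply: rl; exact: regularM.
have tM (s s' : R) : regular s -> regular s' -> tinv (s * s') = tinv s * tinv s'.
  move=> rs rs'; apply: inv_mul (tinvP rs) (tinvP rs') _.
  by rewrite -to_totalM; apply: tinvP; exact: regularM.
split.
- split.
  + exists 1, 1; split; [exact: r1|by rewrite t1 to_total1 mulr1; exact: ring1|exact/esym].
  + move=> _ _ [r [s [rs Vr ->]]] [r' [s' [rs' Vr' ->]]].
    have rss : regular (s * s') by exact: regularM.
    exists (r * s' - r' * s), (s * s'); split; first exact: rss.
      rewrite (tM _ _ rs rs') to_totalB !to_totalM.
      have -> : (t r * t s' - t r' * t s) * (tinv s * tinv s')
        = t r * tinv s * (t s' * tinv s') - t r' * tinv s' * (t s * tinv s) by ring.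
      by rewrite (tinvP rs) (tinvP rs') !mulr1; apply: ringB.
    rewrite (tlM _ _ rs rs') to_locB !to_locM to_totalB !to_totalM.
    transitivity (tA (l r) * tinv (l s) * (tA (l s') * tinv (l s'))
      - tA (l r') * tinv (l s') * (tA (l s) * tinv (l s))); last ring.
    by rewrite (tinvP (rl _ rs)) (tinvP (rl _ rs')) !mulr1.
  + move=> _ _ [r [s [rs Vr ->]]] [r' [s' [rs' Vr' ->]]].
    exists (r * r'), (s * s'); split; first exact: regularM.
      by rewrite (tM _ _ rs rs') (to_totalM r r') mulrACA; apply: ringM.
    rewrite (tlM _ _ rs rs') (to_locM S r r') (to_totalM (l r) (l r')).
    by rewrite mulrACA.
- move=> _ [a _ <-]; have [r [s [Ms ->]]] := loc_fracE a.
  have [x rx ex] := loc_regular_lift nR rR (loc_unit_regular Ms).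
  exists r, x; split; first exact: rx.
    have nMx : ~ M x.
      move=> Mx; have /loc_at_eq0[u nMu ux] : l (x - s) = 0 by rewrite to_locB ex subrr.
      have iM := max_idl maxM; apply: (primeM (max_prime maxM) nMu Ms).
      have -> : u * s = u * x - u * (x - s) by ring.
      by rewrite ux subr0; apply: idlM.
    apply: (ringM rV); first by case: vV => _ sV _ _; apply: sV; exact: base_ring_to.
    by apply: (vmax_inv rV (tinvP rx)) => vx; apply: nMx; rewrite -VM.
  have rX := rl _ rx; apply: (scaleI (regular_total rX)).
  rewrite [RHS]mulrCA (tinvP rX) mulr1 -to_totalM; congr to_total.
  by rewrite ex mulrCA linvP // mulr1.
- move=> e; have [q nVq] : exists q, ~ V q.
    apply: contrapT => H; case: vV => _ _ nT _; apply: nT; apply/seteqP; split=> // q _.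
    by apply: contrapT => nVq; apply: H; exists q.
  have [r [s [rs eq]]] := totalE q; apply: nVq; rewrite eq.
  by apply: vimg_all => //; rewrite e.
- move=> q q'; have [r [s [rs ->]]] := total_loc_frac q.
  have [r' [s' [rs' ->]]] := total_loc_frac q' => nq nq' qq.
  have h : vimg V (tA (l (r * r')) * tinv (l (s * s'))).
    by rewrite (tlM _ _ rs rs') (to_locM S r r') (to_totalM (l r) (l r')) mulrACA.
  have := vimg_all (regularM rs rs') h; rewrite (tM _ _ rs rs') (to_totalM r r') mulrACA.
  apply: mV => [Vr|Vr']; [apply: nq|apply: nq'].
    by exists r, s.
  by exists r', s'.
Qed.

End Image.

Lemma vimg_inj V V' : valuation_rings R V -> valuation_rings R V' ->
  [set r | vmax V (t r)] = M -> [set r | vmax V' (t r)] = M -> vimg V = vimg V' -> V = V'.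
Proof.
have sub W W' : valuation_rings R W -> valuation_rings R W' -> [set r | vmax W (t r)] = M ->
    [set r | vmax W' (t r)] = M -> vimg W = vimg W' -> W `<=` W'.
  move=> vW vW' WM W'M e q Wq; have [r [s [rs eq]]] := totalE q; rewrite eq.
  by apply: (vimg_all vW' W'M) => //; rewrite -e; exists r, s; rewrite -eq.
by move=> vV vV' VM V'M e; apply/seteqP; split; apply: sub.
Qed.

End ValuationLocalization.

Section LargeResidue.
Variables (R : comPzRingType) (y : R) (L : nat).
Hypotheses (nR : noetherian R) (nch : ~ prime_chain R 2) (rR : reduced R).
Hypotheses (Jy : jacobson R y) (ry : regular y) (cL : cs L (pri y) setT).
Local Notation Q := (total_ring R).
Local Notation t := (@to_total R).
Local Notation vp := val_power.
Local Notation I := (value_index R).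
Local Notation B := (base_ring R).

Let vp1 := vp1 nR nch rR Jy ry cL.
Let vpM := vpM nR nch rR Jy ry cL.
Let vpB := vpB nR nch rR Jy ry cL.
Let vp_base := vp_base nR nch rR Jy ry cL.
Let vpMr := vpMr nR nch rR Jy ry cL.
Let veqM := veqM nR nch rR Jy ry cL.
Let veqD := veqD nR nch rR Jy ry cL.
Let vI (i : I) : valuation_rings R (\val i) := valsI i.

Hypothesis lrf : large_residue_fields R.

Definition center (i : I) : set R := [set r | vmax (\val i) (t r)].

Lemma center_max i : max_ideal R (center i).
Proof. exact: (vmax_contract nR nch rR (vI i)). Qed.

Lemma center_vp i r : center i r <-> vp (\val i) 1 (t r).
Proof. by split=> [h|/(vp1 (vI i))//]; apply/(vp1 (vI i)). Qed.

Lemma center_veq i r : ~ center i r -> veq (\val i) 0 (t r).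
Proof.
by move=> nr; split; [exact: vp_base (vI i) _|rewrite add0r => /center_vp].
Qed.

(** The injection provided by large residue fields, composed with [vimg], attaches different residue
    classes to the valuations centered at [M]; [rho] picks representatives. *)
Lemma distinct_residues M : max_ideal R M -> exists rho : I -> R,
  forall i j, center i = M -> center j = M -> M (rho i - rho j) -> i = j.
Proof.
move=> maxM; have /card_leP[f] := lrf maxM.
have finj a b : f a = f b -> a = b by apply: (@inj _ _ _ f); rewrite inE.
have mem i (h : center i = M) : (vimg (maxM := maxM) (\val i)) \in valuation_rings (loc_at maxM).
  by apply/mem_set/vimg_valuation => //; exact: vI.
have iM := max_idl maxM.
have /choice[rho Hrho] : forall i : I, exists r, forall h : center i = M,
    \val (f (SigSub (mem i h))) = [set x | M (x - r)].
  move=> i; have [h|nh] := pselect (center i = M); last by exists 0.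
  have /set_mem[r er] := valP (f (SigSub (mem i h))).
  by exists r => h'; rewrite (Prop_irrelevance h' h).
exists rho => i j hi hj Mij.
have : f (SigSub (mem i hi)) = f (SigSub (mem j hj)).
  apply: val_inj; rewrite Hrho Hrho; apply/seteqP; split=> x /= Mx.
    have -> : x - rho j = (x - rho i) + (rho i - rho j) by ring.
    exact: idlD.
  have -> : x - rho i = (x - rho j) - (rho i - rho j) by ring.
  exact: idlB.
move=> /finj/(congr1 \val) /= e; apply: val_inj.
exact: (vimg_inj (vI i) (vI j) hi hj e).
Qed.

(** A form of the Chinese remainder theorem: multiply factors that are [1] modulo the center of [i],
    one for each other center. *)
Lemma separate_centers i (l : seq I) : exists2 g, center i (1 - g) &
  forall j, j \in l -> center j <> center i -> center j g.
Proof.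
have mi := center_max i; have ii := max_idl mi.
elim: l => [|j l [g g1 gl]]; first by exists 1 => //; rewrite subrr; exact: idl0.
have [ji|nji] := pselect (center j = center i).
  by exists g => // k; rewrite inE => /orP[/eqP->|/gl].
have mj := center_max j; have ij := max_idl mj.
have [a ja nia] : exists2 a, center j a & ~ center i a.
  apply: contrapT => H; apply: nji; apply: max_eq => // a ja.
  by apply: contrapT => na; apply: H; exists a.
have [b hb] := max_inv mi nia; exists (g * (b * a)).
  have -> : 1 - g * (b * a) = (1 - g) + g * (1 - b * a) by ring.
  by apply: idlD => //; exact: idlM.
move=> k; rewrite inE => /orP[/eqP-> _|kl nki].
  by do 2![apply: idlM => //].
by apply: idlMr; [exact: max_idl (center_max k)|exact: gl].
Qed.

(* Adding one index [i] at a time: among the elements [c x + g z], with [c] running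
   through representatives of sufficiently many residue classes, each of the
   previous indices excludes at most one class. *)
Lemma generic_value (E : set Q) (a : I -> int) : submodule B E ->
  (forall i : I, jump E a i) ->
  exists2 x, E x & forall i : I, veq (\val i) (a i) x.
Proof.
move=> sE H; have [s [us sI]] := index_finite nR nch rR Jy ry cL.
have sW := submodule_Wf nR nch rR Jy ry cL a.
suff main : forall l : seq I, uniq l -> exists x, [/\ E x, Wf a x & forall i, i \in l -> veq (\val i) (a i) x].
  by have [x [Ex _ vx]] := main s us; exists x => // i; apply: vx.
elim=> [_|i l IH /= /andP[nil ul]].
  by exists 0; split=> //; [exact: sub0|exact: sub0].
have [x [Ex Wx vx]] := IH ul.
have [vxi|nvxi] := pselect (veq (\val i) (a i) x).
  by exists x; split=> // j; rewrite inE => /orP[/eqP->|/vx].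
have x1 : vp (\val i) (a i + 1) x.
  by apply: contrapT => h; apply: nvxi; split=> //; exact: Wx.
have [z [Ez Wz vz]] := H i.
have [g g1 gl] := separate_centers i s.
have [rho Hrho] := distinct_residues (center_max i).
pose T := [seq j <- s | `[< center j = center i >]].
(* Modulo the center of [i] this is [rho k], modulo the other centers it is [1]; so only the indices
   in [T] can be spoiled by the choice of [k]. *)
pose c k := g * rho k + (1 - g).
pose X k := t (c k) * x + t g * z.
have EX k : E (X k) by exact: (subD sE (subM sE (c k) Ex) (subM sE g Ez)).
have WX k : Wf a (X k) by exact: (subD sW (subM sW (c k) Wx) (subM sW g Wz)).
have ng : ~ center i g.
  move=> hg; apply: (max_n1 (center_max i)); rewrite -[1](subrK g).
  by apply: idlD => //; exact: max_idl (center_max i).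
have Xi k : veq (\val i) (a i) (X k).
  rewrite /X addrC; apply: veqD (vI i) _ _; last by apply: vpMr; [exact: vI|exact: x1].
  by have := veqM (vI i) (center_veq ng) vz; rewrite add0r.
have Xother j k : j \in l -> center j <> center i -> veq (\val j) (a j) (X k).
  move=> jl nji; have gj := gl j (sI j) nji.
  have ij := max_idl (center_max j).
  apply: veqD (vI j) _ _.
    suff nc : ~ center j (c k) by have := veqM (vI j) (center_veq nc) (vx j jl); rewrite add0r.
    move=> hc; apply: (max_n1 (center_max j)).
    have -> : 1 = c k - g * rho k + g by rewrite /c; ring.
    by apply: idlD => //; apply: idlB => //; apply: idlMr.
  have := vpM (vI j) ((center_vp j g).1 gj) (Wz j); by rewrite addrC.
suff [k kT Hk] : exists2 k, k \in T & forall j, j \in l -> center j = center i -> veq (\val j) (a j) (X k).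
  exists (X k); split=> // j; rewrite inE => /orP[/eqP->//|jl].
  by have [ji|nji] := pselect (center j = center i); [exact: Hk|exact: Xother].
apply: contrapT => nk.
have bad k : exists j, k \in T -> [/\ j \in l, center j = center i & vp (\val j) (a j + 1) (X k)].
  have [kT|nkT] := boolP (k \in T); last by exists k.
  apply: contrapT => nb; apply: nk; exists k => // j jl ji; split; first exact: WX.
  by move=> h; apply: nb; exists j.
have /choice[b Hb] := bad.
have injb : {in T &, injective b}.
  move=> k k' kT k'T ebk; have [jl ji h] := Hb k kT; have [_ _ h'] := Hb k' k'T.
  rewrite -ebk in h'; set j := b k in jl ji h h'.
  have cT m : m \in T -> center m = center i by rewrite mem_filter => /andP[/asboolP].
  apply: Hrho; [exact: cT|exact: cT|].
  rewrite -ji; apply: contrapT => nr.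
  have vd : veq (\val j) 0 (t (c k - c k')).
    apply: center_veq => hc; apply: nr.
    have ij := max_idl (center_max j).
    have g1j : center j (1 - g) by rewrite ji.
    have -> : rho k - rho k' = (c k - c k') + (1 - g) * (rho k - rho k') by rewrite /c; ring.
    by apply: idlD => //; apply: idlMr.
  have := veqM (vI j) vd (vx j jl); rewrite add0r => -[_]; apply.
  have -> : t (c k - c k') * x = X k - X k' by rewrite /X to_totalB; ring.
  by apply: vpB; first exact: vI.
(* If every [k] were bad, [b] would map [T] injectively into [T] without hitting [i]. *)
have : {subset i :: [seq b k | k <- T] <= T}.
  have bT k : k \in T -> b k \in T.
    by move=> kT; have [jl ji _] := Hb k kT; rewrite mem_filter sI andbT; apply/asboolP.
  move=> j; rewrite inE => /orP[/eqP->|/mapP[k kT ->]]; last exact: bT.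
  by rewrite mem_filter sI andbT; apply/asboolP.
have ui : uniq (i :: [seq b k | k <- T]).
  rewrite /= map_inj_in_uniq ?filter_uniq // andbT; apply/mapP => -[k kT e].
  by have [jl _ _] := Hb k kT; move: nil; rewrite e jl.
by move=> sub; have := uniq_leq_size ui sub; rewrite /= size_map ltnn.
Qed.

End LargeResidue.

(** * Duality of values *)

Section Duality.
Variables (R : comPzRingType) (y : R) (L : nat).
Hypotheses (nR : noetherian R) (nch : ~ prime_chain R 2) (rR : reduced R).
Hypotheses (Jy : jacobson R y) (ry : regular y) (cL : cs L (pri y) setT).
Hypotheses (ar : analytically_reduced R) (rat : residually_rational R).
Local Notation Q := (total_ring R).
Local Notation t := (@to_total R).
Local Notation vp := val_power.
Local Notation I := (value_index R).
Local Notation B := (base_ring R).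
Local Notation rfi := (@regular_fractional_ideal R).
Local Notation G := (value_set B).
Local Notation g := (conductor G).

Let vpM := vpM nR nch rR Jy ry cL.
Let vpB := vpB nR nch rR Jy ry cL.
Let vp_le := vp_le nR nch rR Jy ry cL.
Let vp_cases := vp_cases nR nch rR Jy ry cL.
Let vpMr := vpMr nR nch rR Jy ry cL.
Let veqM := veqM nR nch rR Jy ry cL.
Let veqD := veqD nR nch rR Jy ry cL.
Let veq_uniq := veq_uniq nR nch rR Jy ry cL.
Let veq_le := veq_le nR nch rR Jy ry cL.
Let vI (i : I) : valuation_rings R (\val i) := valsI i.
Let value_setP := value_setP nR nch rR Jy ry cL ar.
Let conductorP := conductorP nR nch rR Jy ry cL ar rat.
Let residue_mul := residue_mul nR nch rR Jy ry cL rat.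
Let WfM := WfM nR nch rR Jy ry cL.
Let Wf_le := Wf_le nR nch rR Jy ry cL.
Let submodule_Wf := submodule_Wf nR nch rR Jy ry cL.
Let uniform_I := uniform_I nR nch rR Jy ry cL.
Let exact_value := exact_value nR nch rR Jy ry cL.
Let sB := submodule_base R.

Lemma Wf_conductor : Wf g `<=` B. Proof. by have [] := conductorP. Qed.

Lemma conductor_le a : Wf a `<=` B -> forall i, (g i <= a i)%R.
Proof. by have [_] := conductorP; apply. Qed.

Lemma Wf_in E : rfi E -> exists d, Wf d `<=` E.
Proof.
move=> rE; have [sE _] := rE.1; have [z rz Ez] := regular_fractional_in rE.
have [n Hn] := uniform_I (tinv z); exists (fun i => - (- n%:Z) + g i) => x Wx.
have [|r e] := (base_ringP (tinv z * x)).1.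
  apply: Wf_conductor; apply: Wf_le (WfM Hn Wx) => i; lia.
have -> : x = t r * t z by rewrite -e mulrAC [tinv z * t z]mulrC (tinvP rz) mul1r.
exact: (subM sE).
Qed.

Lemma fractional_low (E : set Q) : fractional_ideal E -> exists a, E `<=` Wf a.
Proof.
move=> fE; have [c rc Hc] := fractional_den fE.
have [n Hn] := uniform_I (tinv c); exists (fun=> - n%:Z) => x Ex i.
have [r e] := Hc x Ex.
have -> : x = t r * tinv c by rewrite -e mulrAC (tinvP rc) mul1r.
by apply: vpMr; [exact: vI|exact: Hn].
Qed.

(** The element of a jump may have infinite values. Adding an element of [E] whose values [e] exceed
    [b] and all finite values of [x] makes every value finite and leaves the finite ones
    unchanged. *)
Lemma jump_value E b i : rfi E -> jump E b i <->
  exists2 v, value_set E v & v i = b i /\ forall j, (b j <= v j)%R.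
Proof.
move=> rE; have [sE _] := rE.1; split; last first.
  move=> [v /value_setP[x Ex vx] [vi bv]]; exists x; split=> //.
    by move=> j; have [h _] := vx j; exact: (vp_le (vI j) (bv j) h).
  by rewrite -vi; exact: vx.
move=> [x [Ex Wx vx]]; have [d dE] := Wf_in rE.
have /choice[e He] : forall j : I, exists e : int, [/\ (d j <= e)%R, (b j < e)%R &
    forall k, veq (\val j) k x -> (k < e)%R].
  move=> j; have [[k vk]|nk] := vp_cases (vI j) x.
    exists (Num.max (d j) (Num.max (b j) k + 1)); split; [lia|lia|].
    by move=> k' vk'; have := veq_uniq (vI j) vk vk'; lia.
  exists (Num.max (d j) (b j + 1)); split; [lia|lia|] => k [_ h].
  by case: h; exact: nk.
have [w vw] := exact_value e.
have Ew : E w.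
  by apply: dE => j; have [de _ _] := He j; have [h _] := vw j; exact: (vp_le (vI j) de h).
have /choice[v Hv] : forall j : I, exists k, veq (\val j) k (x + w) /\ (b j <= k)%R.
  move=> j; have [_ be ke] := He j; have [[k vk]|nk] := vp_cases (vI j) x.
    exists k; split; last exact: (veq_le (vI j) vk (Wx j)).
    apply: (veqD (vI j) vk); apply: (vp_le (vI j)) (vw j).1; have := ke k vk; lia.
  by exists (e j); split; [rewrite addrC; exact: (veqD (vI j) (vw j) (nk _))|lia].
exists v; first by apply/value_setP; exists (x + w); [exact: (subD sE)|move=> j; have [] := Hv j].
split=> [|j]; last by have [] := Hv j.
have [_ be _] := He i; have [h _] := Hv i; apply: (veq_uniq (vI i)) h _.
apply: (veqD (vI i) vx); apply: (vp_le (vI i)) (vw i).1; lia.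
Qed.

Definition lower (b : I -> int) (i : I) : I -> int := fun j => b j - (j == i)%:Z.

Lemma lowerE b i : lower b i i = b i - 1. Proof. by rewrite /lower eqxx. Qed.

Lemma lower_le b i j : (lower b i j <= b j)%R. Proof. by rewrite /lower; lia. Qed.

(** As [tau] is [g - 1], the strict inequalities of [Delta] say that [v j] is at least [g j - a j],
    and its equality says that [v i] is [g i - a i - 1]. *)
Lemma Delta_jump E a : rfi E ->
  Delta_in (value_set E) (fun i => tau G i - a i) = set0 <->
  forall i, ~ jump E (lower (fun j => g j - a j) i) i.
Proof.
move=> rE; split=> [e0 i /(jump_value _ _ rE)[v vE [vi bv]]|H].
  suff : Delta_in (value_set E) (fun i => tau G i - a i) v by rewrite e0.
  split=> //; exists i; split; first by rewrite vi lowerE /tau; lia.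
  by move=> j /eqP ji; have := bv j; rewrite /lower (negbTE ji) /tau; lia.
apply/seteqP; split=> // v [[i [vi bv]] vE]; case: (H i); apply/(jump_value _ _ rE).
exists v => //; split; first by rewrite vi lowerE /tau; lia.
move=> j; rewrite /lower; have [->|/eqP ji] := eqVneq j i; first by rewrite vi /tau; lia.
by have := bv j ji; rewrite /tau; lia.
Qed.

Lemma Wf_step b i x z : Wf (lower b i) x -> Wf (lower b i) z ->
  veq (\val i) (b i - 1) z -> exists r, Wf b (x - t r * z).
Proof.
move=> Wx Wz vz; have [|r hr] := residue_mul (i := i) (x := x) _ vz.
  by rewrite -lowerE; exact: Wx.
exists r => j; have [->|ji] := eqVneq j i; first by rewrite subrK in hr.
have := subB (submodule_Wf (lower b i)) Wx (subM (submodule_Wf (lower b i)) r Wz).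
by move=> /(_ j); rewrite /lower (negbTE ji) subr0.
Qed.

(* By minimality the conductor cannot be lowered in a single coordinate. *)
Lemma conductor_gap i x : B x -> Wf (lower g i) x -> ~ veq (\val i) (g i - 1) x.
Proof.
move=> Bx Wx vx; have : Wf (lower g i) `<=` B.
  move=> w Ww; have [r hr] := Wf_step Ww Wx vx.
  rewrite -[w](subrK (t r * x)); apply: (subD sB); first exact: Wf_conductor.
  exact: (subM sB).
by move=> /conductor_le /(_ i); rewrite lowerE; lia.
Qed.

Lemma submodule_colon E : submodule B (colon B E).
Proof.
apply: mk_sub => [z _|x x' hx hx' z Ez|r x hx z Ez].
- by rewrite mul0r; exact: (sub0 sB).
- by rewrite mulrDl; apply: (subD sB); [exact: hx|exact: hx'].
- by rewrite -mulrA; apply: (subM sB); exact: hx.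
Qed.

Lemma rfi_colon E : rfi E -> rfi (colon B E).
Proof.
move=> rE; have [z rz Ez] := regular_fractional_in rE.
have [c rc Hc] := fractional_den rE.1.
split; first split; first exact: submodule_colon.
  exists (t z); first by split; [exact: base_ring_to|exact: regular_total].
  by move=> x hx; rewrite mulrC; exact: hx.
exists (t c); split; last exact: regular_total.
by move=> x /Hc[r ->]; exact: base_ring_to.
Qed.

Lemma colon_colon E : E `<=` colon B (colon B E).
Proof. by move=> x Ex z hz; rewrite mulrC; exact: hz. Qed.

Lemma jump_colon E a i : jump (colon B E) a i -> ~ jump E (lower (fun j => g j - a j) i) i.
Proof.
move=> [x [hx Wx vx]] [z [Ez Wz vz]]; apply: (conductor_gap (i := i) (hx z Ez)).
  by apply: Wf_le (WfM Wx Wz) => j; rewrite /lower; lia.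
have := veqM (vI i) vx vz; rewrite lowerE.
by have -> : a i + (g i - a i - 1) = g i - 1 by lia.
Qed.

Lemma jump_ext (E : set Q) b b' i : (forall j, b j = b' j) -> jump E b i -> jump E b' i.
Proof. by move=> /funext ->. Qed.

(** If [q] had value [k < g i - b i] at [i], take [w] in [Wf b] of value [g i - 1 - k] at [i] and so
    large elsewhere that it outweighs the poles of [q]: the product [q * w] contradicts
    [conductor_gap]. *)
Lemma colon_Wf q b : (forall w, Wf b w -> B (q * w)) -> Wf (fun j => g j - b j) q.
Proof.
move=> H i; apply: contrapT => nq.
have [[k vk]|all] := vp_cases (vI i) q; last by apply: nq; exact: all.
have ki : (k < g i - b i)%R.
  rewrite ltNge; apply/negP => h; apply: nq; exact: (vp_le (vI i) h vk.1).
have [n Hn] := uniform_I q.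
have [w vw] := exact_value
  (fun j => if j == i then g i - 1 - k else Num.max (b j) (g j + n%:Z)).
apply: (conductor_gap (i := i) (x := q * w)).
- apply: H => j; have [h _] := vw j; apply: (vp_le (vI j)) h.
  by case: eqP => [->|_]; lia.
- move=> j; rewrite /lower; have [h _] := vw j; have [ji|ji] := eqVneq j i.
    rewrite ji eqxx in h *; apply: (vp_le (vI i)) (vpM (vI i) vk.1 h); lia.
  rewrite (negbTE ji) in h; apply: (vp_le (vI j)) (vpM (vI j) (Hn j) h); lia.
- have := vw i; rewrite eqxx => h; have := veqM (vI i) vk h.
  by have -> : k + (g i - 1 - k) = g i - 1 by lia.
Qed.

Definition addW (E : set Q) b : set Q := [set x | exists u w, [/\ E u, Wf b w & x = u + w]].

Lemma rfi_addW E b : rfi E -> rfi (addW E b).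
Proof.
move=> rE; have [sE _] := rE.1; have sW := submodule_Wf b.
have [z rz Ez] := regular_fractional_in rE.
have [c rc Hc] := fractional_den rE.1.
(* Multiplication by [x], hence by its numerator [r], carries [Wf b] into [R]; so [c * r] is a
   common denominator. *)
have [x vx] := exact_value (fun j => g j - b j).
have [r [s [rs e]]] := total_frac x.
have rx : regular x.
  by apply: (veq_regular nR nch rR Jy ry cL ar) => j; exists (g j - b j).
have rr : regular r.
  by apply: regular_to_total; rewrite -e; apply: regularM => //; exact: regular_total.
split; first split.
- apply: mk_sub.
  + by exists 0, 0; split; [exact: (sub0 sE)|exact: (sub0 sW)|rewrite addr0].
  + move=> _ _ [u [w [Eu Ww ->]]] [u' [w' [Eu' Ww' ->]]]; exists (u + u'), (w + w').
    by split; [exact: (subD sE)|exact: (subD sW)|rewrite addrACA].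
  + move=> a _ [u [w [Eu Ww ->]]]; exists (t a * u), (t a * w).
    by split; [exact: (subM sE)|exact: (subM sW)|rewrite mulrDr].
- exists (t (c * r)).
    by split; [exact: base_ring_to|apply: regular_total; exact: regularM].
  move=> _ [u [w [Eu Ww ->]]]; rewrite mulrDr; apply: (subD sB).
    have [a ea] := Hc u Eu; rewrite (to_totalM c r) [t c * t r]mulrC -mulrA ea.
    by apply: (subM sB); exact: base_ring_to.
  rewrite (to_totalM c r) -e -!mulrA; apply: (subM sB); apply: (subM sB).
  apply: Wf_conductor; apply: Wf_le (WfM (fun j => (vx j).1) Ww) => j; lia.
- exists (t z); split; last exact: regular_total.
  by exists (t z), 0; split; [|exact: (sub0 sW)|rewrite addr0].
Qed.

Definition reflexive_ideals := forall E, rfi E -> colon B (colon B E) `<=` E.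

(* If [E] has no jump at [b], then adding [Wf b] or [Wf (lower b i)] to [E]
   gives different ideals; reflexivity separates them by an element of the colon. *)
Lemma jump_colon_reflexive E a i : reflexive_ideals -> rfi E ->
  ~ jump E (lower (fun j => g j - a j) i) i -> jump (colon B E) a i.
Proof.
move=> refl rE nj; set b := fun j => g j - a j in nj *; have [sE _] := rE.1.
have [z vz] := exact_value (lower b i).
have vzi := vz i; rewrite lowerE in vzi.
have Wz : Wf (lower b i) z by move=> j; have [] := vz j.
have nFz : ~ addW E b z.
  move=> [u [w [Eu Ww e]]]; apply: nj; exists u; split=> //.
    have -> : u = z - w by rewrite e addrK.
    apply: (subB (submodule_Wf _) Wz); apply: Wf_le Ww => j; exact: lower_le.
  have -> : u = z + - w by rewrite e addrK.
  rewrite lowerE; apply: (veqD (vI i) vzi); rewrite subrK.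
  exact: (subN (submodule_Wf b) Ww).
have /existsNP[q /not_implyP[hq nqz]] : ~ colon B (colon B (addW E b)) z.
  by move=> /(refl _ (rfi_addW b rE)).
have qE u : E u -> B (q * u).
  by move=> Eu; apply: hq; exists u, 0; split; [|exact: (sub0 (submodule_Wf b))|rewrite addr0].
have Wq : Wf a q.
  have : Wf (fun j => g j - b j) q.
    apply: colon_Wf => w Ww; apply: hq; exists 0, w.
    by split; [exact: (sub0 sE)| |rewrite add0r].
  by apply: Wf_le => j; rewrite /b; lia.
exists q; split=> //; split; first exact: Wq.
move=> h; apply: nqz; rewrite mulrC; apply: Wf_conductor.
(* If the value of [q] at [i] exceeded [a i], the product of [q] and [z] would lie in [Wf g], inside
   [R]. *)
have Wq' : Wf (fun j => a j + (j == i)%:Z) q.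
  by move=> j; have [->|_] := eqVneq j i; [exact: h|rewrite addr0; exact: Wq].
apply: Wf_le (WfM Wq' Wz) => j; rewrite /lower /b; lia.
Qed.

Lemma reflexive_value_set E : large_residue_fields R -> reflexive_ideals -> rfi E ->
  value_set (colon B E) =
  [set a | Delta_in (value_set E) (fun i => tau G i - a i) = set0].
Proof.
move=> lrf refl rE; apply/seteqP; split=> a /=.
  move=> /value_setP[x hx vx]; apply/(Delta_jump _ rE) => i; apply: jump_colon.
  by exists x; split=> // j; have [] := vx j.
move=> /(Delta_jump _ rE) H; apply/value_setP.
apply: (generic_value nR nch rR Jy ry cL lrf (submodule_colon E)) => i.
exact: jump_colon_reflexive.
Qed.

Hypothesis formula : forall E, rfi E -> value_set (colon B E) =
  [set a | Delta_in (value_set E) (fun i => tau G i - a i) = set0].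

(* A minimal [b' <= b] with [b' i = b i] at which [E] still does not jump in
   the direction [i] has no jump in any direction, so [g - b'] is a value of
   the colon. *)
Lemma jump_colon_formula E a i : rfi E ->
  ~ jump E (lower (fun j => g j - a j) i) i -> jump (colon B E) a i.
Proof.
move=> rE; set b := fun j => g j - a j => nj.
have [s [us sI]] := fin_index nR nch rR Jy ry cL.
have [lo Elo] := fractional_low rE.1.
suff [b' [b'b b'i Hb']] : exists b', [/\ forall j, (b' j <= b j)%R, b' i = b i &
    forall j, ~ jump E (lower b' j) j].
  have : value_set (colon B E) (fun j => g j - b' j).
    rewrite formula //; apply/(Delta_jump _ rE) => j h; apply: (Hb' j).
    by apply: jump_ext h => k; rewrite /lower; lia.
  move=> /value_setP[x hx vx]; exists x; split=> //.
    move=> j; apply: (vp_le (vI j)) (vx j).1; have := b'b j; rewrite /b; lia.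
  by have := vx i; have -> : g i - b' i = a i by rewrite b'i /b; lia.
pose l j := Num.min (lo j) (b j).
have main m : forall b', (forall j, (l j <= b' j)%R) -> (forall j, (b' j <= b j)%R) ->
    b' i = b i -> ~ jump E (lower b' i) i ->
    (\sum_(j <- s) absz (b' j - l j)%R <= m)%N ->
  exists b', [/\ forall j, (b' j <= b j)%R, b' i = b i & forall j, ~ jump E (lower b' j) j].
  elim: m => [|m IH] b' lb' b'b b'i nj' hm.
    exists b'; split=> // j [x [Ex Wx vx]].
    have := veq_le (vI j) vx (Elo x Ex j); rewrite lowerE.
    by move: hm; rewrite (bigD1_seq j) //= leqn0 addn_eq0 => /andP[]; have := lb' j; rewrite /l; lia.
  have [Hj|/existsNP[j /contrapT hj]] := pselect (forall j, ~ jump E (lower b' j) j).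
    by exists b'; split.
  have ji : j != i by apply/eqP => e; apply: nj'; rewrite -e.
  have [x [Ex Wx vx]] := hj; have lx := veq_le (vI j) vx (Elo x Ex j).
  rewrite lowerE in vx lx.
  apply: (IH (lower b' j)).
  - by move=> k; rewrite /lower; have [->|_] := eqVneq k j; have := lb' k; have := lb' j; rewrite /l; lia.
  - by move=> k; have := lower_le b' j k; have := b'b k; lia.
  - by rewrite /lower [i == j]eq_sym (negbTE ji) subr0.
  (* Subtracting a multiple of [x] from [z] repairs its value at [j] and keeps its value at [i],
     where [x] has value at least [b' i]; this would be a jump excluded by [nj']. *)
  - move=> [z [Ez Wz vz]]; apply: nj'.
    have ei : lower b' j i = b' i by rewrite /lower [i == j]eq_sym (negbTE ji) subr0.
    rewrite lowerE ei in vz.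
    have [|r hr] := residue_mul (i := j) (x := z) (k := b' j - 1) _ vx.
      by have := Wz j; rewrite /lower eqxx (negbTE ji) subr0.
    have [sE _] := rE.1; exists (z - t r * x); split.
    + by apply: (subB sE) => //; exact: (subM sE).
    + move=> k; have [->|kj] := eqVneq k j; first by rewrite /lower (negbTE ji) subr0; rewrite subrK in hr.
      apply: (vpB (vI k)); first by have := Wz k; rewrite /lower (negbTE kj) subr0.
      apply: (vpMr (vI k)); apply: (vp_le (vI k)) (Wx k); rewrite /lower (negbTE kj); lia.
    + rewrite lowerE; apply: (veqD (vI i) vz); rewrite subrK.
      have := subN (submodule_Wf _) (subM (submodule_Wf _) r Wx).
      by move=> /(_ i); rewrite ei.
  - move: hm; rewrite !(bigD1_seq j) //= lowerE.
    have -> : (\sum_(k <- s | k != j) absz (lower b' j k - l k)%R =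
              \sum_(k <- s | k != j) absz (b' k - l k)%R)%N.
      by apply: eq_bigr => k kj; rewrite /lower (negbTE kj) subr0.
    have := lb' j; move: (\sum_(k <- s | k != j) _)%N => S; move: lx; rewrite /l; lia.
apply: (main _ b) (leqnn _) => // j; rewrite /l; lia.
Qed.

Lemma formula_reflexive : reflexive_ideals.
Proof.
move=> E rE x hx; have [sE _] := rE.1; have [d dE] := Wf_in rE.
have [a Ea] := fractional_low (rfi_colon (rfi_colon rE)).1.
have sub : colon B (colon B E) `&` Wf a `<=` E.
  apply: (Wf_descent nR nch rR Jy ry cL rat sE (submodule_colon _) (@colon_colon E) (d := d)).
    by move=> z [_ Wz]; exact: dE.
  move=> b _ i hb; apply: contrapT => nb.
  apply: (jump_colon (a := b) hb).
  (* With this [c], lowering [g - c] at [i] gives back [b], so a missing jump of [E] at [b] produces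
     the jump of the colon that [jump_colon] forbids. *)
  pose c := lower (fun j => g j - b j) i.
  have : jump (colon B E) c i.
    apply: jump_colon_formula => // h; apply: nb.
    by apply: jump_ext h => j; rewrite /c /lower; lia.
  by apply: jump_ext => j.
by apply: sub; split=> //; exact: Ea.
Qed.

End Duality.

(** * Reflexivity and type one *)

Section ReflexiveType.
Variable R : comPzRingType.
Local Notation Q := (total_ring R).
Local Notation t := (@to_total R).
Local Notation B := (base_ring R).

(** For a regular [z] in [E], a denominator [c] of [E] and [x = z c], every [a] in [dual x F] gives
    an element [a / z] of the colon. An element of the bidual of [E] thus yields one of the bidual
    of [F], which is [F] by [dualK]. *)
Lemma typ1_reflexive : noetherian R -> ~ prime_chain R 2 ->
  (forall x, regular x -> forall M, max_ideal R M -> M x -> typ1 M x) -> reflexive_ideals R.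
Proof.
move=> nR nch t1 E rE q hq; have [sE _] := rE.1.
have [z rz Ez] := regular_fractional_in rE.
have [c rc Hc] := fractional_den rE.1.
have iF := idl_pull sE c; set F := pull E c in iF.
have Fx : F (z * c).
  by rewrite /F /pull /= (to_totalM z c) -mulrA (tinvP rc) mulr1.
have [|r er] := (base_ringP (q * t c)).1.
  by apply: hq => x /Hc[r ->]; exact: base_ring_to.
have -> : q = t r * tinv c by rewrite -er -mulrA (tinvP rc) mulr1.
suff : F r by [].
have rx := regularM rz rc.
rewrite -(dualK nR nch rx (t1 _ rx) iF Fx) => a ha.
have hcol : colon B E (t a * tinv z).
  move=> x Ex; have [b Fb ->] := pull_in rc (Hc x Ex) Ex.
  have [d ed] := ha b Fb.
  apply/base_ringP; exists d.
  apply: (scaleI (regular_total rz)); apply: (scaleI (regular_total rc)).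
  transitivity (t a * t b * (t z * tinv z) * (t c * tinv c)); first ring.
  rewrite (tinvP rz) (tinvP rc) !mulr1 -[LHS]to_totalM ed (to_totalM d) (to_totalM z); ring.
have [d ed] := (base_ringP _).1 (hq _ hcol).
exists d; apply: to_total_inj.
rewrite (to_totalM r) -er (to_totalM d) (to_totalM z) -ed.
transitivity (q * t c * t a * (t z * tinv z)); last ring.
by rewrite (tinvP rz) mulr1.
Qed.

(* Apply reflexivity to [E = R + R u] with [u = r / x]: its colon is [M]. *)
Lemma reflexive_typ1 : reflexive_ideals R ->
  forall x, regular x -> forall M, max_ideal R M -> M x -> typ1 M x.
Proof.
move=> refl x rx M mM Mx r s Mr Ms nr.
pose u := t r * tinv x; pose E : set Q := [set q | exists b a, q = t b + t a * u].
have frac a b : pri x b -> t a * (t b * tinv x) = t (a * b) * tinv x.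
  by rewrite (to_totalM a) mulrA.
have E1 : E 1 by exists 1, 0; rewrite to_total0 mul0r addr0.
have sE : submodule B E.
  apply: mk_sub.
  - by exists 0, 0; rewrite to_total0 mul0r addr0.
  - move=> _ _ [b [a ->]] [b' [a' ->]]; exists (b + b'), (a + a').
    by rewrite !to_totalD mulrDl addrACA.
  - move=> c _ [b [a ->]]; exists (c * b), (c * a).
    by rewrite !to_totalM mulrDr mulrA.
have rE : regular_fractional_ideal E.
  split; last by exists 1; split=> // z; rewrite mul1r.
  split=> //; exists (t x); first by split; [exact: base_ring_to|exact: regular_total].
  move=> _ [b [a ->]]; apply/base_ringP; exists (x * b + a * r).
  rewrite to_totalD !to_totalM mulrDr; congr (_ + _).
  transitivity (t a * t r * (t x * tinv x)); first by rewrite /u; ring.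
  by rewrite (tinvP rx) mulr1.
have divx m b : pri x (m * b) -> B (t m * (t b * tinv x)).
  move=> [a e]; apply/base_ringP; exists a.
  by rewrite mulrA -[t m * t b]to_totalM e (to_totalM a) -mulrA (tinvP rx) mulr1.
pose K := [set a | colon B E (t a)].
have iK : idl K.
  have sC := submodule_colon E.
  apply: mk_idl => [|a b ha hb|a b hb]; rewrite /K /=.
  - by rewrite to_total0; exact: (sub0 sC).
  - by rewrite to_totalD; exact: (subD sC).
  - by rewrite to_totalM; exact: (subM sC).
have MK : M `<=` K.
  move=> m Mm _ [b [a ->]]; rewrite mulrDr; apply: (subD (submodule_base R)).
    by rewrite -[t m * t b]to_totalM; exact: base_ring_to.
  by rewrite mulrCA; apply: (subM (submodule_base R)); apply: divx; exact: Mr.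
have KM : K = M.
  have [_ _ /(_ K iK MK)[//|KT]] := mM.
  have K1 : K 1 by rewrite KT.
  have /base_ringP[a ea] : B (t 1 * u).
    by apply: K1; exists 0, 1; rewrite to_total0 add0r to_total1 mul1r.
  case: nr; exists a; apply: to_total_inj.
  by rewrite (to_totalM a) -ea to_total1 mul1r /u -mulrA [tinv x * _]mulrC (tinvP rx) mulr1.
(* The colon consists of elements of [M], and these carry [s / x] into [R]; so [s / x] is in the
   bidual of [E], that is, in [E]. *)
have [b [a e]] : E (t s * tinv x).
  apply: refl => // q hq.
  have /base_ringP[m em] : B q by rewrite -[q]mulr1; exact: hq.
  have Mm : M m by rewrite -KM /K /= -em.
  by rewrite em mulrC; apply: divx; exact: Ms.
exists a; exists b; apply: to_total_inj.
rewrite to_totalB !to_totalM.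
have -> : t s = t x * (t b + t a * u).
  by rewrite -e mulrCA (tinvP rx) mulr1.
transitivity (t b * t x + t a * t r * (t x * tinv x) - t a * t r); first by rewrite /u; ring.
by rewrite (tinvP rx) mulr1 addrK.
Qed.

End ReflexiveType.

Unset Implicit Arguments.

Theorem proposition5p3p7 (R : comPzRingType) (admR : admissible R) :
  gorenstein R <->
  (forall E : set (total_ring R), regular_fractional_ideal E ->
     value_set (colon (base_ring R) E) =
     [set alpha : value_index R -> int |
        Delta_in (value_set E)
          (fun i => tau (value_set (base_ring R)) i - alpha i) = set0]).
Proof.
have [cm sl ar rat lrf] := admR; have [nR [_ dim1] _] := cm.
have nch : ~ prime_chain R 2 by move=> /dim1.
have rR := admissible_reduced cm ar.
have [y Jy ry] := jacobson_regular cm rR sl.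
have [L cL] := cs_exists nR nch (idl_pri y) (@idlT R) (@subsetT _ _) (pri_id y) ry.
split=> [/(gorenstein_typ1 cm rR) t1 E rE|formula].
  apply: (reflexive_value_set nR nch rR Jy ry cL ar rat lrf _ rE).
  exact: (typ1_reflexive nR nch t1).
apply/(gorenstein_typ1 cm rR); apply: reflexive_typ1.
exact: (formula_reflexive nR nch rR Jy ry cL ar rat formula).
Qed.
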